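(* Let $K$ be an infinite locally compact abelian topological group. Then the following conditions are equivalent: (a) $K$ is hereditarily minimal; (b) $K$ is densely minimal; (c) $K$ is (topologically) isomorphic to $\mathbb{Z}_p$ for some prime $p$.
   Context: All topological groups are assumed to be Hausdorff; subgroups carry the subspace topology, and isomorphism of topological groups means topological isomorphism. A Hausdorff topological group $(G,\tau)$ is minimal if there exists no Hausdorff group topology on $G$ that is strictly coarser than $\tau$. A topological group is hereditarily minimal if every subgroup of it is minimal, and densely minimal if every dense subgroup of it is minimal. $\mathbb{Z}_p$ denotes the group of $p$-adic integers with its usual compact topology. *)

(* Defs.v *)
From HB Require Import structures.
From mathcomp Require Import all_boot all_order all_algebra.
From mathcomp Require Import boolp classical_sets functions cardinality.
From mathcomp Require Import topology tvs.

Set Implicit Arguments.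
Unset Strict Implicit.
Unset Printing Implicit Defensive.

Import GRing.Theory.

Local Open Scope classical_set_scope.
Local Open Scope ring_scope.

Definition subgroup (G : topologicalZmodType) (H : zmodClosed G) : Type :=
  {x : G | x \in H}.

Section Subgroup.
Variables (G : topologicalZmodType) (H : zmodClosed G).
Local Notation S := (subgroup H).

Definition subgroup_val : S -> G := sval.

HB.instance Definition _ := [isSub for subgroup_val].
HB.instance Definition _ := [Choice of S by <:].
HB.instance Definition _ := [SubChoice_isSubZmodule of S by <:].
HB.instance Definition _ := Topological.copy S (initial_topology subgroup_val).

Lemma continuous_to_subgroup (T : topologicalType) (f : T -> S) :
  continuous (subgroup_val \o f) -> continuous f.
Proof.
move=> /continuousP cf; apply/continuousP => _ [U oU <-].
by rewrite -comp_preimage; exact: cf.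
Qed.

Lemma subgroup_val_continuous : continuous subgroup_val.
Proof. exact: initial_continuous. Qed.

Lemma subgroup_sub_continuous : continuous (fun x : S * S => x.1 - x.2).
Proof.
apply: continuous_to_subgroup.
rewrite (_ : _ \o _ = (fun z : G * G => z.1 - z.2) \o
    (fun x : S * S => (subgroup_val x.1, subgroup_val x.2))); last first.
  by apply/funext => x; exact: (raddfB (val : S -> G)).
move=> x; apply: continuous_comp; last exact: sub_continuous.
apply: cvg_pair => /=.
  by apply: continuous_comp; [exact: cvg_fst|exact: subgroup_val_continuous].
by apply: continuous_comp; [exact: cvg_snd|exact: subgroup_val_continuous].
Qed.

HB.instance Definition _ :=
  PreTopologicalNmodule_isTopologicalZmodule.Build S subgroup_sub_continuous.

End Subgroup.

(* A topology on the set underlying [G] is given by a structure of type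
   [Topological G], as for the library's [sup_topology]; the choice operator
   it also contains plays no role. *)
Definition is_group_topology (G : zmodType) (tau : Topological G) : Prop :=
  let T := Topological.Pack tau in
  continuous (fun x : T * T => (x.1 : G) + (x.2 : G) : T) /\
  continuous (fun x : T => - (x : G) : T).

Definition minimal (G : topologicalZmodType) : Prop :=
  hausdorff_space G /\
  ~ exists tau : Topological G,
      [/\ is_group_topology tau,
          hausdorff_space (Topological.Pack tau) &
          (@open (Topological.Pack tau) : set (set G)) `<` @open G].

Definition hereditarily_minimal (G : topologicalZmodType) : Prop :=
  forall H : zmodClosed G, minimal (subgroup H).

Definition densely_minimal (G : topologicalZmodType) : Prop :=
  forall H : zmodClosed G, dense [set` H] -> minimal (subgroup H).

Definition topologically_isomorphic (G L : topologicalZmodType) : Prop :=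
  exists (f : {additive G -> L}) (g : L -> G),
    [/\ cancel f g, cancel g f, continuous f & continuous g].

Section Product.
Variables (I : Type) (T : I -> topologicalZmodType).
Local Notation P := (prod_topology T).

Let add (x y : P) : P := fun i => x i + y i.
Let opp (x : P) : P := fun i => - x i.
Let zero : P := fun i => 0.

Let addA : associative add.
Proof. by move=> x y z; apply/functional_extensionality_dep => i; exact: addrA. Qed.
Let addC : commutative add.
Proof. by move=> x y; apply/functional_extensionality_dep => i; exact: addrC. Qed.
Let add0 : left_id zero add.
Proof. by move=> x; apply/functional_extensionality_dep => i; exact: add0r. Qed.
Let addN : left_inverse zero opp add.
Proof. by move=> x; apply/functional_extensionality_dep => i; exact: addNr. Qed.

HB.instance Definition _ := GRing.isZmodule.Build P addA addC add0 addN.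

Lemma prod_proj_continuous i : continuous (fun x : P => x i).
Proof.
move=> x; have /cvg_sup /(_ i) xi : x --> x by exact: cvg_id.
move=> A Ax; apply: xi.
exact: (@initial_continuous _ _ (fun f : P => f i) x A Ax).
Qed.

Lemma continuous_to_prod (U : topologicalType) (f : U -> P) :
  (forall i, continuous (fun u => f u i)) -> continuous f.
Proof.
move=> cf x; apply/cvg_sup => i.
move=> A [_ [[B oB <-] Bfx sBA]]; apply: (filterS sBA).
by apply: (cf i x); exact: open_nbhs_nbhs.
Qed.

Lemma prod_sub_continuous : continuous (fun x : P * P => x.1 - x.2).
Proof.
apply: continuous_to_prod => i x.
apply: (@continuous_comp _ _ _ (fun x : P * P => (x.1 i, x.2 i))
  (fun z : T i * T i => z.1 - z.2)); last exact: sub_continuous.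
apply: cvg_pair => /=.
  by apply: (@continuous_comp _ _ _ fst (fun y : P => y i));
     [exact: cvg_fst|exact: prod_proj_continuous].
by apply: (@continuous_comp _ _ _ snd (fun y : P => y i));
   [exact: cvg_snd|exact: prod_proj_continuous].
Qed.

HB.instance Definition _ :=
  PreTopologicalNmodule_isTopologicalZmodule.Build P prod_sub_continuous.

End Product.

Section DiscreteZmodule.
Variable V : zmodType.
Local Notation D := (discrete_topology V).

HB.instance Definition _ := GRing.Zmodule.copy D V.

Lemma discrete_sub_continuous : continuous (fun x : D * D => x.1 - x.2).
Proof.
move=> [x y]; apply/discrete_cvg; exists ([set x], [set y]) => /=.
  by split; exact: discrete_set1.
by move=> [a b] [/= -> ->].
Qed.

HB.instance Definition _ :=
  PreTopologicalNmodule_isTopologicalZmodule.Build D discrete_sub_continuous.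

End DiscreteZmodule.

Section Padic.
(* Meaningful for [1 < p] only: ['Z_0] and ['Z_1] denote Z/2Z. *)
Variable p : nat.

Definition padic_product : topologicalZmodType :=
  prod_topology (fun n => discrete_topology 'Z_(p ^ n.+1)).

(* [x n.+1] is reduced modulo [p ^ n.+1] through its representative in nat. *)
Definition padic_coherent : {pred padic_product} :=
  fun x => `[< forall n, (x n.+1 : 'Z_(p ^ n.+2))%:R = x n :> 'Z_(p ^ n.+1) >].

Lemma padic_modulus_dvd n :
  ((Zp_trunc (p ^ n.+1)).+2 %| (Zp_trunc (p ^ n.+2)).+2)%N.
Proof.
case: p => [|[|q]]; [by rewrite !exp0n|by rewrite !exp1n|].
have q1 k : (1 < q.+2 ^ k.+1)%N
  by have := ltn_exp2r 1 q.+2 (ltn0Sn k); rewrite exp1n => ->.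
by rewrite !Zp_cast // dvdn_exp2l.
Qed.

Lemma padic_coherent_zmod_closed : zmod_closed padic_coherent.
Proof.
split; first by apply/asboolP => n.
move=> x y /asboolP xc /asboolP yc; apply/asboolP => n.
change (((x n.+1 - y n.+1)%R : 'Z_(p ^ n.+2))%:R = x n - y n :> 'Z_(p ^ n.+1)).
rewrite -(xc n) -(yc n).
move: (x n.+1) (y n.+1) => a b.
have dvd := padic_modulus_dvd n.
have natr_modm k : (k %% (Zp_trunc (p ^ n.+2)).+2)%:R = k%:R :> 'Z_(p ^ n.+1).
  by apply: val_inj; rewrite !Zp_nat /= modn_dvdm.
rewrite /= !natr_modm natrD natr_modm natrB; last exact: ltnW.
by rewrite -[_.+2%:R]natr_modm modnn sub0r.
Qed.

HB.instance Definition _ :=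
  GRing.isZmodClosed.Build padic_product padic_coherent
    padic_coherent_zmod_closed.

(* The inverse limit of the discrete groups Z/p^n, n >= 1; the trivial factor
   n = 0 is omitted. *)
Definition padic_int : topologicalZmodType :=
  @subgroup padic_product padic_coherent.

End Padic.

(* Main.v *)
From HB Require Import structures.
Require Import Defs.
From mathcomp Require Import all_boot all_order all_algebra all_field.
From mathcomp Require Import boolp classical_sets functions cardinality.
From mathcomp Require Import topology tvs.
From mathcomp Require Import zify ring lra.

Set Implicit Arguments.
Unset Strict Implicit.
Unset Printing Implicit Defensive.

Import Order.TTheory GRing.Theory Num.Theory.

Local Open Scope classical_set_scope.
Local Open Scope ring_scope.

(** Hereditary minimality trivially implies dense minimality.

    Every subgroup of [Z_p] is minimal because the subgroups [p ^ n Z_p] are so few.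
    Let [L] be a subgroup of [Z_p], with a coarser Hausdorff group topology.  The
    closure of [L `&` p ^ m Z_p] in this topology has finite index in [L], so it is
    open.  For [m] large it does not contain a chosen nonzero element [s] of
    [L `&` p ^ n Z_p]; so it contains no element of valuation less than [n], which
    would have a multiple equal to [s] modulo [p ^ m].  Thus [L `&` p ^ n Z_p] is
    open too ([chain_hereditarily_minimal]).

    Conversely let [K] be densely minimal and locally compact.  Minimality of the
    dense subgroups of [K] is used in two ways.  First, a dense subgroup meets every
    nontrivial closed subgroup [N], since otherwise it would inherit a coarser
    Hausdorff topology from [K / N] ([densely_minimal_essential]).  Each step below
    that excludes a phenomenon builds a dense subgroup with trivial intersection
    with some [N].  Such a subgroup is taken maximal, by Zorn's lemma, and shown to
    be dense by Baire's theorem; when it is only dense in a closed subgroup, it is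
    extended to [K] by divisibility.  Second, [K] itself has no coarser Hausdorff
    group topology ([densely_minimal_base]).

    The connected component.  If the multiples of [x] did not come back close to
    [0], one could make [m! x] tend to [0] in a coarser topology; so they do come
    back, and the closure of [<x>] is compact.  It follows that the intersection [C]
    of all open subgroups of [K] is compact.  As [C] has no proper open subgroup, it
    is divisible.  This is [no_open_divisible], where Bogolyubov's lemma on sums of
    dense subsets of finite groups stands in for Pontryagin duality.  Then [C] is
    torsion-free ([essential_torsion_free]), and each of its nonzero elements
    generates a dense subgroup of it ([essential_monothetic]).  Doubling is thus
    an expansive automorphism of [C], and a pigeonhole argument shows that [C] is
    trivial ([minimal_closed_trivial]).  Hence the open compact subgroups of [K]
    form a base of neighbourhoods of [0].

    Compactness.  The topology generated by the homomorphisms from [K] to [Q / Z]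
    with open kernel is now Hausdorff.  It is precompact and coarser than that of
    [K], so it is equal to it, and [K] is compact ([densely_minimal_compact]).

    The profinite case.  [K] has infinite exponent ([essential_compact_unbounded]).
    This provides dense subgroups that avoid the nonzero multiples of any given
    element, so [K] is torsion-free ([unbounded_torsion_free]).  Let [O] be an open
    subgroup of prime index [p], and [M] a minimal closed supplement of [O].  Any
    [x] in [M] outside [O] generates a dense subgroup of [M], and [p ^ n x] tends to
    [0].  A minimal closed supplement [A] of [M] is a complement, and it is
    trivial: otherwise some dense subgroup [E] of [A] avoids the nonzero multiples
    of some nonzero [a] in [A], and [E + <a + x>] is dense in [K] with trivial
    intersection with [M].  So [K = M] is the closure of [<x>], and reading [k]
    modulo [p ^ n K] as a multiple of [x] identifies [K] with [Z_p]
    ([procyclic_padic]). *)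

(** * A decision procedure for linear identities in abelian groups *)

(** An identity between integral linear combinations of atoms follows from the
    equality of the coefficients of each atom, and these equalities are
    identities in the commutative ring [int], where [ring] proves them. *)
Inductive zexpr : Type :=
  | ZVar of nat | ZZero | ZAdd of zexpr & zexpr | ZOpp of zexpr | ZMul of zexpr & int.

Section Zexpr.
Variable G : zmodType.

Fixpoint zeval (s : seq G) (e : zexpr) : G :=
  match e with
  | ZVar i => nth 0 s i
  | ZZero => 0
  | ZAdd e1 e2 => zeval s e1 + zeval s e2
  | ZOpp e1 => - zeval s e1
  | ZMul e1 c => zeval s e1 *~ c
  end.

Fixpoint zcoef (i : nat) (e : zexpr) : int :=
  match e with
  | ZVar j => if eqn i j then 1 else 0
  | ZZero => 0
  | ZAdd e1 e2 => zcoef i e1 + zcoef i e2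
  | ZOpp e1 => - zcoef i e1
  | ZMul e1 c => zcoef i e1 * c
  end.

Lemma zeval_coef s e : zeval s e = \sum_(i < size s) s`_i *~ zcoef i e.
Proof.
elim: e => [j||e1 IH1 e2 IH2|e1 IH1|e1 IH1 c] /=.
- have [js|sj] := ltnP j (size s); last first.
    rewrite nth_default // big1 // => i _; rewrite -[eqn _ _]/(val i == j).
    by rewrite (ltn_eqF (leq_trans (ltn_ord i) sj)) mulr0z.
  rewrite (bigD1 (Ordinal js)) //= -[eqn j j]/(j == j) eqxx mulr1z big1 ?addr0 // => i ij.
  by rewrite -[eqn _ _]/(i == Ordinal js) (negPf ij) mulr0z.
- by rewrite big1 // => i _; rewrite mulr0z.
- by rewrite IH1 IH2 -big_split /=; apply: eq_bigr => i _; rewrite mulrzDr.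
- by rewrite IH1 -sumrN; apply: eq_bigr => i _; rewrite mulrNz.
- by rewrite IH1 mulrz_suml; apply: eq_bigr => i _; rewrite mulrzA.
Qed.

Fixpoint zcoef_eqs (n : nat) (e1 e2 : zexpr) : Prop :=
  if n is m.+1 then zcoef m e1 = zcoef m e2 /\ zcoef_eqs m e1 e2 else True.

Lemma zexpr_eq s e1 e2 : zcoef_eqs (size s) e1 e2 -> zeval s e1 = zeval s e2.
Proof.
rewrite !zeval_coef; elim: (size s) => [|n IHn] /=; first by rewrite !big_ord0.
by rewrite !big_ord_recr /= => -[-> /IHn ->].
Qed.

End Zexpr.

Ltac zmod_index x s :=
  match s with
  | x :: _ => constr:(O)
  | _ :: ?t => let i := zmod_index x t in constr:(S i)
  end.

Ltac zmod_insert x s :=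
  match s with
  | nil => constr:(x :: nil)
  | x :: _ => s
  | ?y :: ?t => let t' := zmod_insert x t in constr:(y :: t')
  end.

Ltac zmod_atoms e s :=
  match e with
  | GRing.add ?a ?b => let s := zmod_atoms a s in zmod_atoms b s
  | GRing.opp ?a => zmod_atoms a s
  | GRing.natmul ?a _ => zmod_atoms a s
  | intmul ?a _ => zmod_atoms a s
  | GRing.zero => s
  | _ => zmod_insert e s
  end.

Ltac zmod_reify e s :=
  match e with
  | GRing.add ?a ?b =>
      let a := zmod_reify a s in let b := zmod_reify b s in constr:(ZAdd a b)
  | GRing.opp ?a => let a := zmod_reify a s in constr:(ZOpp a)
  | GRing.natmul ?a ?n => let a := zmod_reify a s in constr:(ZMul a (Posz n))
  | intmul ?a ?n => let a := zmod_reify a s in constr:(ZMul a n)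
  | GRing.zero => constr:(ZZero)
  | _ => let i := zmod_index e s in constr:(ZVar i)
  end.

(** The list [s] of atoms is explicit, so that [zcoef_eqs] unfolds to one equation
    between integers per atom. *)
Ltac zmod :=
  match goal with
  | |- @eq ?T ?a ?b =>
      let s := zmod_atoms a (@nil T) in
      let s := zmod_atoms b s in
      let ea := zmod_reify a s in
      let eb := zmod_reify b s in
      refine (@zexpr_eq _ s ea eb _); cbn [zcoef_eqs zcoef size eqn];
      repeat split; try reflexivity; ring
  end.

(** * Subgroups of an abelian group, as sets *)

Section Algebra.
Variable G : zmodType.
Implicit Types (A B C H S : set G) (x y z : G).

Definition subgrp A := A 0 /\ forall x y, A x -> A y -> A (x - y).

Definition sumset A B := [set z | exists2 a, A a & B (z - a)].

Definition cyc x := range (fun j : int => x *~ j).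

Lemma subgrp0 A : subgrp A -> A 0. Proof. by case. Qed.

Lemma subgrpB A x y : subgrp A -> A x -> A y -> A (x - y).
Proof. by case=> _; apply. Qed.

Lemma subgrpN A x : subgrp A -> A x -> A (- x).
Proof. by move=> sA Ax; rewrite -sub0r; apply: subgrpB => //; exact: subgrp0. Qed.

Lemma subgrpNE A x : subgrp A -> A (- x) <-> A x.
Proof. by move=> sA; split=> [/(subgrpN sA)|/(subgrpN sA)//]; rewrite opprK. Qed.

Lemma subgrpD A x y : subgrp A -> A x -> A y -> A (x + y).
Proof. by move=> sA Ax Ay; rewrite -[y]opprK; apply: subgrpB; rewrite ?subgrpNE. Qed.

Lemma subgrpMn A x n : subgrp A -> A x -> A (x *+ n).
Proof.
move=> sA Ax; elim: n => [|n IHn]; first by rewrite mulr0n; exact: subgrp0.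
by rewrite mulrS; exact: subgrpD.
Qed.

Lemma subgrpMz A x (j : int) : subgrp A -> A x -> A (x *~ j).
Proof.
move=> sA Ax; case: j => n; first exact: subgrpMn.
by rewrite NegzE mulrNz; apply: (subgrpN sA); exact: subgrpMn.
Qed.

Lemma subgrp_subK A x y : subgrp A -> A y -> A (x - y) -> A x.
Proof. by move=> sA Ay /(subgrpD sA)/(_ Ay); rewrite subrK. Qed.

Lemma subgrp_addK A x y : subgrp A -> A y -> A (x + y) -> A x.
Proof. by move=> sA Ay Axy; rewrite -(addrK y x); exact: subgrpB. Qed.

Lemma subgrp_addKl A x y : subgrp A -> A y -> A (y + x) -> A x.
Proof. by rewrite addrC; exact: subgrp_addK. Qed.

Lemma subgrp_sum A (I : Type) (r : seq I) (P : pred I) (F : I -> G) :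
  subgrp A -> (forall i, P i -> A (F i)) -> A (\sum_(i <- r | P i) F i).
Proof.
move=> sA AF; elim/big_ind: _ => //; first exact: subgrp0.
by move=> x y; exact: subgrpD.
Qed.

Lemma subgrpT : subgrp setT. Proof. by []. Qed.

Lemma subgrp_set0 : subgrp [set 0].
Proof. by split=> // x y -> ->; rewrite subr0. Qed.

Lemma subgrpI A B : subgrp A -> subgrp B -> subgrp (A `&` B).
Proof.
move=> sA sB; split; first by split; exact: subgrp0.
by move=> x y [Ax Bx] [Ay By]; split; exact: subgrpB.
Qed.

Lemma subgrp_bigcap (I : Type) (D : set I) (F : I -> set G) :
  (forall i, D i -> subgrp (F i)) -> subgrp (\bigcap_(i in D) F i).
Proof.
move=> sF; split=> [i Di|x y Fx Fy i Di]; first by case: (sF i Di).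
by apply: (subgrpB (sF i Di)); [exact: Fx|exact: Fy].
Qed.

Lemma subgrp_sumset A B : subgrp A -> subgrp B -> subgrp (sumset A B).
Proof.
move=> sA sB; split; first by exists 0; rewrite ?subrr; exact: subgrp0.
move=> x y [a Aa Bxa] [b Ab Byb]; exists (a - b); first exact: subgrpB.
rewrite (_ : _ - _ - _ = (x - a) - (y - b)); last by zmod.
exact: subgrpB.
Qed.

Lemma sumset_subl A B : B 0 -> A `<=` sumset A B.
Proof. by move=> B0 a Aa; exists a; rewrite ?subrr. Qed.

Lemma sumset_subr A B : A 0 -> B `<=` sumset A B.
Proof. by move=> A0 b Bb; exists 0; rewrite ?subr0. Qed.

Lemma sumset_sub A B C : subgrp C -> A `<=` C -> B `<=` C -> sumset A B `<=` C.
Proof.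
by move=> sC AC BC z [a /AC Ca /BC]; exact: subgrp_subK.
Qed.

Lemma sumsetSl A A' B : A `<=` A' -> sumset A B `<=` sumset A' B.
Proof. by move=> AA' z [a Aa Bz]; exists a => //; exact: AA'. Qed.

Lemma sumsetC A B : sumset A B = sumset B A.
Proof.
by apply/seteqP; split=> z [a Aa Bz]; exists (z - a); rewrite // opprB addrC subrK.
Qed.

Lemma subgrp_cyc x : subgrp (cyc x).
Proof.
split; first by exists 0; rewrite ?mulr0z.
by move=> _ _ [i _ <-] [j _ <-]; exists (i - j); rewrite ?mulrzBr.
Qed.

Lemma cyc_id x : cyc x x. Proof. by exists 1. Qed.

Lemma cyc_sub A x : subgrp A -> A x -> cyc x `<=` A.
Proof. by move=> sA Ax _ [j _ <-]; exact: subgrpMz. Qed.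

Lemma subgrp_absz A x (j : int) : subgrp A -> A (x *~ j) -> A (x *+ `|j|%N).
Proof.
move=> sA; case: (intP j) => [|n|n] //.
by rewrite mulrNz => /(subgrpNE _ sA); rewrite abszN.
Qed.

Lemma subgrp_mult_min A x : subgrp A -> (exists2 n, (0 < n)%N & A (x *+ n)) ->
  exists n, [/\ (0 < n)%N, A (x *+ n) & forall j : int, A (x *~ j) -> (n %| `|j|)%N].
Proof.
move=> sA [n0 n00 An0].
have exn : exists n, (0 < n)%N && `[< A (x *+ n) >].
  by exists n0; rewrite n00; exact/asboolP.
case: (ex_minnP exn) => n /andP[n0' /asboolP An] nmin; exists n; split => // j.
move=> /(subgrp_absz sA) Aj; rewrite /dvdn eqn0Ngt; apply/negP => r0.
suff /nmin : (0 < `|j| %% n)%N && `[< A (x *+ (`|j| %% n)) >].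
  by rewrite leqNgt ltn_mod n0'.
rewrite r0; apply/asboolP.
apply: (@subgrp_addKl _ _ (x *+ (`|j| %/ n * n))) => //.
  by rewrite mulnC mulrnA; exact: subgrpMn.
by rewrite -mulrnDr -divn_eq.
Qed.

(** A subgroup maximal among those avoiding [S], by Zorn's lemma.  The last
    clause is how maximality is used: adjoining any further [a] creates an
    element of [S]. *)
Lemma maximal_avoiding H0 A S :
    subgrp H0 -> subgrp A -> H0 `<=` A -> (forall x, H0 x -> ~ S x) ->
  exists H, [/\ subgrp H, H0 `<=` H, H `<=` A, (forall x, H x -> ~ S x) &
    forall a, A a -> ~ H a -> exists h, H h /\ exists j : int, S (h + a *~ j)].
Proof.
move=> sH0 sA H0A H0S.
(* The empty chain has union [set0], so [H0] is only added at the end. *)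
pose P X := [/\ subgrp (X `|` H0), X `<=` A & forall x, X x -> ~ S x].
have [F FP Ftot|X [[sX XA XS] Xmax]] := @Zorn_bigcup G P.
  split.
  - split; first by right; exact: subgrp0.
    have key X x y : F X -> (X `|` H0) x -> (X `|` H0) y ->
        (\bigcup_(X in F) X `|` H0) (x - y).
      move=> FX Xx Xy; have [sX _ _] := FP _ FX.
      by case: (subgrpB sX Xx Xy) => h; [left; exists X|right].
    move=> x y [[X FX Xx]|Hx] [[Y FY Yy]|Hy].
    + by have [XY|YX] := Ftot _ _ FX FY; [apply: (key Y)|apply: (key X)] => //;
        left => //; [exact: XY|exact: YX].
    + by apply: (key X) => //; [left|right].
    + by apply: (key Y) => //; [right|left].
    + by right; exact: subgrpB.
  - by move=> x [X FX Xx]; have [_ + _] := FP _ FX; apply.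
  - by move=> x [X FX Xx]; have [_ _ +] := FP _ FX; apply.
exists (X `|` H0); split => //.
- by move=> x [/XA|/H0A].
- by move=> x [/XS|/H0S].
move=> a Aa XHa; apply: contrapT => nS.
apply: (Xmax (sumset (X `|` H0) (cyc a))).
  split; last by move=> sub; apply: XHa; left; apply: sub; exists 0;
    [exact: subgrp0|rewrite subr0; exact: cyc_id].
  by move=> x Xx; exists x; [left|rewrite subrr; exact: (subgrp0 (subgrp_cyc a))].
have sXa : subgrp (sumset (X `|` H0) (cyc a)) by apply: subgrp_sumset => //; exact: subgrp_cyc.
split.
- rewrite (_ : _ `|` H0 = sumset (X `|` H0) (cyc a)) //; apply/seteqP; split; last by left.
  move=> x [//|Hx]; exists x; first by right.
  by rewrite subrr; exact: (subgrp0 (subgrp_cyc a)).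
- apply: sumset_sub => //; first by move=> x [/XA|/H0A].
  exact: cyc_sub.
- move=> x [h Hh [j _ ajE]] Sx; apply: nS; exists h; split => //; exists j.
  by rewrite ajE addrC subrK.
Qed.

(** Divisible groups are injective, in the form used throughout: if [C / H] is
    divisible then it has a complement in [A / H]. *)
Lemma divisible_complement A C H :
    subgrp A -> subgrp C -> subgrp H -> H `<=` C -> C `<=` A ->
    (forall c n, C c -> (0 < n)%N -> exists2 c', C c' & H (c - c' *+ n)) ->
  exists H', [/\ subgrp H', H `<=` H', H' `<=` A, H' `&` C `<=` H & A `<=` sumset H' C].
Proof.
move=> sA sC sH HC CA divC.
have [|H' [sH' HH' H'A H'S H'max]] :=
  @maximal_avoiding H A [set x | C x /\ ~ H x] sH sA (subset_trans HC CA).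
  by move=> x Hx [].
have H'C x : H' x -> C x -> H x.
  by move=> H'x Cx; apply: contrapT => nHx; exact: (H'S x H'x).
exists H'; split => //; first by move=> x [H'x Cx]; exact: H'C.
move=> a Aa; have sT := subgrp_sumset sH' sC.
have H'T : H' `<=` sumset H' C by apply: sumset_subl; exact: subgrp0.
have CT : C `<=` sumset H' C by apply: sumset_subr; exact: subgrp0.
(* If no positive multiple of [a] is in [H' + C], then [H'] cannot be maximal;
   otherwise, with [n] minimal, divisibility corrects [a] by an element [c'] of
   [C] so that [n (a - c')] is in [H']. *)
have [ex|nex] := pselect (exists2 n, (0 < n)%N & sumset H' C (a *+ n)); last first.
  have [/H'T//|nH'a] := pselect (H' a).
  have [h [H'h [j [Chj nHhj]]]] := H'max _ Aa nH'a.
  have [j0|j0] := eqVneq j 0.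
    by move: Chj nHhj; rewrite j0 mulr0z addr0 => Ch nHh; case: nHh; exact: H'C.
  case: nex; exists `|j|%N; first by rewrite absz_gt0.
  apply: subgrp_absz => //; apply: (@subgrp_addKl _ _ h) => //; first exact: H'T.
  exact: CT.
have [n [n0 [h H'h Canh] nmin]] := subgrp_mult_min sT ex.
have [c' Cc' Hc'] := divC _ _ Canh n0.
have [H'ac'|nH'] := pselect (H' (a - c')).
  by exists (a - c') => //; rewrite opprB addrC subrK.
have nac' : H' ((a - c') *+ n).
  rewrite mulrnBl -[a *+ n](subrK h) addrAC; apply: subgrpD => //; exact: HH'.
have [|k [H'k [j [Ckj nHkj]]]] := H'max (a - c') _ nH'; first by apply: subgrpB => //; exact: CA.
case: nHkj; apply: H'C => //; apply: subgrpD => //.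
suff /dvdnP[q jE] : (n %| `|j|)%N.
  have : H' ((a - c') *+ n *+ q) by exact: subgrpMn.
  rewrite -mulrnA mulnC -jE; case: (intP j) => [|m|m] //.
  by rewrite abszN mulrNz => /(subgrpN sH').
apply: nmin; rewrite -[a](subrK c') mulrzDl; apply: subgrpD => //; last first.
  by apply: CT; exact: subgrpMz.
apply: (@subgrp_addKl _ _ k) => //; [exact: H'T|exact: CT].
Qed.

End Algebra.

(** * Topological preliminaries *)

Section Compactness.
Variable T : topologicalType.
Implicit Types A : set T.

Lemma compact_directed A (I : Type) (F : I -> set T) (i0 : I) :
    compact A -> (forall i, closed (F i)) ->
    (forall i j, exists k, F k `<=` F i `&` F j) ->
    (forall i, A `&` F i !=set0) ->
  exists2 x, A x & forall i, F i x.
Proof.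
move=> cA clF dirF AF.
pose B (i : I) := A `&` F i.
have FB : ProperFilter (filter_from [set: I] B).
  apply: filter_from_proper => [|i _]; last exact: AF.
  apply: filter_fromT_filter; first by exists i0.
  move=> i j; have [k Fk] := dirF i j; exists k => x [Ax /Fk[Fix Fjx]].
  by split; split.
have [|x [Ax clx]] := cA _ FB; first by exists i0 => // x [].
exists x => // i; rewrite (iffLR (closure_id (F i)) (clF i)) => U Ux.
have [|y [[_ Fiy] Uy]] := clx (B i) U _ Ux; first by exists i.
by exists y.
Qed.

End Compactness.

Section Basics.
Variable K : topologicalZmodType.
Implicit Types (A B P U V W : set K) (x y z : K).

Lemma addl_continuous x : continuous (fun z => x + z).
Proof.
move=> z; apply: (@continuous_comp _ _ _ (fun z => (x, z)) (fun z : K * K => z.1 + z.2)).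
  by apply: cvg_pair => /=; [exact: cvg_cst|exact: cvg_id].
exact: add_continuous.
Qed.

Lemma nbhs0P x U : nbhs x U <-> nbhs (0 : K) [set z | U (x + z)].
Proof.
split=> [xU|zU].
  by have := @addl_continuous x 0; rewrite /continuous_at addr0; apply.
have := @addl_continuous (- x) x; rewrite /continuous_at addNr => /(_ _ zU) xU.
have {xU} : nbhs x ((fun z => - x + z) @^-1` [set z | U (x + z)]) by exact: xU.
by apply: filterS => z /=; rewrite addrA subrr add0r.
Qed.

Lemma nbhs0_shift x U : nbhs x U -> nbhs (0 : K) [set z | U (x + z)].
Proof. by move/nbhs0P. Qed.

Lemma open_shift x U : open U -> open [set z | U (x + z)].
Proof. by move=> oU; apply: open_comp => // z _; exact: addl_continuous. Qed.

Lemma open_translate x U : open U -> open [set z | U (z - x)].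
Proof.
move=> oU; rewrite (_ : mkset _ = [set z | U (- x + z)]); first exact: open_shift.
by apply/funext => z /=; rewrite addrC.
Qed.

Lemma closed_translate x U : closed U -> closed [set z | U (z - x)].
Proof.
move=> cU; have : open (~` U) by exact: closed_openC.
by move/(@open_translate x); rewrite -openC.
Qed.

Lemma nbhs0_sub U : nbhs (0 : K) U -> exists V,
  [/\ open V, V 0, (forall x, V x -> V (- x)), V `<=` U &
      forall x y, V x -> V y -> U (x - y)].
Proof.
move=> U0; have := @sub_continuous K (0, 0).
rewrite /continuous_at subr0 => /(_ _ U0) [[X Y] /= [X0 Y0] XYU].
have : nbhs (0 : K) (X `&` Y) by exact: filterI.
rewrite nbhsE => -[Z [oZ Z0] ZXY].
pose V := Z `&` [set z | Z (- z)].
have VZ x : V x -> Z x by case.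
have VU x y : V x -> V y -> U (x - y).
  by move=> [/ZXY[Xx _] _] [/ZXY[_ Yy] _]; exact: (XYU (x, y)).
have V0 : V 0 by split; rewrite //= oppr0.
exists V; split => //.
- by apply: openI => //; apply: open_comp => // z _; exact: opp_continuous.
- by move=> x [Zx ZNx]; split; rewrite //= opprK.
- by move=> x /VU /(_ V0); rewrite subr0.
Qed.

Lemma nbhs0_add U : nbhs (0 : K) U -> exists V,
  [/\ open V, V 0, (forall x, V x -> V (- x)), V `<=` U &
      forall x y, V x -> V y -> U (x + y)].
Proof.
move=> /nbhs0_sub[V [oV V0 VN VU VV]]; exists V; split => // x y Vx Vy.
by rewrite -[y]opprK; apply/VV/VN.
Qed.

Lemma closure_nbhs0 A x :
  closure A x <-> forall V, nbhs (0 : K) V -> exists2 a, A a & V (a - x).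
Proof.
split=> [clx V V0|clx U /nbhs0P /clx [a Aa]].
  have xV : nbhs x [set z | V (z - x)].
    by apply/nbhs0P; apply: filterS V0 => z /=; rewrite addrAC subrr add0r.
  by have [a [Aa Va]] := clx _ xV; exists a.
by rewrite /= subrKC; exists a.
Qed.

Lemma closureW A x : (forall V, nbhs (0 : K) V -> exists2 a, A a & V (a - x)) -> closure A x.
Proof. by move=> h; apply/closure_nbhs0. Qed.

Lemma closure_mono_sub A B : closed B -> A `<=` B -> closure A `<=` B.
Proof. by move=> cB AB; rewrite (iffLR (closure_id B) cB); exact: closureS. Qed.

Lemma closure_idS A : closed A -> closure A `<=` A.
Proof. by move=> cA; exact: closure_mono_sub. Qed.

Lemma closed_nbhs0 A :
  (forall x, (forall V, nbhs (0 : K) V -> exists2 a, A a & V (a - x)) -> A x) -> closed A.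
Proof.
move=> h; apply/closure_id/seteqP; split; first exact: subset_closure.
by move=> x /closure_nbhs0; exact: h.
Qed.

Lemma closed_notin A x : closed A -> ~ A x -> nbhs (0 : K) [set v | ~ A (x + v)].
Proof.
move=> cA nAx; apply: (@nbhs0_shift x (~` A)); apply: open_nbhs_nbhs.
by split => //; exact: closed_openC.
Qed.

Lemma subgrp_closure A : subgrp A -> subgrp (closure A).
Proof.
move=> sA; split; first by apply: subset_closure; exact: subgrp0.
move=> x y /closure_nbhs0 clx /closure_nbhs0 cly; apply: closureW => V.
move=> /nbhs0_sub[W [oW W0 _ _ WV]].
have nW : nbhs (0 : K) W by exact: open_nbhs_nbhs.
have [a Aa Wa] := clx _ nW; have [b Ab Wb] := cly _ nW.
exists (a - b); first exact: subgrpB.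
by rewrite (_ : _ - _ = (a - x) - (b - y)); [exact: WV|zmod].
Qed.

(** Topological groups are regular. *)
Lemma closed_nbhs0_sub U : nbhs (0 : K) U -> exists V, [/\ closed V, nbhs (0 : K) V, V `<=` U &
  forall x, V x -> V (- x)].
Proof.
move=> /nbhs0_sub[W [oW W0 WN _ WU]].
have nW : nbhs (0 : K) W by exact: open_nbhs_nbhs.
exists (closure W); split; first exact: closed_closure.
- exact: filterS (@subset_closure _ W) nW.
- move=> x /closure_nbhs0 /(_ _ nW)[a Wa Wax].
  by rewrite -(subKr a x); apply: WU.
- move=> x /closure_nbhs0 clx; apply: closureW => V V0.
  have [|a Wa Va] := clx [set z | V (- z)]; last by exists (- a); [exact: WN|rewrite -opprD].
  by have := @opp_continuous K 0; rewrite /continuous_at oppr0; apply.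
Qed.

Lemma mulrn_continuous n : continuous (fun x : K => x *+ n).
Proof.
elim: n => [|n IHn] x; first by apply: cvg_cst.
rewrite /continuous_at (_ : (fun z : K => z *+ n.+1) = (fun z => z + z *+ n)); last first.
  by apply/funext => z; rewrite mulrS.
rewrite mulrS.
apply: (@continuous_comp _ _ _ (fun z => (z, z *+ n)) (fun z : K * K => z.1 + z.2)).
  by apply: cvg_pair => /=; [exact: cvg_id|exact: IHn].
exact: add_continuous.
Qed.

Lemma mulrz_continuous (j : int) : continuous (fun x : K => x *~ j).
Proof.
case: (intP j) => [|n|n].
- exact: mulrn_continuous.
- exact: mulrn_continuous.
- move=> x; rewrite (_ : (fun z : K => z *~ - n.+1%:Z) = (-%R \o (fun z => z *+ n.+1))).
    apply: (@continuous_comp _ _ _ (fun z : K => z *+ n.+1) (-%R)).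
      exact: mulrn_continuous.
    exact: opp_continuous.
  by apply/funext => z /=; rewrite mulrNz.
Qed.

Lemma nbhs0_muln n U : nbhs (0 : K) U -> nbhs (0 : K) [set x | forall k, (k <= n)%N -> U (x *+ k)].
Proof.
move=> U0; elim: n => [|n IHn].
  apply: filterE => x k /=; rewrite leqn0 => /eqP ->; rewrite mulr0n; exact: nbhs_singleton.
have Un : nbhs (0 : K) [set x | U (x *+ n.+1)].
  by have := @mulrn_continuous n.+1 0; rewrite /continuous_at mul0rn => /(_ _ U0).
apply: filterS (filterI IHn Un) => x [/= Ux Uxn k].
by rewrite leq_eqVlt => /predU1P[->//|]; exact: Ux.
Qed.

Lemma closed_mulrz (j : int) y B : closed B -> closed [set x : K | B (x *~ j - y)].
Proof.
move=> cB; apply: (@closed_comp _ _ (fun x : K => x *~ j) [set x | B (x - y)]).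
  by move=> x _; exact: mulrz_continuous.
exact: closed_translate.
Qed.

Lemma closed_mulrn n y B : closed B -> closed [set x : K | B (x *+ n - y)].
Proof. exact: (@closed_mulrz n). Qed.

Lemma closed_opp B : closed B -> closed [set x : K | B (- x)].
Proof. by move=> cB; apply: closed_comp => // x _; exact: opp_continuous. Qed.

Lemma compact_sumset A B : compact A -> compact B -> compact (sumset A B).
Proof.
move=> cA cB; rewrite (_ : sumset A B = (fun z : K * K => z.1 + z.2) @` (A `*` B)).
  apply: continuous_compact; last exact: compact_setX.
  by apply: continuous_subspaceT => z; exact: add_continuous.
apply/seteqP; split=> [z [a Aa Bz]|_ [[a b] [/= Aa Bb] <-]].
  by exists (a, z - a) => //=; rewrite subrKC.
by exists a; rewrite // addrAC subrr add0r.
Qed.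

Lemma compact_mulrn n A : compact A -> compact [set a *+ n | a in A].
Proof.
move=> cA; apply: continuous_compact => //.
by apply: continuous_subspaceT => z; exact: mulrn_continuous.
Qed.

Lemma subgrp_mulrn n A : subgrp A -> subgrp [set a *+ n | a in A].
Proof.
move=> sA; split; first by exists 0; [exact: subgrp0|rewrite mul0rn].
by move=> _ _ [a Aa <-] [b Ab <-]; exists (a - b); [exact: subgrpB|rewrite mulrnBl].
Qed.

Lemma closed_sumset A B : compact A -> closed B -> closed (sumset A B).
Proof.
move=> cA cB; apply: closed_nbhs0 => x clx.
pose I := {V : set K | nbhs (0 : K) V}.
pose F (V : I) := closure [set a | exists2 v, sval V v & B (x + v - a)].
have [|||a Aa Fa] := @compact_directed K A I F (exist _ setT filterT) cA.
- by move=> V; exact: closed_closure.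
- move=> [V V0] [W W0]; exists (exist _ (V `&` W) (filterI V0 W0)).
  by move=> a Fa; split; apply: closureS Fa => b [v [Vv Wv] Bv]; exists v.
- move=> [V V0]; have [z [a Aa Bz] Vz] := clx _ V0; exists a; split => //.
  by apply: subset_closure; exists (z - x) => //=; rewrite subrKC.
exists a => //; apply: contrapT => nB.
have /nbhs0_sub[W [oW W0 WN WU WWU]] := closed_notin cB nB.
have nW : nbhs (0 : K) W by exact: open_nbhs_nbhs.
have /closure_nbhs0 /(_ _ nW)[b [v Wv Bv] Wb] := Fa (exist _ W nW).
apply: (WWU _ _ Wv Wb); congr B: Bv; zmod.
Qed.

Lemma hausdorff_notin x : hausdorff_space K -> x != 0 ->
  exists V, [/\ closed V, nbhs (0 : K) V, (forall z, V z -> V (- z)) & ~ V x].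
Proof.
move=> hK x0.
have [V V0 nVx] : exists2 V : set K, nbhs (0 : K) V & ~ V x.
  apply: contrapT => h; case/eqP: x0; apply/esym/hK => A B A0 Bx.
  have /nbhs0_sub[W [oW W0 WN WA WWB]] := nbhs0_shift Bx.
  have nW : nbhs (0 : K) (A `&` [set z | W (- z)]).
    apply: filterI => //; have := @opp_continuous K 0.
    by rewrite /continuous_at oppr0; apply; exact: open_nbhs_nbhs.
  have Wx : sumset W (A `&` [set z | W (- z)]) x.
    apply: contrapT => nx; apply: h; exists (A `&` W).
      by apply: filterI => //; exact: open_nbhs_nbhs.
    by move=> [Ax Wx]; apply: nx; exists 0 => //; rewrite subr0; split => //; exact: WN.
  case: Wx => w Ww [Axw Wxw]; exists (x - w); split => //.
  by have /= := WWB 0 w W0 Ww; rewrite sub0r.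
have [W [cW W0 WV WN]] := closed_nbhs0_sub V0.
by exists W; split => // /WV.
Qed.

Lemma closed_set0 : hausdorff_space K -> closed [set (0 : K)].
Proof. by move=> hK; exact: (accessible_closed_set1 (hausdorff_accessible hK)). Qed.

Lemma compact_cover_nbhs0 A V : compact A -> nbhs (0 : K) V ->
  exists s : seq K, (forall c, c \in s -> A c) /\
    forall a, A a -> exists2 c, c \in s & V (a - c).
Proof.
move=> cA; rewrite nbhsE => -[U [oU U0] UV].
pose I := {s : seq K | forall c, c \in s -> A c}.
pose F (s : I) := [set a | forall c, c \in sval s -> ~ U (a - c)].
have i0 : I by exists [::].
have clF s : closed (F s).
  rewrite (_ : F s = \bigcap_(c in [set c | c \in sval s]) ~` [set a | U (a - c)]).
    apply: closed_bigI => c _; apply: open_closedC; exact: open_translate.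
  by apply/seteqP; split=> a h c /h.
apply: contrapT => h.
have [||a Aa Fa] := @compact_directed K A I F i0 cA clF.
- move=> [s As] [t At]; have Ast c : c \in s ++ t -> A c.
    by rewrite mem_cat => /orP[/As|/At].
  exists (exist _ (s ++ t) Ast) => a /= Fa.
  by split=> c /= cs; apply: Fa; rewrite mem_cat cs ?orbT.
- move=> [s As]; apply: contrapT => nF; apply: h; exists s; split => // a Aa.
  apply: contrapT => na; apply: nF; exists a; split => // c /= cs Uac.
  by apply: na; exists c => //; exact: UV.
have Aa1 c : c \in [:: a] -> A c by rewrite inE => /eqP ->.
by apply: (Fa (exist _ _ Aa1) a); rewrite /= ?inE// subrr.
Qed.

Definition open_in A P := exists2 V : set K, nbhs (0 : K) V & A `&` V `<=` P.

Definition divisible A := forall a n, A a -> (0 < n)%N -> exists2 b, A b & b *+ n = a.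

Lemma compact_finite_index A P : compact A -> subgrp P -> open_in A P -> subgrp A ->
  exists s : seq K, (forall c, c \in s -> A c) /\
    forall a, A a -> exists2 c, c \in s & P (a - c).
Proof.
move=> cA sP [V V0 AVP] sA; have [s [As sV]] := compact_cover_nbhs0 cA V0.
exists s; split => // a Aa; have [c cs Vac] := sV a Aa; exists c => //.
by apply: AVP; split => //; apply: subgrpB => //; exact: As.
Qed.

Lemma finite_index_exponent A P (s : seq K) : subgrp P -> subgrp A ->
    (forall a, A a -> exists2 c, c \in s & P (a - c)) ->
  exists2 n, (0 < n)%N & forall a, A a -> P (a *+ n).
Proof.
move=> sP sA sAP; exists (size s)`!; first exact: fact_gt0.
move=> a Aa.
have [f fP] : {f : 'I_(size s).+1 -> 'I_(size s) &
    forall i : 'I_(size s).+1, P (a *+ i - s`_(f i))}.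
  apply: (@choice _ _ (fun (i : 'I_(size s).+1) j => P (a *+ i - s`_(j : 'I_(size s))))) => i; have [c cs Pc] := sAP _ (subgrpMn i sA Aa).
  by rewrite -index_mem in cs; exists (Ordinal cs); rewrite nth_index // -index_mem.
have [i [j [ij fij]]] : exists i j : 'I_(size s).+1, (i < j)%N /\ f i = f j.
  have /injectivePn[i [j ij fij]] : ~~ injectiveb f.
    by apply/negP => /injectiveP /leq_card; rewrite !card_ord ltnn.
  have [lt|lt|/val_inj/eqP] := ltngtP (val i) (val j); [by exists i, j|by exists j, i|].
  by rewrite (negPf ij).
have Pij : P (a *+ (j - i)%N).
  rewrite mulrnBr 1?ltnW // (_ : _ - _ = (a *+ j - s`_(f j)) - (a *+ i - s`_(f i))).
    exact: subgrpB.
  by rewrite fij; zmod.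
have /dvdn_fact/dvdnP[q ->] : (0 < j - i <= size s)%N.
  by have := ltn_ord j; lia.
by rewrite mulnC mulrnA; exact: subgrpMn.
Qed.

Lemma finite_index_open A P (s : seq K) : subgrp P -> closed P ->
  (forall a, A a -> exists2 c, c \in s & P (a - c)) -> open_in A P.
Proof.
move=> sP cP sAP; exists [set v | forall c, c \in s -> ~ P c -> ~ P (v - c)].
  elim: s {sAP} => [|c s IHs]; first by apply: filterE => v c.
  have [Pc|nPc] := pselect (P c).
    by apply: filterS IHs => v h d; rewrite inE => /predU1P[->//|]; exact: h.
  have nPc' : ~ P (- c) by move=> /(subgrpNE _ sP).
  apply: filterS (filterI IHs (closed_notin cP nPc')) => v [h hc] d; rewrite inE => /predU1P[->|]; last exact: h.
  by rewrite addrC.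
move=> v [Av Vv]; have [c cs Pvc] := sAP v Av.
have [Pc|nPc] := pselect (P c); first exact: (subgrp_subK sP Pc).
by case: (Vv c cs nPc).
Qed.

(** A divisible group has no proper subgroup of finite index. *)
Lemma divisible_open_in A P : compact A -> subgrp A -> divisible A -> subgrp P ->
  open_in A P -> A `<=` P.
Proof.
move=> cA sA dA sP oP; have [s [_ sAP]] := compact_finite_index cA sP oP sA.
have [n n0 nP] := finite_index_exponent sP sA sAP.
by move=> a Aa; have [b Ab <-] := dA a n Aa n0; exact: nP.
Qed.

(** A form of the Baire category theorem. *)
Lemma baire (I : countType) (F : I -> set K) A : compact A -> A !=set0 ->
    (forall i, closed (F i)) -> A `<=` \bigcup_i F i ->
  exists i x, A x /\ exists2 V : set K, nbhs (0 : K) V & forall a, A a -> V (a - x) -> F i a.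
Proof.
move=> cA [a0 Aa0] clF AF; apply: contrapT => nobaire.
(* A decreasing sequence of closed balls with centres in [A], the [n]-th of
   which misses the [n]-th closed set. *)
pose S := {p : K * set K | A p.1 /\ nbhs (0 : K) p.2}.
pose ball (p : S) := [set z | (sval p).2 (z - (sval p).1)].
have step (n : nat) (p : S) : exists q : S, [/\ closed (ball q), ball q `<=` ball p &
    forall i, unpickle n = Some i -> ball q `<=` ~` F i].
  have shrink (a : K) U : A a -> nbhs (0 : K) U -> exists q : S, closed (ball q) /\
      forall z, ball q z -> U (z - a).
    move=> Aa U0; have [V [cV V0 VU _]] := closed_nbhs0_sub U0.
    by exists (exist _ (a, V) (conj Aa V0)); split; [exact: closed_translate|move=> z /VU].
  case: p => -[x V] /= [Ax V0]; case nE: (unpickle n) => [i|]; last first.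
    by have [q [cq qU]] := shrink x V Ax V0; exists q; split.
  have [U [oU U0] UV] : exists2 U, open_nbhs (0 : K) U & U `<=` V.
    by have := V0; rewrite {1}nbhsE.
  have [a [Aa Ua nFa]] : exists a, [/\ A a, U (a - x) & ~ F i a].
    apply: contrapT => h; apply: nobaire; exists i, x; split => //; exists U.
      exact: open_nbhs_nbhs.
    by move=> a Aa Ua; apply: contrapT => nFa; apply: h; exists a.
  have na : nbhs (0 : K) ([set v | U (v + a - x)] `&` [set v | ~ F i (a + v)]).
    apply: filterI; last exact: closed_notin.
    have : nbhs (a - x) U by exact: open_nbhs_nbhs.
    by move=> /nbhs0P; apply: filterS => v /=; rewrite addrC addrA.
  have [q [cq qU]] := shrink a _ Aa na; exists q; split => //.
    by move=> z /qU[/= + _]; rewrite subrK => /UV.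
  by move=> j [<-] z /qU[_ /=]; rewrite subrKC.
have [f fP] : {f : nat * S -> S & forall np, [/\ closed (ball (f np)),
    ball (f np) `<=` ball np.2 &
    forall i, unpickle np.1 = Some i -> ball (f np) `<=` ~` F i]}.
  apply: (@choice _ _ (fun (np : nat * S) q => [/\ closed (ball q), ball q `<=` ball np.2 &
    forall i, unpickle np.1 = Some i -> ball q `<=` ~` F i])) => -[n p]; exact: step.
have p0 : S by exists (a0, setT); split => //; exact: filterT.
pose p := fix p n := if n is m.+1 then f (m, p m) else p0.
have pS n : ball (p n.+1) `<=` ball (p n) by have [] := fP (n, p n).
have pD m n : (m <= n)%N -> ball (p n) `<=` ball (p m).
  elim: n => [|n IHn]; first by rewrite leqn0 => /eqP ->.
  rewrite leq_eqVlt => /predU1P[->//|/IHn]; apply: subset_trans; exact: pS.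
have [|||x Ax px] := @compact_directed K A nat (fun n => ball (p n.+1)) 0 cA.
- by move=> n; have [] := fP (n, p n).
- move=> m n; exists (maxn m n) => z pz.
  by split; apply: pD pz; rewrite ltnS (leq_maxl, leq_maxr).
- move=> n; have [Aq nq] := svalP (p n.+1); exists (sval (p n.+1)).1; split => //.
  by rewrite /ball /= subrr; exact: nbhs_singleton.
have [i _ Fix_] := AF x Ax.
have [_ _ /(_ i (pickleK i))] := fP (pickle i, p (pickle i)).
by move=> /(_ _ (px (pickle i))).
Qed.

(** [A] is the union of the countably many closed sets of all [a] with [n a] in
    [y i + P], and the difference of two elements of such a set is mapped into
    [P] by [n]; so it is enough that one of them has an interior point. *)
Lemma baire_multiples (I : countType) (y : I -> K) A P : compact A -> subgrp A ->
    subgrp P -> closed P ->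
    (forall a, A a -> exists n i, (0 < n)%N /\ P (a *+ n - y i)) ->
  exists2 n, (0 < n)%N & open_in A [set a | P (a *+ n)].
Proof.
move=> cA sA sP cP AP.
have [|||[n i] [x [Ax [V V0 VF]]]] := @baire (nat * I)%type
    (fun ni => [set a | P (a *+ ni.1.+1 - y ni.2)]) A cA.
- by exists 0; exact: subgrp0.
- by move=> ni; exact: closed_mulrn.
- move=> a /AP[[|n] [i [//_ Pn]]]; by exists (n, i).
exists n.+1 => //; exists V => // v [Av Vv] /=.
have /= P1 : P ((x + v) *+ n.+1 - y i).
  by apply: VF; [exact: subgrpD|rewrite addrAC subrr add0r].
have /= P2 : P (x *+ n.+1 - y i).
  by apply: VF; rewrite // subrr; exact: nbhs_singleton.
rewrite (_ : v *+ n.+1 = ((x + v) *+ n.+1 - y i) - (x *+ n.+1 - y i)); last by zmod.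
exact: subgrpB.
Qed.

End Basics.

(** * Minimal group topologies *)

Section GroupBase.
Variables (G : zmodType) (I : Type) (B : I -> set G) (i0 : I).
Hypothesis B0 : forall i, B i 0.
Hypothesis BI : forall i j, exists k, B k `<=` B i `&` B j.
Hypothesis BS : forall i, exists j, forall x y, B j x -> B j y -> B i (x - y).

Definition base_open (A : set G) := forall x, A x -> exists i, forall z, B i z -> A (x + z).

Lemma base_openT : base_open setT.
Proof. by move=> x _; exists i0. Qed.

Lemma base_openI : setI_closed base_open.
Proof.
move=> A A' oA oA' x [/oA[i iA] /oA'[j jA]]; have [k kB] := BI i j; exists k.
by move=> z /kB[/iA ? /jA ?].
Qed.

Lemma base_open_bigU (J : Type) (f : J -> set G) :
  (forall j, base_open (f j)) -> base_open (\bigcup_j f j).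
Proof. by move=> of_ x [j _ /of_[i iA]]; exists i => z /iA fz; exists j. Qed.

Definition base_topologicalType : topologicalType :=
  HB.pack_for topologicalType (GRing.Zmodule.sort G)
    (isOpenTopological.Build (GRing.Zmodule.sort G) base_openT base_openI base_open_bigU).

Local Notation T := base_topologicalType.

Definition base_topology : Topological G := Topological.class T.

Lemma base_topology_openE (A : set G) : @open (Topological.Pack base_topology) A = base_open A.
Proof. by []. Qed.

Lemma base_topology_nbhsP (x : G) (A : set G) :
  @nbhs _ (Topological.Pack base_topology) x A <-> exists i, forall z, B i z -> A (x + z).
Proof.
rewrite nbhsE; split=> [[C [+ Cx] CA]|[i iA]].
  by rewrite base_topology_openE => /(_ x Cx)[i iC]; exists i => z /iC/CA.
exists [set y | exists j, forall z, B j z -> A (y + z)]; last first.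
  by move=> y [j jA]; have := jA 0 (B0 j); rewrite addr0.
split; last by exists i.
rewrite base_topology_openE => y [j jA]; have [k kj] := BS j; exists k => z kz.
have [l lk] := BS k; have [m mlk] := BI l k; exists m => w /mlk[lw kw].
rewrite -addrA; apply: jA; rewrite -[w]opprK; apply: kj => //.
by rewrite -sub0r; apply: lk.
Qed.

Lemma base_topology_group : is_group_topology base_topology.
Proof.
have BD i : exists j, forall x y, B j x -> B j y -> B i (x + y).
  have [j ji] := BS i; have [k kj] := BS j; have [l lkj] := BI k j; exists l => x y.
  move=> /lkj[_ jx] /lkj[ky _]; rewrite -[y]opprK; apply: ji => //.
  by rewrite -sub0r; apply: kj.
split=> [[x y] A|x A].
  move=> /base_topology_nbhsP[i iA]; have [j ji] := BD i.
  exists ([set x + z | z in B j], [set y + z | z in B j]) => /=.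
    by split; apply/base_topology_nbhsP; exists j => z jz; exists z.
  by move=> _ [/= [u ju <-] [v jv <-]] /=; rewrite addrACA; apply/iA/ji.
move=> /base_topology_nbhsP[i iA]; have [j ji] := BS i.
apply/base_topology_nbhsP; exists j => z jz /=; rewrite opprD; apply: iA.
by rewrite -sub0r; apply: ji.
Qed.

Lemma base_topology_hausdorff : (forall x, (forall i, B i x) -> x = 0) ->
  hausdorff_space (Topological.Pack base_topology).
Proof.
move=> B00 x y xy; apply/esym/eqP; rewrite -subr_eq0; apply/eqP/B00 => i.
have [j ji] := BS i.
have [||z [[u ju uz] [v jv vz]]] := xy [set x + z | z in B j] [set y + z | z in B j].
- by apply/base_topology_nbhsP; exists j => z jz; exists z.
- by apply/base_topology_nbhsP; exists j => z jz; exists z.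
by rewrite (_ : y - x = u - v); [exact: ji|rewrite -[u](addKr x) uz -vz; zmod].
Qed.

End GroupBase.

(** The use made of minimality: a Hausdorff group topology given by a base of
    neighbourhoods of [0] cannot be coarser without being the same. *)
Lemma minimal_base (G : topologicalZmodType) (I : Type) (B : I -> set G) (i0 : I) :
    minimal G -> (forall i, nbhs (0 : G) (B i)) ->
    (forall i j, exists k, B k `<=` B i `&` B j) ->
    (forall i, exists j, forall x y, B j x -> B j y -> B i (x - y)) ->
    (forall x, (forall i, B i x) -> x = 0) ->
  forall U, nbhs (0 : G) U -> exists i, B i `<=` U.
Proof.
move=> [hG minG] nB BI BS B00 U nU; apply: contrapT => nBU.
have B0 i : B i 0 by exact: nbhs_singleton.
apply: minG; exists (base_topology i0 BI); split.
- exact: base_topology_group.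
- exact: base_topology_hausdorff.
split=> [A|sub].
  rewrite base_topology_openE openE => oA x /oA[i iA].
  by apply/nbhs0P; exact: filterS (nB i).
move: nU; rewrite nbhsE => -[V [/sub + V0] VU].
rewrite base_topology_openE => /(_ 0 V0)[i iV]; apply: nBU; exists i => z /iV.
by rewrite add0r => /VU.
Qed.

Section SubgroupOfSet.
Variables (K : topologicalZmodType) (H : set K) (sH : subgrp H).

Definition set_pred : {pred K} := fun x => `[< H x >].

Lemma set_pred_zmod_closed : zmod_closed set_pred.
Proof.
split; first by apply/asboolP; exact: subgrp0.
by move=> x y /asboolP Hx /asboolP Hy; apply/asboolP; exact: subgrpB.
Qed.

Definition subgroup_of_set : zmodClosed K :=
  HB.pack_for (zmodClosed K) set_pred
    (GRing.isZmodClosed.Build K set_pred set_pred_zmod_closed).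

Lemma subgroup_of_setP x : x \in subgroup_of_set <-> H x.
Proof. by split=> /asboolP. Qed.

Lemma subgroup_nbhs0P (L : zmodClosed K) (U : set (subgroup L)) :
  nbhs (0 : subgroup L) U <->
  exists2 V : set K, nbhs (0 : K) V & forall s : subgroup L, V (subgroup_val s) -> U s.
Proof.
split=> [[_ [[W oW <-] W0 WU]]|[V V0 VU]].
  by exists W => //; apply: open_nbhs_nbhs; split.
have V' : nbhs (0 : subgroup L) (@subgroup_val K L @^-1` V).
  exact: (@subgroup_val_continuous K L 0 V V0).
exact: filterS V'.
Qed.

End SubgroupOfSet.

(** A dense minimal subgroup [H] meets every nontrivial closed subgroup [N]:
    otherwise [H] embeds in the quotient by [N], whose topology is coarser; by
    minimality it induces the same topology on [H], and then every point of
    [N], being a limit of points of [H], is a limit of small ones. *)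
Lemma densely_minimal_essential (K : topologicalZmodType) (H N : set K) :
    hausdorff_space K -> densely_minimal K -> subgrp H -> (forall x, closure H x) ->
    subgrp N -> closed N -> (exists2 x, N x & x != 0) ->
  exists x, [/\ H x, N x & x != 0].
Proof.
move=> hK dK sH dH sN cN [x Nx x0]; apply: contrapT => nHN.
have {}nHN h : H h -> N h -> h = 0.
  by move=> Hh Nh; apply: contrapT => /eqP h0; apply: nHN; exists h.
pose L := subgroup_of_set sH.
have HL h : H h -> h \in L by move=> Hh; apply/subgroup_of_setP.
have minL : minimal (subgroup L).
  apply: dK => U [y Uy] oU.
  have /(dH y)[h [Hh Uh]] : nbhs y U by exact: open_nbhs_nbhs.
  by exists h; split => //; exact: HL.
have LH (s : subgroup L) : H (subgroup_val s).
  by apply/subgroup_of_setP; exact: (valP s).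
have valB (s t : subgroup L) : subgroup_val (s - t) = subgroup_val s - subgroup_val t.
  exact: (raddfB (val : subgroup L -> K)).
have val0 : subgroup_val (0 : subgroup L) = 0 by exact: (raddf0 (val : subgroup L -> K)).
pose I := {V : set K | nbhs (0 : K) V}.
pose B (V : I) := [set s : subgroup L | sumset (sval V) N (subgroup_val s)].
have [W [cW W0 WN nWx]] := hausdorff_notin hK x0.
have [|||||[V V0] /= VW] := @minimal_base _ I B (exist _ setT filterT) minL _ _ _ _
    [set s | W (subgroup_val s)].
- move=> [V V0]; apply/subgroup_nbhs0P; exists V => // s Vs.
  by apply: sumset_subl Vs; exact: subgrp0.
- move=> [V V0] [U U0]; exists (exist _ (V `&` U) (filterI V0 U0)) => s /= sVU.
  by split; apply: sumsetSl sVU => z [].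
- move=> [V V0]; have [U [oU U0 _ _ UV]] := nbhs0_sub V0.
  have nU : nbhs (0 : K) U by exact: open_nbhs_nbhs.
  exists (exist _ U nU) => s t /= [a Ua Na] [b Ub Nb].
  exists (a - b); [exact: UV|rewrite valB].
  rewrite (_ : _ - _ - _ = (subgroup_val s - a) - (subgroup_val t - b)); last by zmod.
  exact: subgrpB.
- move=> s Bs; apply: val_inj; apply: (nHN _ (LH s)); apply: (closure_idS cN).
  apply: closureW => V /nbhs0_sub[U [oU U0 UN UV _]].
  have nU : nbhs (0 : K) U by exact: open_nbhs_nbhs.
  have [a Ua Na] := Bs (exist _ U nU); exists (subgroup_val s - a) => //.
  by rewrite addrAC subrr add0r; apply/UV/UN.
- by apply/subgroup_nbhs0P; exists W.
have [h Hh [Vh nWh]] := iffLR (closure_nbhs0 H x) (dH x) _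
  (filterI V0 (closed_notin cW nWx)).
apply: nWh; rewrite subrKC.
apply: (VW (Sub h (HL h Hh) : subgroup L)); exists (h - x) => //=.
by rewrite subKr.
Qed.

(** * Bogolyubov's lemma in finite groups of bounded exponent *)

Section Fourier.
Variables (m n : nat).
Local Notation d := m.+2.
Local Notation V := 'rV['Z_d]_n.
Variable zeta : algC.
Hypothesis zetaP : d.-primitive_root zeta.

Let chi (u : 'Z_d) : algC := zeta ^+ (u : nat).

Let chiD u v : chi (u + v) = chi u * chi v.
Proof. by rewrite /chi -exprD -(prim_expr_mod zetaP (u + v)). Qed.

Let chi0 : chi 0 = 1. Proof. by rewrite /chi expr0. Qed.

Let chi_neq1 u : u != 0 -> chi u != 1.
Proof.
move=> u0; rewrite /chi -(prim_order_dvd zetaP) gtnNdvd //.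
by rewrite lt0n; apply: contra u0 => /eqP u0; apply/eqP/val_inj.
Qed.

Let chi_norm u : `|chi u| = 1.
Proof.
apply/eqP; rewrite /chi normrX; suff -> : `|zeta| = 1 by rewrite expr1n.
have : `|zeta| ^+ d == 1 by rewrite -normrX (prim_expr_order zetaP) normr1.
by rewrite pexpr_eq1 // => /eqP.
Qed.

Let chi_conj u : (chi u)^* = chi (- u).
Proof.
have := congr1 (fun z => z ^+ 2) (chi_norm u); rewrite normCK expr1n => h.
by rewrite -[LHS]mul1r -chi0 -(subrr u) addrC chiD -mulrA h mulr1.
Qed.

Definition dotz (w v : V) : 'Z_d := \sum_i w 0 i * v 0 i.

Lemma dotzDl w w' v : dotz (w + w') v = dotz w v + dotz w' v.
Proof. by rewrite -big_split; apply: eq_bigr => i _; rewrite mxE mulrDl. Qed.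

Lemma dotzDr w v v' : dotz w (v + v') = dotz w v + dotz w v'.
Proof. by rewrite -big_split; apply: eq_bigr => i _; rewrite mxE mulrDr. Qed.

Lemma dotz0l v : dotz 0 v = 0.
Proof. by rewrite /dotz big1 // => i _; rewrite mxE mul0r. Qed.

Lemma dotz0r w : dotz w 0 = 0.
Proof. by rewrite /dotz big1 // => i _; rewrite mxE mulr0. Qed.

Lemma dotzNr w v : dotz w (- v) = - dotz w v.
Proof. by apply/eqP; rewrite -addr_eq0 -dotzDr addNr dotz0r. Qed.

Let e w v := chi (dotz w v).

Let eDr w v v' : e w (v + v') = e w v * e w v'.
Proof. by rewrite /e dotzDr chiD. Qed.

Let eN w v : e w (- v) = (e w v)^*.
Proof. by rewrite /e dotzNr chi_conj. Qed.

Let e_sum v : \sum_w e w v = if v == 0 then #|{: V}|%:R else 0.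
Proof.
have [->|v0] := eqVneq v 0.
  by rewrite (eq_bigr (fun _ => 1)) ?sumr_const // => w _; rewrite /e dotz0r chi0.
have [i vi] : exists i, v 0 i != 0.
  apply/existsP; apply: contraNT v0 => /existsPn v0; apply/eqP/rowP => i.
  by rewrite mxE; apply/eqP/negPn.
have wi : dotz (delta_mx 0 i) v = v 0 i.
  rewrite /dotz (bigD1 i) //= mxE !eqxx mul1r big1 ?addr0 // => j ji.
  by rewrite mxE eqxx (negPf ji) mul0r.
have : \sum_w e w v = chi (v 0 i) * \sum_w e w v.
  rewrite [LHS](reindex_inj (addrI (delta_mx 0 i))) mulr_sumr.
  by apply: eq_bigr => w _; rewrite /e dotzDl chiD wi.
move=> /eqP; rewrite -subr_eq0 -{1}[X in X - _]mul1r -mulrBl mulf_eq0 subr_eq0.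
by rewrite eq_sym (negPf (chi_neq1 vi)) => /eqP.
Qed.

Variable A : {set V}.

Let S w := \sum_(a in A) e w a.

Let S2 w : `|S w| ^+ 2 = \sum_(a in A) \sum_(b in A) e w (a - b).
Proof.
rewrite normCK rmorph_sum big_distrlr /=.
by apply: eq_bigr => a _; apply: eq_bigr => b _; rewrite eDr eN.
Qed.

Let parseval : \sum_w `|S w| ^+ 2 = #|{: V}|%:R * #|A|%:R.
Proof.
under eq_bigr do rewrite S2; rewrite exchange_big /=.
under eq_bigr do rewrite exchange_big /=.
under eq_bigr do under eq_bigr do rewrite e_sum subr_eq0.
rewrite (eq_bigr (fun _ => #|{: V}|%:R)); last first.
  move=> a Aa; rewrite (bigD1 a) //= eqxx big1 ?addr0 // => b /andP[_ ba].
  by rewrite eq_sym (negPf ba).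
by rewrite sumr_const mulr_natr.
Qed.

(** The sum counts, up to a factor, the representations of [x] in
    [A - A + A - A]. *)
Let S4 x : ~ (exists a b c d, [/\ a \in A, b \in A, c \in A, d \in A & x = a - b + (c - d)]) ->
  \sum_w `|S w| ^+ 4 * e w (- x) = 0.
Proof.
move=> nx; under eq_bigr => w _ do
  rewrite -[4%N]/(2 * 2)%N exprM expr2 S2 -mulrA mulr_suml.
rewrite exchange_big big1 // => a Aa.
under eq_bigr do rewrite mulr_suml.
rewrite exchange_big big1 // => b Ab.
under eq_bigr do rewrite mulr_suml mulr_sumr.
rewrite exchange_big big1 // => c Ac.
under eq_bigr do rewrite mulr_suml mulr_sumr.
rewrite exchange_big big1 // => c' Ac'.
under eq_bigr do rewrite -!eDr; rewrite e_sum addrA.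
case: eqP => // /eqP; rewrite subr_eq0 => /eqP xE.
by case: nx; exists a, b, c, c'; split.
Qed.

(** Bogolyubov's lemma: a set [A] of density [1 / k] is so structured that
    [A - A + A - A] contains the common kernel of at most [2 k ^ 2] linear forms.
    The forms are those where the Fourier transform [S] of [A] is large; there
    are few of them by Parseval's identity.  If [x] is in their kernel but not
    in [A - A + A - A], the sum over [w] of [|S w| ^ 4 e w (- x)] vanishes by [S4];
    but the large forms contribute at least [|A| ^ 4], at [w = 0] already, and
    the others are too small to cancel it. *)
Lemma bogolyubov_spectrum (k : nat) : (#|{: V}| <= k * #|A|)%N ->
  exists T : {set V}, (#|T| <= 2 * k ^ 2)%N /\
    forall x, (forall w, w \in T -> dotz w x = 0) ->
    exists a b c d, [/\ a \in A, b \in A, c \in A, d \in A & x = a - b + (c - d)].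
Proof.
move=> kA; set M := #|{: V}| in kA *.
have M0 : (0 < M)%N by rewrite /M; apply/card_gt0P; exists 0.
have A0 : (0 < #|A|)%N by move: (leq_trans M0 kA); rewrite muln_gt0 => /andP[].
pose T : {set V} := [set w | (#|A| ^ 3)%:R <= (2 * M)%:R * `|S w| ^+ 2]%SET.
exists T; split.
  have : (#|T| * #|A| ^ 3)%:R <= (2 * M * (M * #|A|))%:R :> algC.
    rewrite natrM mulr_natl -sumr_const [X in _ <= X]natrM [X in _ * X]natrM -parseval.
    rewrite mulr_sumr [X in _ <= X](bigID (mem T)) /= ler_wpDr //.
      by apply: sumr_ge0 => w _; rewrite mulr_ge0 ?exprn_ge0.
    by apply: ler_sum => w; rewrite inE.
  rewrite ler_nat => TA.
  rewrite -(leq_pmul2r (_ : 0 < #|A| ^ 3)%N) ?expn_gt0 ?A0 //.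
  apply: leq_trans TA _; rewrite (_ : 2 * M * (M * #|A|) = M * M * (2 * #|A|))%N; last by ring.
  rewrite (_ : 2 * k ^ 2 * #|A| ^ 3 = k * #|A| * (k * #|A|) * (2 * #|A|))%N; last by ring.
  by rewrite leq_mul2r leq_mul ?orbT.
move=> x Tx; apply: contrapT => /S4 /eqP.
rewrite (bigID (mem T)) /= addr_eq0 => /eqP TE.
have ST : \sum_(w in T) `|S w| ^+ 4 * e w (- x) = \sum_(w in T) `|S w| ^+ 4.
  by apply: eq_bigr => w /Tx; rewrite eN /e => ->; rewrite chi0 rmorph1 mulr1.
have S0 : S 0 = #|A|%:R.
  by rewrite /S (eq_bigr (fun _ => 1)) ?sumr_const // => a _; rewrite /e dotz0l chi0.
have T0 : 0 \in T.
  rewrite inE S0 normr_nat -natrX -natrM ler_nat (expnS _ 2) leq_mul2r; apply/orP; right.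
  rewrite (leq_trans (max_card _)) // -/M; lia.
have lo : (#|A| ^ 4)%:R <= \sum_(w in T) `|S w| ^+ 4 :> algC.
  rewrite (bigD1 0) //= S0 normr_nat -natrX ler_wpDr //.
  by apply: sumr_ge0 => w _; rewrite exprn_ge0.
have hi : `|\sum_(w in T) `|S w| ^+ 4| <= \sum_(w | w \notin T) `|S w| ^+ 4.
  rewrite -ST TE normrN; apply: le_trans (ler_norm_sum _ _ _) _.
  apply: ler_sum => w _; rewrite normrM chi_norm mulr1.
  by rewrite ger0_norm // exprn_ge0.
have hi2 : (2 * M)%:R * \sum_(w | w \notin T) `|S w| ^+ 4 <= (#|A| ^ 3 * (M * #|A|))%:R.
  rewrite [X in _ <= X]natrM [X in _ <= _ * X]natrM -parseval mulr_sumr mulr_sumr.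
  rewrite [X in _ <= X](bigID (mem T)) /= ler_wpDl //.
    by apply: sumr_ge0 => w _; rewrite mulr_ge0 ?exprn_ge0 ?ler0n.
  apply: ler_sum => w; rewrite inE -real_ltNge ?realn ?realM // => /ltW wT.
  by rewrite -[4%N]/(2 + 2)%N exprD mulrA ler_wpM2r ?exprn_ge0.
have : (2 * M * #|A| ^ 4)%:R <= (#|A| ^ 3 * (M * #|A|))%:R :> algC.
  apply: le_trans hi2; rewrite natrM ler_wpM2l ?ler0n //.
  apply: le_trans lo _; apply: le_trans hi; rewrite ger0_norm //.
  by apply: sumr_ge0 => w _; rewrite exprn_ge0.
rewrite ler_nat (_ : #|A| ^ 3 * (M * #|A|) = M * #|A| ^ 4)%N; last by ring.
rewrite leq_pmul2r ?expn_gt0 ?A0 //; lia.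
Qed.

End Fourier.

(** * Compact groups without proper open subgroups are divisible *)

(** In a sum of more than [#|W|] terms two partial sums coincide, and the terms
    between them can be dropped. *)
Lemma short_subsum (W : finZmodType) n (u : 'I_n -> W) :
  exists2 I : {set 'I_n}, (#|I| <= #|W|)%N & \sum_(i in I) u i = \sum_i u i.
Proof.
pose P (I : {set 'I_n}) := \sum_(i in I) u i == \sum_i u i.
have PT : P finset.setT by apply/eqP/eq_bigl => i; rewrite inE.
case: (arg_minnP (fun I : {set 'I_n} => #|I|) PT) => I /eqP PI Imin.
exists I => //; rewrite leqNgt; apply/negP => WI.
pose s := enum I; have ss : size s = #|I| by rewrite /s -cardE.
pose f (k : 'I_(size s).+1) := \sum_(i <- take k s) u i.
have [k [l [kl fkl]]] : exists k l : 'I_(size s).+1, (k < l)%N /\ f k = f l.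
  have /injectivePn[k [l kl fkl]] : ~~ injectiveb f.
    apply/negP => /injectiveP /leq_card; rewrite card_ord ss.
    by rewrite leqNgt ltnS ltnW.
  have [lt|lt|/val_inj/eqP] := ltngtP (val k) (val l); [by exists k, l|by exists l, k|].
  by rewrite (negPf kl).
pose t := take k s ++ drop l s.
have us : uniq s by exact: enum_uniq.
have ut : uniq t.
  apply: subseq_uniq us; rewrite -[X in subseq _ X](cat_take_drop l s) cat_subseq //.
  by rewrite -(take_takel s (ltnW kl)) take_subseq.
have : P [set i in t]%SET.
  apply/eqP; rewrite -PI (eq_bigl (mem t)) => [|i]; last by rewrite inE.
  rewrite -big_uniq // big_cat /= -[X in X + _]/(f k) fkl /f -big_cat cat_take_drop.
  by rewrite /s big_enum.
move=> /Imin; rewrite leqNgt cardsE => /negP; apply.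
rewrite (leq_ltn_trans (card_size _)) // size_cat size_take size_drop -ss.
have := ltn_ord l; move: (size s) (k : nat) (l : nat) kl => a b e; case: ifP; lia.
Qed.

Section NoOpen.
Variable K : topologicalZmodType.
Implicit Types (A B C P U V W : set K).

Definition no_open_subgroup C := forall P, subgrp P -> P `<=` C -> open_in C P -> C `<=` P.

Lemma nbhs0_bigsum n U : nbhs (0 : K) U -> exists W, [/\ nbhs (0 : K) W,
  (forall x, W x -> W (- x)) & forall r : seq K, (size r <= n)%N ->
    (forall x, x \in r -> W x) -> U (\sum_(x <- r) x)].
Proof.
elim: n U => [|n IHn] U U0.
  have [W [oW W0 WN _ _]] := nbhs0_sub U0.
  exists W; split => //; first exact: open_nbhs_nbhs.
  by move=> r; rewrite leqn0 size_eq0 => /eqP -> _; rewrite big_nil; exact: nbhs_singleton.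
have [U' [oU' U'0 U'N _ U'U]] := nbhs0_add U0.
have nU' : nbhs (0 : K) U' by exact: open_nbhs_nbhs.
have [W [W0 WN WU']] := IHn _ nU'.
exists (W `&` U'); split.
- exact: filterI.
- by move=> x [Wx U'x]; split; [exact: WN|exact: U'N].
move=> [|x r] /= rn rW; first by rewrite big_nil; exact: nbhs_singleton.
rewrite big_cons; apply: U'U; first by case: (rW x _); rewrite ?mem_head.
by apply: WU' => // y yr; case: (rW y _); rewrite ?inE ?yr ?orbT.
Qed.

(** The elements of [C] in [W] generate an open subgroup of [C]. *)
Lemma no_open_generated C W x : subgrp C -> no_open_subgroup C -> nbhs (0 : K) W ->
  (forall x, W x -> W (- x)) -> C x ->
  exists2 r : seq K, (forall y, y \in r -> W y /\ C y) & x = \sum_(y <- r) y.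
Proof.
move=> sC nC W0 WN Cx.
pose P := [set x | exists2 r : seq K, (forall y, y \in r -> W y /\ C y) & x = \sum_(y <- r) y].
suff : C `<=` P by apply.
apply: nC.
- split; first by exists [::]; rewrite ?big_nil.
  move=> _ _ [r rW ->] [s sW ->]; exists (r ++ map -%R s).
    move=> y; rewrite mem_cat => /orP[/rW//|/mapP[z /sW[Wz Cz] ->]].
    by split; [exact: WN|exact: (subgrpN sC Cz)].
  by rewrite big_cat big_map /= sumrN.
- by move=> _ [r rW ->]; rewrite big_seq; apply: subgrp_sum => // y /rW[].
- exists W => // y [Cy Wy]; exists [:: y]; last by rewrite big_seq1.
  by move=> z; rewrite inE => /eqP ->.
Qed.

(** If [c] is not in [d C], write [c] as a sum of very small elements [w i] of
    [C].  They define a map [f], linear modulo [d C], from a free [Z/d]-module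
    of unbounded rank to [C].  The preimage under [f] of some small cell of [C]
    has density at least [1 / k], where the number [k] of cells does not depend
    on the [w i].  By Bogolyubov's lemma, [f] is small on a submodule defined by
    boundedly many linear forms; modulo that submodule, [c] is a sum of boundedly
    many [w i], hence is close to [0] modulo [d C], a contradiction. *)
Lemma no_open_divisible C : hausdorff_space K -> compact C -> subgrp C ->
  no_open_subgroup C -> divisible C.
Proof.
move=> hK cC sC nC c [|[|m]] Cc // _; first by exists c.
set d := m.+2; pose Q := [set a *+ d | a in C].
have sQ : subgrp Q by exact: subgrp_mulrn.
have cQ : closed Q by apply: compact_closed => //; exact: compact_mulrn.
apply: contrapT => nQ; have {}nQ : ~ Q c by move=> [a Ca ac]; apply: nQ; exists a.
have /nbhs0_sub[U1 [oU1 U10 _ _ U1P]] := closed_notin cQ nQ.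
have nU1 : nbhs (0 : K) U1 by exact: open_nbhs_nbhs.
have [U2 [oU2 U20 _ _ U2P]] := nbhs0_sub nU1.
have nU2 : nbhs (0 : K) U2 by exact: open_nbhs_nbhs.
have [U3 [oU3 U30 _ _ U3P]] := nbhs0_sub nU2.
have nU3 : nbhs (0 : K) U3 by exact: open_nbhs_nbhs.
have [s [_ sC3]] := compact_cover_nbhs0 cC nU3; set k := size s in sC3.
have [W [W0 WN WU1]] := nbhs0_bigsum (d ^ (2 * k ^ 2)) nU1.
have [r rW cE] := no_open_generated sC nC W0 WN Cc.
set n := size r; pose w (i : 'I_n) := r`_i.
have wr i : w i \in r by rewrite mem_nth.
pose f (v : 'rV['Z_d]_n) := \sum_i w i *+ (v 0 i : nat).
have Cf v : C (f v).
  by apply: subgrp_sum => // i _; apply: subgrpMn => //; case: (rW _ (wr i)).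
have fD u v : Q (f u + f v - f (u + v)).
  rewrite -big_split -sumrB; apply: subgrp_sum => // i _.
  rewrite mxE /= -mulrnDr -mulrnBr ?leq_mod //.
  rewrite {1}(divn_eq (u 0 i + v 0 i) d) addnK mulrnA; exists (w i *+ ((u 0 i + v 0 i) %/ d)) => //.
  by apply: subgrpMn => //; case: (rW _ (wr i)).
have fB u v : Q (f (u - v) - (f u - f v)).
  by have := fD (u - v) v; rewrite subrK opprB addrA addrAC.
have [g gP] : {g : 'rV['Z_d]_n -> 'I_k & forall v, U3 (f v - s`_(g v))}.
  apply: (@choice _ _ (fun v (j : 'I_k) => U3 (f v - s`_j))) => v.
  have [a aS U3a] := sC3 _ (Cf v); rewrite -index_mem in aS.
  by exists (Ordinal aS); rewrite nth_index // -index_mem.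
pose A (j : 'I_k) : {set 'rV['Z_d]_n} := [set v | g v == j]%SET.
have [j kA] : exists j, (#|{: 'rV['Z_d]_n}| <= k * #|A j|)%N.
  case: (arg_maxnP (fun j => #|A j|) (erefl : predT (g 0))) => j _ jmax; exists j.
  rewrite -[X in (X <= _)%N]sum1_card (partition_big g predT) //=.
  have : (\sum_(i < k) #|A i| <= \sum_(i < k) #|A j|)%N by apply: leq_sum => i _; exact: jmax.
  rewrite sum_nat_const card_ord => h. apply: (leq_trans _ h).
  by apply: leq_sum => i _; rewrite sum1dep_card.
(* [I] selects boundedly many of the [w i], with the same values of the forms
   in [T] as the sum of all of them. *)
have [z zP] := C_prim_root_exists (ltn0Sn m.+1).
have [T [Tk TP]] := bogolyubov_spectrum zP kA.
pose u (i : 'I_n) : 'rV['Z_d]_n := delta_mx 0 i.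
pose q (v : 'rV['Z_d]_n) : 'rV['Z_d]_#|T| := \row_(t < #|T|) dotz (enum_val t) v.
have [I Icard Isum] := short_subsum (fun i => q (u i)).
have qsum (J : {set 'I_n}) : q (\sum_(i in J) u i) = \sum_(i in J) q (u i).
  apply/rowP => t; rewrite mxE summxE.
  elim/big_rec2: _ => [|i a b _ IH]; first by rewrite dotz0r.
  by rewrite dotzDr IH mxE.
have fI (J : {set 'I_n}) : f (\sum_(i in J) u i) = \sum_(i in J) w i.
  rewrite [RHS]big_mkcond; apply: eq_bigr => i _; rewrite summxE.
  case: ifPn => iJ.
    rewrite (bigD1 i) //= mxE !eqxx big1 ?addr0 // => l /andP[_ li].
    by rewrite mxE eqxx eq_sym (negPf li).
  by rewrite big1 // => l lJ; rewrite mxE eqxx; case: eqP => // il; rewrite il lJ in iJ.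
pose x := \sum_(i in finset.setT) u i - \sum_(i in I) u i.
have [|a [b [a' [b' [Aa Ab Aa' Ab' xE]]]]] := TP x.
  move=> t tT; rewrite dotzDr dotzNr; apply/eqP; rewrite subr_eq0; apply/eqP.
  have : q (\sum_(i in finset.setT) u i) = q (\sum_(i in I) u i).
    by rewrite !qsum Isum; apply: eq_bigl => i; rewrite inE.
  by move=> /rowP /(_ (enum_rank_in tT t)); rewrite !mxE enum_rankK_in.
set X := \sum_(i in finset.setT) u i in x xE; set Y := \sum_(i in I) u i in x xE.
have fX : f X = c.
  rewrite fI cE (eq_bigl predT) => [|i]; last by rewrite inE.
  by rewrite [RHS](big_nth 0) big_mkord.
have fY : U1 (f Y).
  rewrite fI -big_enum -(big_map w xpredT id); apply: WU1 => [|y /mapP[i _ ->]]; last first.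
    by case: (rW _ (wr i)).
  rewrite size_map -cardE; apply: leq_trans Icard _.
  by rewrite card_mx card_ord mul1n leq_exp2l.
have fAB v v' : v \in A j -> v' \in A j -> U2 (f v - f v').
  rewrite !inE => /eqP gv /eqP gv'.
  rewrite (_ : _ - _ = (f v - s`_(g v)) - (f v' - s`_(g v'))); first exact: U3P.
  by rewrite gv gv'; zmod.
have := U1P _ _ (U2P _ _ (fAB _ _ Ab' Aa') (fAB _ _ Aa Ab)) fY; apply.
rewrite -fX (_ : f X + _ = (f (a - b) - (f a - f b)) + (f (a' - b') - (f a' - f b'))
  - (f (a - b) + f (a' - b') - f x) - (f x - (f X - f Y))); last by zmod.
apply: (subgrpB sQ _ (fB X Y)); apply: (subgrpB sQ); first exact: (subgrpD sQ).
by rewrite [in f x]xE.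
Qed.

End NoOpen.

(** * Compact divisible subgroups of essential groups *)

Section TrivialMeet.
Variable G : zmodType.
Implicit Types (A H N : set G).

Lemma maximal_trivial_meet H0 A N :
    subgrp H0 -> subgrp A -> subgrp N -> H0 `<=` A -> (forall x, H0 x -> N x -> x = 0) ->
  exists H, [/\ subgrp H, H0 `<=` H, H `<=` A, (forall x, H x -> N x -> x = 0) &
    forall a, A a -> exists n z, [/\ (0 < n)%N, N z & H (a *+ n - z)]].
Proof.
move=> sH0 sA sN H0A H0N.
have [|H [sH H0H HA HS Hmax]] :=
    @maximal_avoiding _ H0 A [set z | N z /\ z != 0] sH0 sA H0A.
  by move=> x Hx [Nx /eqP]; apply; exact: H0N.
have HN x : H x -> N x -> x = 0.
  by move=> Hx Nx; apply: contrapT => /eqP x0; exact: (HS x Hx).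
exists H; split => // a Aa; have [Ha|nHa] := pselect (H a).
  by exists 1%N, 0; split; rewrite ?subr0//; exact: subgrp0.
have [h [Hh [j [Nz /eqP z0]]]] := Hmax a Aa nHa.
case: (intP j) Nz z0 => [|m|m].
- by rewrite mulr0z addr0 => Nh; case; exact: HN.
- move=> Nz _; exists m.+1, (h + a *~ m.+1); split => //.
  by rewrite (_ : _ - _ = - h); [exact: subgrpN|zmod].
- move=> Nz _; exists m.+1, (- (h + a *~ - m.+1%:Z)); split => //; first exact: subgrpN.
  by rewrite (_ : _ - _ = h) //; zmod.
Qed.

End TrivialMeet.

Section Supplement.
Variable K : topologicalZmodType.
Implicit Types (A B C M P : set K).

Lemma open_in_closed A P : closed A -> subgrp P -> P `<=` A -> subgrp A ->
  open_in A P -> closed P.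
Proof.
move=> cA sP PA sA [V V0 AVP]; apply: closed_nbhs0 => x clx.
have Ax : A x.
  apply: (closure_idS cA); apply: closureW => W /clx[p Pp Wp]; exists p => //; exact: PA.
have [p Pp Vp] := clx V V0; rewrite -(subKr p x); apply: subgrpB => //.
by apply: AVP; split => //; apply: subgrpB => //; exact: PA.
Qed.

(** By compactness, intersections of chains of closed supplements of [M] are
    supplements of [M]. *)
Lemma minimal_supplement C M : compact C -> closed C -> subgrp C -> subgrp M -> closed M ->
  exists A, [/\ subgrp A, closed A, A `<=` C, C `<=` sumset A M &
    forall B, subgrp B -> closed B -> B `<=` A -> C `<=` sumset B M -> A `<=` B].
Proof.
move=> cC clC sC sM cM.
pose T := {A : set K | [/\ subgrp A, closed A, A `<=` C & C `<=` sumset A M]}.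
have TC : [/\ subgrp C, closed C, C `<=` C & C `<=` sumset C M].
  by split => //; apply: sumset_subl; exact: subgrp0.
pose R (A B : T) := `[< sval B `<=` sval A >].
have [||F Ftot|A0 Amax] := @ZL_preorder T (exist _ C TC) R.
- by move=> A; apply/asboolP.
- by move=> A B D /asboolP BA /asboolP DB; apply/asboolP; exact: subset_trans BA.
- pose A := C `&` \bigcap_(B in F) sval B.
  have TA : [/\ subgrp A, closed A, A `<=` C & C `<=` sumset A M].
    split.
    + by apply: subgrpI => //; apply: subgrp_bigcap => B _; case: (svalP B).
    + apply: closedI => //; apply: closed_bigI => B _; by case: (svalP B).
    + by move=> x [].
    move=> c Cc; have [[B0 FB0]|F0] := pselect (exists B : T, F B); last first.
      exists c; last by rewrite subrr; exact: subgrp0.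
      by split => // B FB; case: F0; exists B.
    pose I := {B : T | F B}.
    have [|||a Ca aF] := @compact_directed K C I
      (fun B : I => sval (sval B) `&` [set a | M (c - a)]) (exist _ B0 FB0) cC.
    + move=> [B FB] /=; have [_ clB _ _] := svalP B; apply: closedI => //.
      have : closed [set a | M (- (a - c))].
        by apply: (@closed_translate _ c [set a | M (- a)]); exact: closed_opp.
      by congr closed; apply/funext => a /=; rewrite opprB.
    + move=> [B FB] [D FD]; have [/asboolP DB|/asboolP BD] := Ftot _ _ FB FD.
        by exists (exist _ D FD) => z [/= Dz Mz]; split; split => //; exact: DB.
      by exists (exist _ B FB) => z [/= Bz Mz]; split; split => //; exact: BD.
    + move=> [B FB] /=; have [_ _ BC CB] := svalP B; have [b Bb Mb] := CB c Cc.
      by exists b; split => //; exact: BC.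
    exists a; last by have [_] := aF (exist _ B0 FB0).
    by split => // B FB; have [] := aF (exist _ B FB).
  by exists (exist _ A TA) => B FB; apply/asboolP => x /= [_ Ax]; exact: Ax.
have [sA clA AC CAM] := svalP A0.
exists (sval A0); split => // B sB clB BA CB.
have TB : [/\ subgrp B, closed B, B `<=` C & C `<=` sumset B M].
  by split => //; exact: subset_trans AC.
have := Amax (exist _ B TB) => /(_ _)/asboolP; apply; exact/asboolP.
Qed.

(** An open subgroup [P] of [A] has finite index in it, so [P + M] has finite
    index in the divisible group [C]: it is [C], and [P] is [A] by minimality. *)
Lemma supplement_no_open C M A : compact C -> subgrp C -> divisible C ->
    subgrp M -> closed M -> compact M -> closed A -> subgrp A -> A `<=` C ->
    M `<=` C -> C `<=` sumset A M ->
    (forall B, subgrp B -> closed B -> B `<=` A -> C `<=` sumset B M -> A `<=` B) ->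
  no_open_subgroup A.
Proof.
move=> cC sC dC sM clM cM clA sA AC MC CAM Amin P sP PA oP.
have cA : compact A := subclosed_compact clA cC AC.
have clP : closed P := open_in_closed clA sP PA sA oP.
apply: Amin => //.
have sPM : subgrp (sumset P M) by exact: subgrp_sumset.
apply: divisible_open_in => //.
have [s [_ sAP]] := compact_finite_index cA sP oP sA.
apply: (@finite_index_open _ _ _ s) => //.
  by rewrite sumsetC; exact: closed_sumset.
move=> c /CAM[a Aa Mca]; have [t ts Pat] := sAP a Aa; exists t => //.
by exists (a - t) => //; rewrite (_ : _ - _ = c - a) //; zmod.
Qed.

End Supplement.

Section Essential.
Variable K : topologicalZmodType.
Hypothesis hK : hausdorff_space K.
Implicit Types (A B C H N M P : set K).

Definition essential_dense := forall H N, subgrp H -> (forall x, closure H x) ->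
  subgrp N -> closed N -> (exists2 x, N x & x != 0) ->
  exists x, [/\ H x, N x & x != 0].

Hypothesis essK : essential_dense.

(** If [C / H] is divisible, it has a complement in [K / H], and so a dense
    subgroup of [C] that misses [N] extends to one of [K]. *)
Lemma essential_relative C H N : subgrp C -> subgrp H -> H `<=` C -> C `<=` closure H ->
    (forall c n, C c -> (0 < n)%N -> exists2 c', C c' & H (c - c' *+ n)) ->
    subgrp N -> closed N -> N `<=` C -> (exists2 x, N x & x != 0) ->
  exists x, [/\ H x, N x & x != 0].
Proof.
move=> sC sH HC CH divC sN clN NC nN.
have [H' [sH' HH' _ H'C KH']] :=
  @divisible_complement _ setT C H (@subgrpT _) sC sH HC (fun _ _ => I) divC.
have [|x [H'x Nx x0]] := essK sH' _ sN clN nN.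
  move=> x; have [h H'h Cxh] := KH' x I.
  apply: (subgrp_subK (subgrp_closure sH') (subset_closure H'h)).
  exact: closureS HH' _ (CH _ Cxh).
by exists x; split => //; apply: H'C; split => //; exact: NC.
Qed.

(** By Baire's theorem, some positive multiple of an open subgroup of [C] lies in
    [F]; and the only open subgroup of a compact divisible group is the whole. *)
Lemma divisible_dense C (F : set K) y : compact C -> subgrp C -> divisible C ->
    subgrp F -> closed F ->
    (forall c, C c -> exists n (j : int), (0 < n)%N /\ F (c *+ n - y *~ j)) ->
  C `<=` F.
Proof.
move=> cC sC dC sF clF CF.
have [n n0 oF] := baire_multiples cC sC sF clF CF.
have sFn : subgrp [set a : K | F (a *+ n)].
  split; first by rewrite /= mul0rn; exact: subgrp0.
  by move=> a b Fa Fb; rewrite /= mulrnBl; exact: subgrpB.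
have CFn := divisible_open_in cC sC dC sFn oF.
by move=> c Cc; have [b Cb <-] := dC c n Cc n0; exact: CFn.
Qed.

Lemma finite_cyc_torsion (x : K) n : (0 < n)%N -> x *+ n = 0 -> finite_set (cyc x).
Proof.
move=> n0 xn; rewrite (_ : cyc x = (fun k => x *+ k) @` `I_n).
  by apply: finite_image; exact: finite_II.
apply/seteqP; split=> [_ [j _ <-]|_ [k _ <-]]; last by exists k.
exists `|(j %% n)%Z|%N; first by rewrite /= -ltz_nat gez0_abs ?modz_ge0 ?ltz_pmod //; lia.
rewrite {2}(divz_eq j n) mulrzDr mulrC mulrzA -[x *~ n]/(x *+ n) xn mul0rz add0r.
by rewrite -[in RHS](gez0_abs (modz_ge0 _ _)) //; lia.
Qed.

Lemma compact_cyc_torsion (x : K) n : (0 < n)%N -> x *+ n = 0 -> compact (cyc x).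
Proof. by move=> n0 /(finite_cyc_torsion n0); exact: finite_compact. Qed.

Section DivisibleSubgroup.
Variable C : set K.
Hypotheses (cC : compact C) (sC : subgrp C) (dC : divisible C).

Let clC : closed C. Proof. exact: compact_closed. Qed.

Lemma essential_divisible H N : subgrp H -> H `<=` C -> C `<=` closure H ->
    subgrp N -> closed N -> N `<=` C -> (exists2 x, N x & x != 0) ->
  exists x, [/\ H x, N x & x != 0].
Proof.
move=> sH HC CH; apply: (essential_relative sC sH HC CH) => c n Cc n0.
by have [b Cb <-] := dC Cc n0; exists b => //; rewrite subrr; exact: subgrp0.
Qed.

(** Otherwise a subgroup of [C] maximal among those with trivial intersection
    with [<x>] is dense by [divisible_dense], against the hypothesis on [K] as
    [<x>] is closed. *)
Lemma essential_torsion_free (x : K) n : C x -> (0 < n)%N -> x *+ n = 0 -> x = 0.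
Proof.
move=> Cx n0 xn; apply: contrapT => /eqP x0.
have sx : subgrp (cyc x) by exact: subgrp_cyc.
have cx : closed (cyc x) by apply: compact_closed => //; exact: compact_cyc_torsion xn.
have xC : cyc x `<=` C by exact: cyc_sub.
have [||H [sH _ HC HN Hmax]] := @maximal_trivial_meet _ [set 0] C (cyc x) (@subgrp_set0 _) sC sx.
- by move=> _ ->; exact: subgrp0.
- by move=> _ ->.
have [||z [Hz xz /eqP z0]] := @essential_divisible H (cyc x) sH HC _ sx cx xC.
- apply: (@divisible_dense _ _ x) => //; [exact: subgrp_closure|exact: closed_closure|].
  move=> c /Hmax[m [_ [m0 [j _ <-] Hj]]]; exists m, j; split => //.
  exact: subset_closure.
- by exists x => //; exact: cyc_id.
- by apply: z0; exact: HN.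
Qed.

(** Let [M] be the closure of [<x>], [A] a minimal closed supplement of [M] in
    [C], which is divisible, and [E] a subgroup of [A] maximal with trivial
    intersection with [M].  If [E] is trivial, then [A] is torsion modulo
    [A `&` M], so that [A] is contained in [M] and [C = M].  Otherwise, let [a] be
    a nonzero element of [E], and [E0] a subgroup of [E] maximal with trivial
    intersection with [<a>].  The closure of [E0] is a supplement of [M], so [E0]
    is dense in [A].  Then [E0 + <a + x>] is dense in [C], its closure containing
    [A], [a] and [x]; but it meets [M] trivially, because the sum of [E] and [M]
    is direct and [a] has infinite order modulo [E0]. *)
Lemma essential_monothetic (x : K) : C x -> x != 0 -> C `<=` closure (cyc x).
Proof.
move=> Cx x0; set M := closure (cyc x).
have sM : subgrp M by apply: subgrp_closure; exact: subgrp_cyc.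
have clM : closed M by exact: closed_closure.
have Mx : M x by apply: subset_closure; exact: cyc_id.
have MC : M `<=` C by apply: closure_mono_sub => //; exact: cyc_sub.
have cM : compact M := subclosed_compact clM cC MC.
have [A [sA clA AC CAM Amin]] := minimal_supplement cC clC sC sM clM.
have cA : compact A := subclosed_compact clA cC AC.
have dA : divisible A.
  by apply: no_open_divisible => //; exact: supplement_no_open Amin.
have sAM : subgrp (A `&` M) by exact: subgrpI.
have clAM : closed (A `&` M) by exact: closedI.
have cAM : compact (A `&` M) by apply: (subclosed_compact clAM cC) => z [/AC].
have [||E [sE _ EA EN Emax]] :=
    @maximal_trivial_meet _ [set 0] A (A `&` M) (@subgrp_set0 _) sA sAM.
- by move=> _ ->; exact: subgrp0.
- by move=> _ ->.
have [[a Ea a0]|nE] := pselect (exists2 a, E a & a != 0); last first.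
  have AM : A `<=` A `&` M.
    apply: (@divisible_dense _ _ 0) => // c /Emax[n [z [n0 Nz Ez]]].
    exists n, 0; split => //; rewrite mul0rz subr0.
    suff -> : c *+ n = z by [].
    by apply/eqP; rewrite -subr_eq0; apply/negPn/negP => cz0; apply: nE; exists (c *+ n - z).
  by move=> c /CAM[b /AM[_ Mb]]; exact: subgrp_subK.
have sa : subgrp (cyc a) by exact: subgrp_cyc.
have [||E0 [sE0 _ E0E E0a E0max]] := @maximal_trivial_meet _ [set 0] E (cyc a) (@subgrp_set0 _) sE sa.
- by move=> _ ->; exact: subgrp0.
- by move=> _ ->.
have scE0 := subgrp_closure sE0.
have AF : A `<=` sumset (A `&` M) (closure E0).
  apply: (@divisible_dense _ _ a) => //; first exact: subgrp_sumset.
    by apply: closed_sumset => //; exact: closed_closure.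
  move=> c /Emax[n [z [n0 Nz /E0max[m [_ [m0 [j _ <-] E0j]]]]]].
  exists (n * m)%N, j; split; first by rewrite muln_gt0 n0.
  exists (z *+ m); first exact: subgrpMn.
  by apply: subset_closure; congr E0: E0j; zmod.
have AE0 : A `<=` closure E0.
  apply: Amin => //; first exact: closed_closure.
    by apply: closure_mono_sub => //; exact: subset_trans EA.
  move=> c /CAM[b /AF[z [_ Mz] E0z] Mb]; exists (b - z) => //.
  by rewrite (_ : _ - _ = (c - b) + z); [exact: (subgrpD sM)|zmod].
pose H := sumset E0 (cyc (a + x)).
have sH : subgrp H by apply: subgrp_sumset => //; exact: subgrp_cyc.
have Aa := EA _ Ea; have scH := subgrp_closure sH.
have E0H : E0 `<=` H by apply: sumset_subl; exact: (subgrp0 (subgrp_cyc _)).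
have AH : A `<=` closure H by apply: (subset_trans AE0); exact: closureS.
have Hx : closure H x.
  apply: (subgrp_addKl scH (AH _ Aa)); apply: subset_closure.
  by apply: sumset_subr; [exact: subgrp0|exact: cyc_id].
have MH : M `<=` closure H by apply: closure_mono_sub; [exact: closed_closure|exact: cyc_sub].
have [|||z [[e E0e [j _ zE]] Mz z0]] := @essential_divisible H M sH _ _ sM clM MC.
- apply: sumset_sub => //; first by apply: (subset_trans E0E); exact: (subset_trans EA).
  by apply: cyc_sub => //; apply: subgrpD => //; exact: AC.
- by move=> c /CAM[b /AH Hb /MH]; exact: subgrp_subK.
- by exists x.
have ea0 : e + a *~ j = 0.
  apply: EN; first by apply: (subgrpD sE (E0E _ E0e)); exact: (subgrpMz j sE Ea).
  split; first by apply: (subgrpD sA (EA _ (E0E _ E0e))); exact: (subgrpMz j sA Aa).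
  rewrite (_ : _ + _ = z - x *~ j); first by apply: (subgrpB sM Mz); exact: (subgrpMz j sM Mx).
  by rewrite -[z](subrK e) -zE; zmod.
have e0 : e = 0.
  by apply: E0a => //; exists (- j) => //; rewrite mulrNz; apply/eqP; rewrite eq_sym -addr_eq0 ea0.
move: ea0 zE; rewrite e0 add0r subr0 => aj zE.
have j0 : j = 0.
  apply: contrapT => /eqP j0; case/eqP: a0.
  apply: (@essential_torsion_free a `|j|%N (AC _ Aa)); first by rewrite absz_gt0.
  exact: (@subgrp_absz _ [set 0] a j (@subgrp_set0 _)).
by case/eqP: z0; rewrite -zE j0 mulr0z.
Qed.

End DivisibleSubgroup.

End Essential.

(** * Doubling in compact torsion-free divisible groups *)

Section Expansive.
Variable K : topologicalZmodType.
Hypothesis hK : hausdorff_space K.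
Implicit Types (A B C U V W : set K).
Variable C : set K.
Hypotheses (cC : compact C) (sC : subgrp C) (dC : divisible C).
Hypothesis tfC : forall x n, C x -> (0 < n)%N -> x *+ n = 0 -> x = 0.

(** In a compact group without small subgroups, no nontrivial orbit of the
    doubling map stays close to [0].  Let [y] be the point of the orbit whose
    multiples leave [U0] first, say at [z = n.+1 y].  All points [2 ^ k y] of
    the orbit have their first [n] multiples in [U0], so many multiples of [z]
    remain in [U0 + U0].  By compactness, and as [U] contains no subgroup, this
    forces [z] to be in [U0], a contradiction. *)
Lemma doubling_expansive U : closed U -> nbhs (0 : K) U ->
    (forall x, C x -> (forall j, U (x *+ j)) -> x = 0) ->
  exists2 B, nbhs (0 : K) B & forall x, C x -> (forall i, B (x *+ 2 ^ i)) -> x = 0.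
Proof.
move=> clU nU noU; have [V [oV V0 _ _ VU]] := nbhs0_add nU.
have nV : nbhs (0 : K) V by exact: open_nbhs_nbhs.
have [U0 [clU0 nU0 U0V _]] := closed_nbhs0_sub nV.
have [W [oW W0] WU0] : exists2 W, open_nbhs (0 : K) W & W `<=` U0.
  by move: nU0; rewrite nbhsE.
have [L LW] : exists L, forall z, C z -> (forall j, (j <= L)%N -> U (z *+ j)) -> W z.
  apply: contrapT => nL.
  have [|||z Cz Fz] := @compact_directed K C nat
    (fun L => [set z | forall j, (j <= L)%N -> U (z *+ j)] `&` ~` W) 0 cC.
  - move=> L; apply: closedI; last exact: open_closedC.
    rewrite (_ : mkset _ = \bigcap_(j in [set j | (j <= L)%N]) [set z | U (z *+ j)]).
      apply: closed_bigI => j _; have := @closed_mulrn K j 0 U clU.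
      by congr closed; apply/funext => z /=; rewrite subr0.
    by apply/seteqP; split=> z h j /h.
  - move=> L M; exists (maxn L M) => z [/= Uz Wz]; split; split => // j jL; apply: Uz.
      by rewrite leq_max jL.
    by rewrite leq_max jL orbT.
  - move=> L; apply: contrapT => nz; apply: nL; exists L => z Cz Uz.
    by apply: contrapT => nWz; apply: nz; exists z.
  have z0 : z = 0 by apply: noU => // j; have [+ _] := Fz j; apply.
  by have [_ /=] := Fz 0%N; rewrite z0.
(* For [j <= L], [j n.+1 = 2 ^ L.+1 a + r] with [a <= n] and [r < 2 ^ L.+1], so
   that [j z] is the sum of a small multiple of a point of the orbit of [y] and
   of a small multiple of [y], which is in [B]. *)
pose B := [set b : K | forall r, (r <= 2 ^ L.+1)%N -> U0 (b *+ r)].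
exists B; first exact: nbhs0_muln.
move=> x Cx Bx; apply: contrapT => /eqP x0.
pose leaves n := exists i, ~ U0 (x *+ 2 ^ i *+ n.+1).
have exn : exists n, `[< leaves n >].
  apply: contrapT => nn; case/eqP: x0; apply: noU => // -[|n].
    by rewrite mulr0n; exact: nbhs_singleton.
  suff /U0V /VU : U0 (x *+ n.+1) by move=> /(_ 0 V0); rewrite addr0.
  apply: contrapT => nx; apply: nn; exists n; apply/asboolP; exists 0%N.
  by rewrite expn0 mulr1n.
case: (ex_minnP exn) => n /asboolP[i yn] nmin; set y := x *+ 2 ^ i in yn.
have orb i' j : (j <= n)%N -> U0 (x *+ 2 ^ i' *+ j).
  case: j => [_|j jn]; first by rewrite mulr0n; exact: nbhs_singleton.
  apply: contrapT => nU0j; have /nmin : `[< leaves j >] by apply/asboolP; exists i'.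
  by rewrite leqNgt jn.
have n0 : (0 < n)%N.
  rewrite lt0n; apply/eqP => n0; apply: yn; rewrite n0; apply: Bx.
  by rewrite expn_gt0.
apply: yn; apply/WU0/LW; first by do 2!apply: subgrpMn => //.
move=> j jL; have L2 : (L < 2 ^ L)%N by exact: ltn_expl.
have pk : (0 < 2 ^ L.+1)%N by rewrite expn_gt0.
rewrite -mulrnA mulnC (divn_eq (j * n.+1) (2 ^ L.+1)) mulrnDr; apply: VU; apply: U0V.
  rewrite (_ : y *+ _ = x *+ 2 ^ (i + L.+1) *+ (j * n.+1 %/ 2 ^ L.+1)).
    apply: orb; rewrite -ltnS ltn_divLR //; rewrite expnS.
    by move: (2 ^ L)%N L2 => a L2; nia.
  by rewrite /y -!mulrnA expnD; congr (_ *+ _); ring.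
by apply: Bx; rewrite ltnW // ltn_mod.
Qed.

(** [C] has no small subgroups, so doubling is an expansive automorphism of [C],
    and this is impossible for a nontrivial [C].  Let [A n] be the set of points
    that stay in [B] for [n] doublings.  Halving contracts it, so the covering
    of [C] by [m] translates of [A n] gives coverings by [m] translates of
    [A (n + k)] for all [k].  Two of the points [0, y, ..., m y] fall in the same
    translate; their difference [l y] stays close to [0] for [k] doublings, with
    [0 < l <= m]; but for [k] large each of these [l y] leaves in time. *)
Lemma minimal_closed_trivial : (forall x, C x -> x != 0 -> C `<=` closure (cyc x)) ->
  C `<=` [set 0].
Proof.
move=> monoC y Cy; apply: contrapT => /eqP y0.
have [U [clU nU UN nUy]] := hausdorff_notin hK y0.
have noU x : C x -> (forall j, U (x *+ j)) -> x = 0.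
  move=> Cx Ux; apply: contrapT => /eqP x0; apply: nUy.
  apply: (closure_mono_sub clU _ (monoC x Cx x0 _ Cy)) => _ [j _ <-].
  by case: (intP j) => [|n|n]; [exact: (Ux 0%N)|exact: Ux|rewrite mulrNz; exact/UN/Ux].
have [B1 nB1 B1C] := doubling_expansive clU nU noU.
have [V [oV V0 VN VB1 VVB]] := nbhs0_sub nB1.
have nV : nbhs (0 : K) V by exact: open_nbhs_nbhs.
have [B [clB nB BV _]] := closed_nbhs0_sub nV.
have BC x : C x -> (forall i, B (x *+ 2 ^ i)) -> x = 0.
  by move=> Cx Bx; apply: B1C => // i; apply/VB1/BV.
pose A n := [set x : K | forall i, (i <= n)%N -> B (x *+ 2 ^ i)].
have nA n : nbhs (0 : K) (A n).
  by apply: filterS (nbhs0_muln (2 ^ n) nB) => x Bx i ni; apply: Bx; rewrite leq_pexp2l.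
have clA n : closed (A n).
  rewrite (_ : A n = \bigcap_(i in [set i | (i <= n)%N]) [set z | B (z *+ 2 ^ i)]).
    apply: closed_bigI => j _; have := @closed_mulrn K (2 ^ j) 0 B clB.
    by congr closed; apply/funext => z /=; rewrite subr0.
  by apply/seteqP; split=> z h j /h.
have [W [oW W0] WB] : exists2 W, open_nbhs (0 : K) W & W `<=` B.
  by move: nB; rewrite nbhsE.
pose D := [set b *+ 2 | b in C `&` ~` W].
have clD : closed D.
  apply: compact_closed => //; apply: compact_mulrn.
  by apply: compact_closedI => //; exact: open_closedC.
have [n nD] : exists n, forall x, C x -> A n x -> ~ D x.
  apply: contrapT => nn.
  have [|||x Cx Fx] := @compact_directed K C nat (fun n => A n `&` D) 0 cC.
  - by move=> n; exact: closedI.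
  - move=> p q; exists (maxn p q) => z [Az Dz]; split; split => // i ip; apply: Az.
      by rewrite leq_max ip.
    by rewrite leq_max ip orbT.
  - move=> p; apply: contrapT => np; apply: nn; exists p => x Cx Ax Dx.
    by apply: np; exists x.
  have x0 : x = 0 by apply: BC => // i; have [+ _] := Fx i; apply.
  have [_ [b [Cb nWb] bx]] := Fx 0%N; apply: nWb.
  by rewrite (tfC Cb (isT : 0 < 2)%N) // bx.
(* By the choice of [n], an element of [A n] is not the double of an element far
   from [0]; so its half is in [B], and hence in [A n.+1]. *)
have half k b : C b -> A n (b *+ 2 ^ k) -> A (n + k)%N b.
  elim: k b => [|k IHk] b Cb; first by rewrite expn0 mulr1n addn0.
  move=> Ab; have Cbk := subgrpMn (2 ^ k) sC Cb.
  have Wb : W (b *+ 2 ^ k).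
    apply: contrapT => nWb; apply: nD Ab _; first exact: subgrpMn.
    by exists (b *+ 2 ^ k) => //; rewrite -mulrnA -expnSr.
  have Ank : A n (b *+ 2 ^ k).
    move=> [_|i ni]; first by rewrite expn0 mulr1n; exact: WB.
    have := Ab i (ltnW ni); rewrite -!mulrnA; congr B; congr (_ *+ _).
    by rewrite !expnS; lia.
  move=> i; rewrite addnS leq_eqVlt => /predU1P[->|]; last by rewrite ltnS => ?; exact: IHk.
  have := Ab n (leqnn n); rewrite -mulrnA; congr B; congr (_ *+ _).
  by rewrite -expnD; congr (2 ^ _)%N; lia.
have [s [sC' sA]] := compact_cover_nbhs0 cC (nA n).
set m := size s in sA *.
have [f fP] : {f : nat -> nat & forall l, (0 < l)%N -> ~ B1 (y *+ l *+ 2 ^ f l)}.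
  apply: (@choice _ _ (fun l i => (0 < l)%N -> ~ B1 (y *+ l *+ 2 ^ i))) => l.
  have [l0|l0] := posnP l; first by exists 0%N.
  apply: contrapT => nl; case/eqP: y0; apply: (tfC Cy l0); apply: B1C; first exact: subgrpMn.
  by move=> i; apply: contrapT => nB1'; apply: nl; exists i.
pose k := (\sum_(l < m.+1) f l)%N.
have lift (c : K) : C c -> exists j : 'I_m, exists2 t, C t & A (n + k)%N (c - t) /\ t *+ 2 ^ k = s`_j.
  move=> Cc; have [a aS Aa] := sA _ (subgrpMn (2 ^ k) sC Cc).
  have k0 : (0 < 2 ^ k)%N by rewrite expn_gt0.
  have [t Ct tk] := dC (sC' _ aS) k0.
  have jm : (index a s < m)%N by rewrite index_mem.
  exists (Ordinal jm), t => //; rewrite nth_index //; split => //.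
  apply: half; first exact: subgrpB.
  by rewrite mulrnBl tk.
have [g gP] : {g : 'I_m.+1 -> 'I_m & forall l : 'I_m.+1,
    exists2 t, C t & A (n + k)%N (y *+ l - t) /\ t *+ 2 ^ k = s`_(g l)}.
  apply: (@choice _ _ (fun (l : 'I_m.+1) (j : 'I_m) =>
    exists2 t, C t & A (n + k)%N (y *+ l - t) /\ t *+ 2 ^ k = s`_j)) => l.
  by apply: lift; exact: subgrpMn.
have [l [l' [ll' gll']]] : exists l l' : 'I_m.+1, (l < l')%N /\ g l = g l'.
  have /injectivePn[l [l' ll' gll']] : ~~ injectiveb g.
    by apply/negP => /injectiveP /leq_card; rewrite !card_ord ltnn.
  have [lt|lt|/val_inj/eqP] := ltngtP (val l) (val l'); [by exists l, l'|by exists l', l|].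
  by rewrite (negPf ll').
have [t Ct [At tk]] := gP l; have [t' Ct' [At' t'k]] := gP l'.
have tt' : t = t'.
  apply/eqP; rewrite -subr_eq0; apply/eqP; apply: (tfC (n := 2 ^ k)); first exact: subgrpB.
    by rewrite expn_gt0.
  by rewrite mulrnBl tk t'k gll' subrr.
have lm : (l' - l < m.+1)%N by have := ltn_ord l'; lia.
have fk : (f (l' - l) <= k)%N.
  by rewrite /k (bigD1 (Ordinal lm)) //= leq_addr.
apply: (fP (l' - l)%N); first by rewrite subn_gt0.
rewrite mulrnBr; last exact: ltnW.
rewrite (_ : _ *+ 2 ^ _ = (y *+ l' - t') *+ 2 ^ f (l' - l)%N - (y *+ l - t) *+ 2 ^ f (l' - l)%N).
  by apply: VVB; apply: BV; [apply: At'|apply: At]; rewrite (leq_trans fk) ?leq_addl.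
by rewrite tt'; zmod.
Qed.

End Expansive.

(** * Locally compact minimal groups *)

Section DenselyMinimal.
Variable K : topologicalZmodType.

(** [K] is a dense subgroup of itself, so it is minimal. *)
Lemma densely_minimal_base (I : Type) (B : I -> set K) (i0 : I) :
    densely_minimal K -> (forall i, nbhs (0 : K) (B i)) ->
    (forall i j, exists k, B k `<=` B i `&` B j) ->
    (forall i, exists j, forall x y, B j x -> B j y -> B i (x - y)) ->
    (forall x, (forall i, B i x) -> x = 0) ->
  forall U, nbhs (0 : K) U -> exists i, B i `<=` U.
Proof.
move=> dK nB BI BS B00 U nU; pose L := subgroup_of_set (@subgrpT K).
have HL x : x \in L by exact/subgroup_of_setP.
have minL : minimal (subgroup L).
  by apply: dK => V [y Vy] oV; exists y; split => //; exact: HL.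
have [|||||i BU] := @minimal_base (subgroup L) I (fun i => @subgroup_val K L @^-1` B i) i0 minL
    _ _ _ _ (@subgroup_val K L @^-1` U).
- by move=> i; apply/subgroup_nbhs0P; exists (B i).
- by move=> i j; have [k kB] := BI i j; exists k => s /kB.
- move=> i; have [j ji] := BS i; exists j => s t /ji /[apply].
  by rewrite -(raddfB (val : subgroup L -> K)).
- by move=> s Bs; apply: val_inj; exact: B00.
- by apply/subgroup_nbhs0P; exists U.
exists i => x Bx.
exact: (BU (Sub x (HL x) : subgroup L)).
Qed.

Hypotheses (hK : hausdorff_space K) (dK : densely_minimal K).

(** If [x] did not return to [W], the sets [U + <m x>], for [U] a neighbourhood
    of [0] and [m > 0], would be a base of a Hausdorff group topology, in which the
    multiples [m! x] tend to [0]; it is coarser than that of [K], so it is equal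
    to it, and [x] does return to [W]. *)
Lemma densely_minimal_cyc_recurrent (x : K) W : nbhs (0 : K) W ->
  exists2 n, (0 < n)%N & W (x *+ n).
Proof.
move=> nW; have [V [oV V0 VN VW VVW]] := nbhs0_sub nW.
have nV : nbhs (0 : K) V by exact: open_nbhs_nbhs.
apply: contrapT => nx.
have Wx (j : int) : W (x *~ j) -> W (x *~ - j) -> j = 0.
  case: (intP j) => // n; rewrite ?opprK => h1 h2; exfalso; apply: nx; exists n.+1 => //.
pose I := ({U : set K | nbhs (0 : K) U} * nat)%type.
pose B (i : I) := sumset (sval i.1) (cyc (x *+ i.2.+1)).
have [|||||[[U nU] m] BW] := @densely_minimal_base I B (exist _ setT filterT, 0%N) dK _ _ _ _ V.
- move=> [[U nU] m]; apply: (filterS _ nU); apply: sumset_subl.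
  exact: (subgrp0 (subgrp_cyc _)).
- move=> [[U nU] m] [[U' nU'] m'].
  exists (exist _ (U `&` U') (filterI nU nU'), (m.+1 * m'.+1).-1).
  move=> z [u [Uu U'u] [j _ zj]]; split; exists u => //.
    by exists (m'.+1%:Z * j) => //; rewrite -zj prednK //; zmod.
  by exists (m.+1%:Z * j) => //; rewrite -zj prednK //; zmod.
- move=> [[U nU] m]; have [U' [oU' U'0 _ _ U'U]] := nbhs0_sub nU.
  have nU' : nbhs (0 : K) U' by exact: open_nbhs_nbhs.
  exists (exist _ U' nU', m) => a b [u U'u [i _ ai]] [u' U'u' [j _ bj]].
  exists (u - u'); first exact: U'U.
  by exists (i - j) => //; rewrite mulrzBr ai bj; zmod.
- move=> z Bz; apply: contrapT => /eqP z0.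
  have [v Vv [k _ zk]] := Bz (exist _ V nV, 0%N).
  have [U [_ nU _ nUz]] := hausdorff_notin hK z0.
  have [v' [Vv' Uv'] [j _ zj]] := Bz (exist _ (V `&` U) (filterI nV nU), `|k|%N).
  have kj : (`|k|.+1%:Z * j - k) = 0.
    apply: Wx.
      rewrite (_ : x *~ _ = v - v'); first exact: VVW.
      have -> : v = z - x *~ k by rewrite -[z](subrK v) -zk /=; zmod.
      by have -> : v' = z - x *+ `|k|.+1 *~ j; [rewrite zj subKr|zmod].
    rewrite (_ : x *~ _ = v' - v); first exact: VVW.
    have -> : v = z - x *~ k by rewrite -[z](subrK v) -zk /=; zmod.
    by have -> : v' = z - x *+ `|k|.+1 *~ j; [rewrite zj subKr|zmod].
  have j0 : j = 0.
    have kk : k = `|k|.+1%:Z * j by apply/esym/eqP; rewrite -subr_eq0 kj.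
    apply: contrapT => /eqP j0; have := congr1 absz kk; rewrite abszM /=.
    have : (0 < `|j|)%N by rewrite absz_gt0.
    by nia.
  by apply: nUz; move: zj Uv'; rewrite j0 mulr0z => /esym/eqP; rewrite subr_eq0 => /eqP <-.
- by [].
apply: nx; exists m.+1 => //; apply/VW/BW.
by apply: sumset_subr; [exact: nbhs_singleton|exact: cyc_id].
Qed.

End DenselyMinimal.

Section LocallyCompact.
Variable K : topologicalZmodType.
Hypotheses (hK : hausdorff_space K) (lcK : locally_compact [set: K]).
Implicit Types (A B C O P Q U V W : set K) (x y z : K).

Lemma compact_nbhs0 U : nbhs (0 : K) U ->
  exists V, [/\ compact V, closed V, nbhs (0 : K) V, (forall x, V x -> V (- x)) & V `<=` U].
Proof.
have [A nA' [cA clA]] := lcK (I : [set: K] 0).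
have nA : nbhs (0 : K) A by apply: (@filterS _ (nbhs (0 : K)) _ [set z | [set: K] z -> A z] _ _ nA') => z; exact.
move=> nU; have [V [clV nV VAU VN]] := closed_nbhs0_sub (filterI nA nU).
exists V; split => //; last by move=> x /VAU[].
by apply: (subclosed_compact clV cA) => x /VAU[].
Qed.

Lemma open_subgrp P : subgrp P -> nbhs (0 : K) P -> open P.
Proof.
move=> sP nP; rewrite openE => x Px; apply/nbhs0P; apply: filterS nP => z Pz.
exact: subgrpD.
Qed.

Lemma open_subgrp_closed P : subgrp P -> open P -> closed P.
Proof.
move=> sP oP; apply: (@open_in_closed _ setT P) => //.
by exists P; [apply: open_nbhs_nbhs; split => //; exact: subgrp0|move=> x []].
Qed.

Lemma compact_seq (s : seq K) : compact [set x | x \in s].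
Proof. by apply: finite_compact; exact: finite_seq. Qed.

(** A cyclic subgroup that is recurrent has compact closure: its returns to a
    compact neighbourhood of [0] occur with bounded gaps. *)
Lemma recurrent_cyc_compact x :
    (forall W, nbhs (0 : K) W -> exists2 n, (0 < n)%N & W (x *+ n)) -> compact (closure (cyc x)).
Proof.
move=> recx; have [V [cV clV nV VN _]] := compact_nbhs0 (@filterT _ (nbhs (0 : K)) _).
have large W N : nbhs (0 : K) W -> exists2 n, (N <= n)%N & W (x *+ n).
  move=> nW; have [n n0 Wn] := recx _ (nbhs0_muln N nW).
  by exists (n * N)%N; [rewrite leq_pmull|rewrite mulrnA; exact: Wn].
have [W [oW W0] WV] : exists2 W, open_nbhs (0 : K) W & W `<=` V.
  by move: nV; rewrite nbhsE.
pose Y := closure (cyc x) `&` V.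
have cY : compact Y.
  by apply: (subclosed_compact _ cV) => [|z []//]; apply: closedI => //; exact: closed_closure.
have [M YM] : exists M, forall y, Y y -> exists n, [/\ (0 < n)%N, (n <= M)%N & V (y - x *+ n)].
  apply: contrapT => nM.
  pose F M := [set y | forall n, (0 < n)%N -> (n <= M)%N -> ~ W (y - x *+ n)].
  have [|||y [/closure_nbhs0 cy Vy] Fy] := @compact_directed K Y nat F 0 cY.
  - move=> M; rewrite (_ : F M =
      \bigcap_(n in [set n | (0 < n)%N /\ (n <= M)%N]) ~` [set y | W (y - x *+ n)]).
      by apply: closed_bigI => n _; apply: open_closedC; exact: open_translate.
    by apply/seteqP; split=> z h n; [move=> []|move=> n0 nM'] => *; apply: h.
  - move=> M N; exists (maxn M N) => z Fz; split=> n n0 nM'; apply: Fz => //.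
      by rewrite leq_max nM'.
    by rewrite leq_max nM' orbT.
  - move=> M; apply: contrapT => nz; apply: nM; exists M => y Yy; apply: contrapT => ny.
    apply: nz; exists y; split => // n n0 nM' Wn; apply: ny; exists n; split => //.
    exact: WV.
  have nW : nbhs (0 : K) W by exact: open_nbhs_nbhs.
  have [U [oU U0 UN UW UUW]] := nbhs0_sub nW.
  have nU : nbhs (0 : K) U by exact: open_nbhs_nbhs.
  have [_ [j _ <-] Uj] := cy _ nU; have [N jN UN'] := large U `|j|.+1 nU.
  have [n nE n0] : exists2 n : nat, n%:Z = j + N%:Z & (0 < n)%N.
    by exists `|(j + N%:Z)%R|%N; lia.
  apply: (Fy n n n0 (leqnn n)).
  rewrite (_ : _ - _ = - (x *~ j - y) - x *+ N); first by apply: UUW => //; exact: UN.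
  by rewrite -[x *+ n]/(x *~ n%:Z) nE; zmod.
pose S := [seq - (x *+ i) | i <- iota 0 M.+1].
have xS : cyc x `<=` sumset [set z | z \in S] V.
  move=> _ [m _ <-].
  have [n mn Vn] := large V `|m|%N nV.
  suff [i iM Vi] : exists2 i, (i <= M)%N & V (x *~ (m + i%:Z)).
    exists (- (x *+ i)); first by apply/mapP; exists i; rewrite ?mem_iota.
    by rewrite opprK -[x *+ i]/(x *~ i%:Z) -mulrzDr.
  have [d nE] : exists d : nat, n%:Z = m + d%:Z by exists `|(n%:Z - m)%R|%N; lia.
  rewrite -[x *+ n]/(x *~ n%:Z) nE in Vn.
  elim/ltn_ind: d Vn {n mn nE} => d IHd Vd.
  have [dM|Md] := leqP d M; first by exists d.
  have [|k [k0 kM Vk]] := YM (x *~ (m + d%:Z)).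
    by split => //; apply: subset_closure; exists (m + d%:Z).
  apply: (IHd (d - k)%N); first by rewrite ltn_subrL k0 (leq_trans k0) // ltnW // (leq_ltn_trans kM).
  rewrite -[x *+ k]/(x *~ k%:Z) -mulrzBr in Vk.
  by congr V: Vk; congr (_ *~ _); lia.
have cS : compact (sumset [set z | z \in S] V) by apply: compact_sumset => //; exact: compact_seq.
apply: (subclosed_compact _ cS); first exact: closed_closure.
by apply: closure_mono_sub => //; exact: compact_closed.
Qed.

(** The intersection of all open subgroups; in a locally compact group this is
    the connected component of [0]. *)
Definition component := [set x : K | forall O, subgrp O -> open O -> O x].

Lemma subgrp_component : subgrp component.
Proof.
split=> [O [] //|x y Cx Cy O sO oO].
by apply: subgrpB => //; [exact: Cx|exact: Cy].
Qed.

Lemma closed_component : closed component.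
Proof.
apply: closed_nbhs0 => x clx O sO oO; have [|a Ca Oax] := clx O.
  by apply: open_nbhs_nbhs; split => //; exact: subgrp0.
by rewrite -(subKr a x); apply: subgrpB => //; exact: Ca.
Qed.

(** By compactness, some open subgroup [O] satisfies [O `&` V] in [P + W], with
    [W] so small that [O `&` (P + V)] is stable under translation by the elements
    of [O `&` W].  The stabilizer of that set is the open subgroup [Q]. *)
Lemma component_sep P V : subgrp P -> P `<=` component -> compact V -> closed V -> nbhs (0 : K) V ->
    component `&` V `<=` P ->
  exists Q, [/\ subgrp Q, open Q & Q `<=` sumset P V].
Proof.
move=> sP PC cV clV nV CVP.
have [W [oW W0 WN WV WWV]] := nbhs0_add nV.
have oPW : open (sumset P W).
  rewrite (_ : sumset P W = \bigcup_(p in P) [set z | W (z - p)]).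
    by apply: bigcup_open => p _; exact: open_translate.
  by apply/seteqP; split=> z [p Pp Wp]; exists p.
pose I := {O : set K | subgrp O /\ open O}.
have iT : I by exists setT; split => //; exact: openT.
have [O [sO oO] OVPW] : exists2 O : set K, subgrp O /\ open O & O `&` V `<=` sumset P W.
  apply: contrapT => nO.
  have [|||x Vx Fx] := @compact_directed K V I (fun O : I => sval O `&` ~` sumset P W) iT cV.
  - move=> [O [sO oO]] /=; apply: closedI; first exact: open_subgrp_closed.
    exact: open_closedC.
  - move=> [O [sO oO]] [O' [sO' oO']].
    exists (exist _ (O `&` O') (conj (subgrpI sO sO') (openI oO oO'))) => z [/= [Oz O'z] nz].
    by split; split.
  - move=> [O [sO oO]]; apply: contrapT => nz; apply: nO; exists O => // z [Oz Vz].
    by apply: contrapT => nPW; apply: nz; exists z.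
  have [_] := Fx iT; apply; apply: sumset_subl => //; apply: CVP; split => // O sO oO.
  by have [] := Fx (exist _ O (conj sO oO)).
pose A := O `&` sumset P V.
have PO : P `<=` O by move=> p /PC; exact.
have AW w a : O w -> W w -> A a -> A (w + a).
  move=> Ow Ww [Oa [p Pp Vap]]; split; first exact: subgrpD.
  have [|p' Pp' Wap] := OVPW (a - p).
    by split => //; apply: subgrpB => //; exact: PO.
  exists (p + p'); first exact: subgrpD.
  by rewrite (_ : _ - _ = w + (a - p - p')); [exact: WWV|zmod].
pose Q := [set q | O q /\ forall a, A a -> A (q + a) /\ A (- q + a)].
have sQ : subgrp Q.
  split; first by split=> [|a Aa]; [exact: subgrp0|rewrite oppr0 !add0r].
  move=> q q' [Oq Aq] [Oq' Aq']; split=> [|a Aa]; first exact: subgrpB.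
  rewrite -addrA opprB -addrA; split; first by apply: (Aq _ _).1; exact: (Aq' _ _).2.
  by apply: (Aq' _ _).1; exact: (Aq _ _).2.
exists Q; split => //.
  apply: open_subgrp => //.
  have nOW : nbhs (0 : K) (O `&` W).
    by apply: open_nbhs_nbhs; split; [exact: openI|split => //; exact: subgrp0].
  apply: filterS nOW => w [Ow Ww]; split => // a Aa; split; first exact: AW.
  by apply: AW => //; [exact: (subgrpN sO)|exact: WN].
move=> q [_ /(_ 0)]; rewrite addr0 => -[|[_ //] _]; split; first exact: subgrp0.
by exists 0; [exact: subgrp0|rewrite subrr; exact: nbhs_singleton].
Qed.

Lemma component_no_open : no_open_subgroup component.
Proof.
move=> P sP PC [U nU CUP]; have [V [cV clV nV VN VU]] := compact_nbhs0 nU.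
have CVP : component `&` V `<=` P by move=> x [Cx /VU Ux]; apply: CUP.
have [Q [sQ oQ QPV]] := component_sep sP PC cV clV nV CVP.
move=> x Cx; have [p Pp Vxp] := QPV _ (Cx Q sQ oQ).
apply: (subgrp_subK sP Pp); apply: CVP; split => //.
by apply: (subgrpB subgrp_component) => //; exact: PC.
Qed.

(** The sum of [component `&` V] and of finitely many compact subgroups [closure
    (cyc c)] is a compact open subgroup of the component, hence all of it. *)
Lemma compact_component : (forall x, compact (closure (cyc x))) -> compact component.
Proof.
move=> cmono; have sC := subgrp_component.
have [V [cV clV nV VN _]] := compact_nbhs0 (@filterT _ (nbhs (0 : K)) _).
pose VC := component `&` V.
have cVC : compact VC.
  by apply: (subclosed_compact _ cV) => [|x []//]; apply: closedI => //; exact: closed_component.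
have [s [sVC sV]] := compact_cover_nbhs0 (compact_sumset cVC cVC) nV.
have [G [sG cG GC Gs]] : exists G : set K, [/\ subgrp G, compact G, G `<=` component &
    forall c, c \in s -> G c].
  have {}sVC c : c \in s -> component c.
    by move=> /sVC[a [Ca _] [Cca _]]; exact: subgrp_subK Cca.
  elim: s sVC {sV} => [|c s IHs] sC'.
    exists [set 0]; split => //; [exact: subgrp_set0|exact: compact_set1|].
    by move=> _ ->; exact: subgrp0.
  have [|G [sG cG GC Gs]] := IHs; first by move=> d ds; apply: sC'; rewrite inE ds orbT.
  have sc : subgrp (closure (cyc c)) by apply: subgrp_closure; exact: subgrp_cyc.
  exists (sumset G (closure (cyc c))); split.
  - exact: subgrp_sumset.
  - exact: compact_sumset.
  - apply: sumset_sub => //; apply: closure_mono_sub; first exact: closed_component.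
    by apply: cyc_sub => //; apply: sC'; rewrite mem_head.
  - move=> d; rewrite inE => /predU1P[->|/Gs].
      by apply: sumset_subr; [exact: subgrp0|apply: subset_closure; exact: cyc_id].
    by apply: sumset_subl; exact: subgrp0.
pose P := sumset G VC.
have VC0 : VC 0 by split; [exact: subgrp0|exact: nbhs_singleton].
have PC : P `<=` component by apply: sumset_sub => // x [].
have sP : subgrp P.
  split; first by apply: sumset_subl => //; exact: subgrp0.
  move=> z z' [g Gg [Czg Vzg]] [g' Gg' [Cz'g' Vz'g']].
  have [c cs Vc] : exists2 c, c \in s & V ((z - g) - (z' - g') - c).
    apply: sV; exists (z - g); first by split.
    rewrite (_ : _ - _ - _ = - (z' - g')); last by zmod.
    by split; [exact: (subgrpN sC Cz'g')|exact: VN].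
  exists (g - g' + c); first by apply: (subgrpD sG); [exact: (subgrpB sG)|exact: Gs].
  rewrite (_ : _ - _ - _ = (z - g) - (z' - g') - c); last by zmod.
  split => //; apply: (subgrpB sC); first exact: (subgrpB sC).
  by apply: GC; exact: Gs.
have cP : compact P by exact: compact_sumset.
apply: (subclosed_compact closed_component cP); apply: component_no_open => //.
by exists V => // x [Cx Vx]; apply: sumset_subr; [exact: subgrp0|split].
Qed.

(** The component is compact, divisible and torsion-free, and all its nonzero
    elements generate dense subgroups of it. *)
Lemma component_trivial : essential_dense K -> (forall x, compact (closure (cyc x))) ->
  component `<=` [set 0].
Proof.
move=> essK cmono; have cC := compact_component cmono; have sC := subgrp_component.
have dC : divisible component by apply: no_open_divisible => //; exact: component_no_open.
apply: minimal_closed_trivial => //.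
  by move=> x n; exact: essential_torsion_free.
by move=> x; exact: essential_monothetic.
Qed.

Lemma open_compact_subgroup U : component `<=` [set 0] -> nbhs (0 : K) U ->
  exists Q, [/\ subgrp Q, open Q, compact Q & Q `<=` U].
Proof.
move=> C0 nU; have [V [cV clV nV VN VU]] := compact_nbhs0 nU.
have [||Q [sQ oQ QV]] := component_sep (@subgrp_set0 K) _ cV clV nV.
- by move=> _ ->; exact: (subgrp0 subgrp_component).
- by move=> x [/C0].
have {}QV : Q `<=` V by move=> q /QV[_ -> ]; rewrite subr0.
exists Q; split => //; last exact: subset_trans VU.
by apply: (subclosed_compact _ cV) => //; exact: open_subgrp_closed.
Qed.

End LocallyCompact.

(** * Totally disconnected minimal groups are compact *)

Section Characters.
Variable K : topologicalZmodType.
Implicit Types (O Q U V : set K) (x y : K).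

(** A homomorphism to [Q / Z] with open kernel, given by representatives. *)
Definition character (g : K -> rat) :=
  (forall x y, g (x - y) - (g x - g y) \is a Num.int) /\
  nbhs (0 : K) [set x | g x \is a Num.int].

Lemma character0 : character (fun _ => 0).
Proof.
split=> [x y|]; first by rewrite !subr0 rpred0.
by apply: filterE => x /=; rewrite rpred0.
Qed.

(** Characters of the discrete group [K / Q] separate points: send [x] to
    [1 / n], where [n] is the order of [x], or [2] if that order is infinite, and
    extend by divisibility of [Q / Z].  The extension is obtained as a complement
    [H] in [K * rat], which is the graph of a homomorphism modulo [Z]. *)
Lemma character_separates Q x : subgrp Q -> nbhs (0 : K) Q -> ~ Q x ->
  exists2 g, character g & g x \isn't a Num.int.
Proof.
move=> sQ nQ nQx.
have [n n1 nP] : exists2 n, (1 < n)%N & forall j : int, Q (x *~ j) -> (n %| `|j|)%N.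
  have [ex|nex] := pselect (exists2 n, (0 < n)%N & Q (x *+ n)); last first.
    exists 2%N => // j Qj; have [->//|j0] := eqVneq j 0.
    case: nex; exists `|j|%N; first by rewrite absz_gt0.
    exact: subgrp_absz.
  have [n [n0 Qn nP]] := subgrp_mult_min sQ ex; exists n => //.
  by case: n n0 Qn nP => [|[|n]].
pose G := (K * rat)%type.
pose R := [set z : G | exists u (j k : int), [/\ Q u, z.1 = u + x *~ j &
  z.2 = j%:~R / n%:R + k%:~R]].
pose C := [set z : G | exists u (j : int), Q u /\ z.1 = u + x *~ j].
have sR : subgrp R.
  split; first by exists 0, 0, 0; split; rewrite ?mul0r ?mulr0z ?addr0//; exact: subgrp0.
  move=> [a a'] [b b'] [u [j [k [Qu /= -> ->]]]] [v [l [m [Qv /= -> ->]]]].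
  exists (u - v), (j - l), (k - m); split => /=; [exact: subgrpB|by zmod|].
  by rewrite !rmorphB mulrBl /=; ring.
have sC : subgrp C.
  split; first by exists 0, 0; split; rewrite ?mulr0z ?addr0//; exact: subgrp0.
  move=> [a a'] [b b'] [u [j [Qu /= ->]]] [v [l [Qv /= ->]]].
  by exists (u - v), (j - l); split => /=; [exact: subgrpB|zmod].
have RC : R `<=` C by move=> z [u [j [k [Qu z1 _]]]]; exists u, j.
have [|H [sH RH _ HC HT]] := @divisible_complement G setT C R (@subgrpT G) sC sR RC (fun _ _ => I).
  move=> [a q] m [u [j [Qu /= ->]]] m0; exists (0, (q - j%:~R / n%:R) / m%:R).
    by exists 0, 0; split; rewrite ?mulr0z ?addr0//; exact: subgrp0.
  exists u, j, 0; split => //=; first by rewrite raddfMn /= mul0rn subr0.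
  rewrite raddfMn /= -[_ *+ m]mulr_natr divfK ?addr0 ?subKr //.
  by rewrite pnatr_eq0 -lt0n.
have Hint q : H (0, q) -> q \is a Num.int.
  move=> Hq; have [|u [j [k [Qu /= u0 ->]]]] := HC (0, q).
    split => //; exists 0, 0; split; rewrite ?mulr0z ?addr0//; exact: subgrp0.
  have /nP/dvdnP[i ji] : Q (x *~ j).
    by rewrite (_ : x *~ j = - u); [exact: subgrpN|apply/eqP; rewrite -addr_eq0 addrC -u0].
  rewrite rpredD ?intr_int //; suff -> : j%:~R / n%:R = (sgz j * i%:Z)%:~R :> rat by rewrite intr_int.
  rewrite {1}(intEsg j) ji PoszM mulrA intrM -pmulrn mulfK // pnatr_eq0 -lt0n.
  exact: ltnW.
have ex_g k : exists q, H (k, q).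
  have [[h1 h2] Hh [u [j [Qu /= kh]]]] := HT (k, 0) I.
  exists (h2 + j%:~R / n%:R).
  rewrite (_ : (k, _) = (h1, h2) + (u + x *~ j, j%:~R / n%:R)); last first.
    by congr (_, _); rewrite /= -kh subrKC.
  by apply: subgrpD => //; apply: RH; exists u, j, 0; rewrite addr0.
have [g gP] := choice ex_g.
have gB k k' : g (k - k') - (g k - g k') \is a Num.int.
  apply: Hint; rewrite (_ : (0, _) = (k - k', g (k - k')) - ((k, g k) - (k', g k'))).
    by apply: subgrpB => //; exact: subgrpB.
  by congr (_, _); rewrite /= subrr.
have gR k q : R (k, q) -> g k - q \is a Num.int.
  move=> /RH Hkq; apply: Hint; rewrite (_ : (0, _) = (k, g k) - (k, q)); first exact: subgrpB.
  by congr (_, _); rewrite /= subrr.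
exists g.
  split => //; apply: filterS nQ => u Qu /=; rewrite -[g u]subr0; apply: gR.
  by exists u, 0, 0; rewrite mulr0z mul0r !addr0.
apply/negP => gx; have : g x - n%:R^-1 \is a Num.int.
  by apply: gR; exists 0, 1, 0; rewrite add0r mul1r addr0; split => //; exact: subgrp0.
rewrite rpredBl // => /intrP[k nk].
have : (1%:Z = k * n%:Z).
  apply: (@intr_inj rat); rewrite intrM -nk -pmulrn mulVf // pnatr_eq0 -lt0n; exact: ltnW.
move=> /(congr1 absz); rewrite abszM /= => /esym/eqP; rewrite muln_eq1 => /andP[_ /eqP n1'].
by rewrite n1' in n1.
Qed.

Lemma ratint_close (q : rat) : (forall N, exists k : int, `|q - k%:~R| < N.+1%:R^-1) ->
  q \is a Num.int.
Proof.
move=> /(_ `|denq q|%N)[k]; set b := denq q => qk.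
have b0 : 0 < b by exact: denq_gt0.
have br : 0 < b%:~R :> rat by rewrite ltr0z.
have bE : `|b|%N%:R = b%:~R :> rat by rewrite pmulrn gez0_abs // ltW.
have : `|(numq q - k * b)%:~R| < 1 :> rat.
  rewrite (_ : _%:~R = (q - k%:~R) * b%:~R); last first.
    by rewrite mulrBl intrB intrM -{2}(divq_num_den q) divfK // gt_eqF.
  rewrite normrM (gtr0_norm br); apply: lt_trans (_ : `|b|.+1%:R^-1 * b%:~R < 1).
    by rewrite ltr_pM2r.
  rewrite mulrC ltr_pdivrMr ?ltr0n // mul1r -bE ltr_nat; lia.
rewrite -intr_norm -[1]/(1%:~R) ltr_int => h.
have nk : numq q = k * b by lia.
by rewrite -(divq_num_den q) nk intrM mulfK ?gt_eqF // intr_int.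
Qed.

(** The topology generated by the characters is coarser and totally bounded;
    so by minimality [K] is covered by finitely many translates of [Q]. *)
Lemma densely_minimal_compact : hausdorff_space K -> densely_minimal K ->
    (forall U, nbhs (0 : K) U -> exists Q, [/\ subgrp Q, open Q, compact Q & Q `<=` U]) ->
  compact [set: K].
Proof.
move=> hK dK base.
pose I := ((nat -> {g : K -> rat | character g}) * nat * nat)%type.
pose B (i : I) := [set x : K | forall l, (l < i.1.2)%N ->
  exists k : int, `|sval (i.1.1 l) x - k%:~R| < i.2.+1%:R^-1 :> rat].
pose c0 : {g : K -> rat | character g} := exist _ _ character0.
have [Q [sQ oQ cQ _]] := base setT (@filterT _ (nbhs (0 : K)) _).
have nQ : nbhs (0 : K) Q by apply: open_nbhs_nbhs; split => //; exact: subgrp0.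
have B0 i : nbhs (0 : K) (B i).
  case: i => [[f n] N]; rewrite /B /=; elim: n => [|n IHn]; first by apply: filterE.
  have [_ fn] := svalP (f n).
  apply: filterS (filterI IHn fn) => x [/= Bx /intrP[k xk]] l.
  rewrite ltnS leq_eqVlt => /predU1P[->|]; last exact: Bx.
  by exists k; rewrite xk subrr normr0 invr_gt0 ltr0n.
have mono N N' : (N <= N')%N -> N'.+1%:R^-1 <= N.+1%:R^-1 :> rat.
  by move=> NN'; rewrite lef_pV2 ?posrE ?ltr0n // ler_nat.
have [|||[[f n] N] BQ] := @densely_minimal_base K I B (fun _ => c0, 0%N, 0%N) dK B0 _ _ _ Q nQ.
- move=> [[f n] N] [[f' n'] N'].
  exists (fun l => if (l < n)%N then f l else f' (l - n)%N, (n + n')%N, maxn N N').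
  move=> x Bx; split=> l /= ln.
    have [|k xk] := Bx l; first by rewrite /= (leq_trans ln) // leq_addr.
    by exists k; move: xk; rewrite /= ln => /lt_le_trans; apply; rewrite mono // leq_maxl.
  have [|k xk] := Bx (n + l)%N; first by rewrite /= ltn_add2l.
  exists k; move: xk; rewrite /= ltnNge leq_addr /= addKn => /lt_le_trans; apply.
  by rewrite mono // leq_maxr.
- move=> [[f n] N]; exists (f, n, (2 * N).+1) => x y Bx By l /= ln.
  have [/= k xk] := Bx l ln; have [/= k' yk] := By l ln.
  have [/(_ x y)/intrP[m mE] _] := svalP (f l); exists (m + k - k').
  rewrite (_ : _ - _ = (sval (f l) x - k%:~R) - (sval (f l) y - k'%:~R)); last first.
    by rewrite -[sval (f l) (x - y)](subrK (sval (f l) x - sval (f l) y)) mE intrB intrD; ring.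
  apply: le_lt_trans (ler_normB _ _) _.
  rewrite (_ : N.+1%:R^-1 = (2 * N).+2%:R^-1 + (2 * N).+2%:R^-1 :> rat); first exact: ltrD.
  rewrite (_ : (2 * N).+2 = 2 * N.+1)%N; last by lia.
  by rewrite natrM invfM -mulrDl; rewrite (_ : _ + _ = 1) ?mul1r //; field.
- move=> x Bx; apply: contrapT => /eqP x0.
  have [U [_ nU _ nUx]] := hausdorff_notin hK x0.
  have [P [sP oP _ PU]] := base U nU.
  have [||g cg gx] := @character_separates P x sP.
  + by apply: open_nbhs_nbhs; split => //; exact: subgrp0.
  + by move=> /PU.
  case/negP: gx; apply: ratint_close => N.
  by have [k] := Bx (fun _ => exist _ g cg, 1%N, N) 0%N isT; exists k.
(* Two points are in the same cell when the values of the [n] characters lie in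
   the same of the [N.+1] arcs of equal length of [Q / Z]. *)
pose cell x : {ffun 'I_n -> 'I_N.+1} :=
  [ffun i => inord `|(Num.floor (sval (f (val i)) x * N.+1%:R) %% N.+1)%Z|%N].
have cellP x y : cell x = cell y -> Q (x - y).
  move=> xy; apply: BQ => l /= ln.
  have [/(_ x y)/intrP[m mE] _] := svalP (f l).
  move/ffunP: xy => /(_ (Ordinal ln)); rewrite !ffunE /= => /(congr1 val).
  set a := sval (f l) x in mE *; set b := sval (f l) y in mE *.
  have pN : (0 < N.+1%:Z) by [].
  have fl (z : int) : (`|(z %% N.+1)%Z| < N.+1)%N.
    by rewrite -ltz_nat gez0_abs ?modz_ge0 // ltz_pmod.
  rewrite /= !inordK // => /(congr1 Posz); rewrite !gez0_abs ?modz_ge0 // => ab.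
  have [k kE] : exists k, Num.floor (a * N.+1%:R) - Num.floor (b * N.+1%:R) = k * N.+1%:Z.
    exists ((Num.floor (a * N.+1%:R) %/ N.+1)%Z - (Num.floor (b * N.+1%:R) %/ N.+1)%Z).
    rewrite {1}(divz_eq (Num.floor (a * N.+1%:R)) N.+1).
    by rewrite {1}(divz_eq (Num.floor (b * N.+1%:R)) N.+1) ab; ring.
  exists (m + k); have Nr : 0 < N.+1%:R :> rat by rewrite ltr0n.
  rewrite -(ltr_pM2r Nr) mulVf ?gt_eqF // -{1}(gtr0_norm Nr) -normrM.
  have -> : (sval (f l) (x - y) - (m + k)%:~R) * N.+1%:R =
      (a * N.+1%:R - (Num.floor (a * N.+1%:R))%:~R) - (b * N.+1%:R - (Num.floor (b * N.+1%:R))%:~R).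
    have -> : sval (f l) (x - y) = m%:~R + (a - b) by rewrite -mE subrK.
    have : (k * N.+1%:Z)%:~R = (Num.floor (a * N.+1%:R))%:~R - (Num.floor (b * N.+1%:R))%:~R :> rat.
      by rewrite -kE intrB.
    rewrite intrM -pmulrn intrD => h.
    rewrite (_ : (m%:~R + (a - b) - (m%:~R + k%:~R)) * N.+1%:R = (a - b) * N.+1%:R - k%:~R * N.+1%:R); last by ring.
    by rewrite h; ring.
  have := floor_itv (a * N.+1%:R); have := floor_itv (b * N.+1%:R).
  rewrite !intrD => /andP[b1 b2] /andP[a1 a2].
  by rewrite ltr_norml; apply/andP; split; lra.
have [r rP] : {r : {ffun 'I_n -> 'I_N.+1} -> K & forall c x, cell x = c -> cell (r c) = c}.
  apply: (@choice _ _ (fun c r => forall x, cell x = c -> cell r = c)) => c.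
  have [[x xc]|nx] := pselect (exists x, cell x = c); first by exists x.
  by exists 0 => x xc; case: nx; exists x.
have cS : compact (sumset [set r c | c in [set: {ffun 'I_n -> 'I_N.+1}]] Q).
  apply: compact_sumset => //; apply: finite_compact; apply: finite_image.
  exact: finite_finset.
apply: (subclosed_compact _ cS); first exact: closedT.
move=> x _; exists (r (cell x)); first by exists (cell x).
by apply: cellP; rewrite (rP _ x).
Qed.

End Characters.

(** * Dense subgroups of compact groups *)

Section LinearCombinations.
Variable G : zmodType.
Implicit Types (f : nat -> G) (d : seq int).

Definition lincomb f n d := \sum_(i < n) f i *~ d`_i.

Definition span f n := range (lincomb f n).

Lemma lincomb_mkseq f n (c : nat -> int) : lincomb f n (mkseq c n) = \sum_(i < n) f i *~ c i.
Proof. by apply: eq_bigr => i _; rewrite nth_mkseq. Qed.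

Lemma span_sum f n (c : nat -> int) : span f n (\sum_(i < n) f i *~ c i).
Proof. by rewrite -lincomb_mkseq; exists (mkseq c n). Qed.

Lemma subgrp_span f n : subgrp (span f n).
Proof.
split; first by exists [::] => //; rewrite /lincomb big1 // => i _; rewrite nth_nil mulr0z.
move=> _ _ [d _ <-] [e _ <-]; rewrite /lincomb -sumrB.
under eq_bigr do rewrite -mulrzBr.
exact: (span_sum f n (fun i => d`_i - e`_i)).
Qed.

Lemma span_mem f n i : (i < n)%N -> span f n (f i).
Proof.
move=> ni; have := span_sum f n (fun k => (k == i)%:R); congr (span f n).
rewrite (bigD1 (Ordinal ni)) //= eqxx mulr1z big1 ?addr0 // => k ki.
by rewrite (_ : (val k == i) = false) ?mulr0z //; apply/negbTE.
Qed.

Lemma spanS f n N : (n <= N)%N -> span f n `<=` span f N.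
Proof.
move=> nN _ [d _ <-]; apply: subgrp_sum; first exact: subgrp_span.
move=> i _; apply: subgrpMz; first exact: subgrp_span.
by apply: span_mem; exact: leq_trans nN.
Qed.

Definition span_all f := \bigcup_n span f n.

Lemma subgrp_span_all f : subgrp (span_all f).
Proof.
split; first by exists 0%N => //; exact: (subgrp0 (subgrp_span f 0)).
move=> x y [n _ nx] [m _ my]; exists (maxn n m) => //.
by apply: subgrpB; [exact: subgrp_span|apply: spanS nx|apply: spanS my];
  rewrite ?leq_maxl ?leq_maxr.
Qed.

Lemma span_all_sub f A : subgrp A -> (forall i, A (f i)) -> span_all f `<=` A.
Proof.
by move=> sA Af _ [n _ [d _ <-]]; apply: subgrp_sum => // i _; exact: subgrpMz.
Qed.

Lemma span_all_mem f i : span_all f (f i).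
Proof. by exists i.+1 => //; exact: span_mem. Qed.

End LinearCombinations.

Section Unbounded.
Variable K : topologicalZmodType.
Hypothesis hK : hausdorff_space K.
Implicit Types (A B H P U V W : set K).

(** If no choice of [f n.+1] were possible, every element of [A] would have a
    multiple in the countable group [span f n.+1], and by Baire's theorem [A]
    would have finite exponent. *)
Lemma compact_independent A (x : K) : compact A -> subgrp A ->
    (forall n, (0 < n)%N -> exists2 a, A a & a *+ n != 0) -> A x ->
  exists f : nat -> K, [/\ f 0 = x, (forall n, A (f n)) &
    forall n m, (0 < m)%N -> ~ span f n.+1 (f n.+1 *+ m)].
Proof.
move=> cA sA uA Ax.
have [nxt nxtP] : {nxt : seq K -> K & forall s, A (nxt s) /\
    forall m, (0 < m)%N -> ~ span (nth 0 s) (size s) (nxt s *+ m)}.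
  apply: (@choice _ _ (fun s y => A y /\
    forall m, (0 < m)%N -> ~ span (nth 0 s) (size s) (y *+ m))) => s.
  apply: contrapT => ns.
  have [|n n0 oA] := @baire_multiples K (seq int) (lincomb (nth 0 s) (size s)) A [set 0]
    cA sA (@subgrp_set0 K) (closed_set0 hK).
    move=> a Aa; apply: contrapT => na; apply: ns; exists a; split => // m m0 [d _ dE].
    by apply: na; exists m, d; split => //; rewrite dE /= subrr.
  have sAn : subgrp [set a : K | [set 0] (a *+ n)].
    by split; [rewrite /= mul0rn|move=> a b /= an bn; rewrite mulrnBl an bn subrr].
  have [t [_ tA]] := compact_finite_index cA sAn oA sA.
  have [m m0 mA] := finite_index_exponent sAn sA tA.
  have [|a /mA /= amn] := uA (m * n)%N; first by rewrite muln_gt0 m0.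
  by rewrite mulrnA amn eqxx.
pose ys := fix ys n := if n is m.+1 then rcons (ys m) (nxt (ys m)) else [:: x].
have sys n : size (ys n) = n.+1 by elim: n => //= n IHn; rewrite size_rcons IHn.
pose f i := nth 0 (ys i) i.
have ysf n i : (i <= n)%N -> nth 0 (ys n) i = f i.
  elim: n => [|n IHn]; first by rewrite leqn0 => /eqP ->.
  rewrite leq_eqVlt => /predU1P[->//|]; rewrite ltnS => ni.
  by rewrite /= nth_rcons sys ltnS ni IHn.
have fS n : f n.+1 = nxt (ys n) by rewrite /f /= nth_rcons sys ltnn eqxx.
exists f; split => //.
  by case=> [//|n]; rewrite fS; have [] := nxtP (ys n).
move=> n m m0 [d _ dE]; have [_ /(_ m m0)] := nxtP (ys n); apply.
rewrite sys -fS -dE; exists d => //; apply: eq_bigr => i _; rewrite ysf //.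
by rewrite -ltnS.
Qed.

(** Given elements [x = f 0, f 1, f 2, ...] of [A], each of infinite order modulo
    the previous ones, impose the relations [f i = i.+2 f i.+1].  These make the
    group that they generate divisible without killing a nonzero multiple of
    [x].  A complement [H] of that quotient avoids the nonzero multiples of [x].
    The quotient of [A] by [H] is countable and divisible, so that [H] is dense by
    Baire's theorem. *)
Lemma dense_subgroup_avoiding_cyc A x : compact A -> subgrp A ->
    (forall n, (0 < n)%N -> exists2 a, A a & a *+ n != 0) -> A x ->
  exists H, [/\ subgrp H, H `<=` A, A `<=` closure H &
    forall h, H h -> cyc x h -> h = 0].
Proof.
move=> cA sA uA Ax; have [f [f0 Af find]] := compact_independent cA sA uA Ax.
pose r i := f i - f i.+1 *+ i.+2.
pose R := span_all r; have sR : subgrp R by exact: subgrp_span_all.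
have Rr i : R (r i) by exact: span_all_mem.
have RA : R `<=` A.
  by apply: span_all_sub => // i; apply: (subgrpB sA) => //; exact: subgrpMn.
have step n N : (n <= N)%N -> exists c : int, R (f n - f N *~ c).
  elim: N => [|N IHN].
    by rewrite leqn0 => /eqP ->; exists 1; rewrite subrr; exact: subgrp0.
  rewrite leq_eqVlt => /predU1P[->|]; first by exists 1; rewrite subrr; exact: subgrp0.
  rewrite ltnS => /IHN[c Rc]; exists (N.+2%:Z * c).
  rewrite (_ : _ - _ = (f n - f N *~ c) + r N *~ c); last by rewrite /r; zmod.
  by apply: (subgrpD sR) => //; exact: subgrpMz.
pose Y := [set z | exists n (s : int), R (z - f n *~ s)].
have sY : subgrp Y.
  split; first by exists 0%N, 0; rewrite subr0; exact: subgrp0.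
  move=> z z' [n [s Rz]] [n' [s' Rz']].
  have [c Rc] := step n (maxn n n') (leq_maxl _ _).
  have [c' Rc'] := step n' (maxn n n') (leq_maxr _ _).
  exists (maxn n n'), (c * s - c' * s').
  rewrite (_ : _ - _ = (z - f n *~ s) + (f n - f (maxn n n') *~ c) *~ s
    - (z' - f n' *~ s') - (f n' - f (maxn n n') *~ c') *~ s'); last by zmod.
  apply: (subgrpB sR); last exact: subgrpMz.
  by apply: (subgrpB sR) => //; apply: (subgrpD sR) => //; exact: subgrpMz.
have Yf n (s : int) : Y (f n *~ s) by exists n, s; rewrite subrr; exact: subgrp0.
have RY : R `<=` Y by move=> z Rz; exists 0%N, 0; rewrite mulr0z subr0.
have YA : Y `<=` A.
  move=> z [n [s /RA Az]]; apply: (subgrp_subK sA _ Az); exact: subgrpMz.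
(* [i] is such that [i.+2 = m n.+2]: the relation between [f i] and [f i.+1] makes
   [f i], and so [f n], divisible by [m]. *)
have divY c m : Y c -> (0 < m)%N -> exists2 c', Y c' & R (c - c' *+ m).
  move=> [n [s Rc]] m0; pose i := (m * n.+2 - 2)%N.
  have ni : (n <= i)%N by rewrite /i; nia.
  have [t Rt] := step n i ni.
  exists (f i.+1 *~ (n.+2%:Z * t * s)); first exact: Yf.
  have iE : i.+2 = (m * n.+2)%N by rewrite /i; nia.
  rewrite (_ : _ - _ = (c - f n *~ s) + (f n - f i *~ t) *~ s + r i *~ (t * s)).
    apply: (subgrpD sR); last exact: subgrpMz.
    by apply: (subgrpD sR) => //; exact: subgrpMz.
  by rewrite /r iE; zmod.
(* The relation [r n] has a nonzero coefficient at [f n.+1], so a combination of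
   relations that lies in [<x>] cannot involve the last of them. *)
have Rx h : R h -> cyc x h -> h = 0.
  move=> [n _ [d _ <-]] [j _ xj]; move: xj; rewrite -f0.
  elim: n => [|n IHn]; first by rewrite /lincomb big_ord0.
  rewrite /lincomb big_ord_recr /= -/(lincomb r n d) => xj.
  have sS : subgrp (span f n.+1) by exact: subgrp_span.
  have Sf i : (i <= n)%N -> span f n.+1 (f i) by move=> ni; exact: span_mem.
  have Sr : span f n.+1 (lincomb r n d).
    apply: subgrp_sum => // i _; apply: subgrpMz => //; apply: (subgrpB sS).
      by apply: Sf; exact: ltnW.
    by apply: subgrpMn => //; exact: Sf.
  have dn : d`_n = 0.
    apply: contrapT => /eqP dn0.
    have m0 : (0 < n.+2 * `|(d`_n)%R|)%N by rewrite muln_gt0 /= absz_gt0.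
    apply: (find n _ m0); rewrite mulrnA; apply: subgrp_absz => //.
    rewrite (_ : _ *~ _ = lincomb r n d + f n *~ d`_n - f 0%N *~ j).
      apply: (subgrpB sS); last by apply: subgrpMz => //; exact: Sf.
      by apply: (subgrpD sS) => //; apply: subgrpMz => //; exact: Sf.
    by rewrite xj /r; zmod.
  by move: xj; rewrite dn mulr0z addr0 => /IHn.
have [H [sH RH HA HY AH]] := divisible_complement sA sY sR RY YA divY.
exists H; split => //; last first.
  move=> h Hh xh; apply: Rx => //; apply: HY; split => //.
  by move: xh => [j _ <-]; rewrite -f0; exact: Yf.
have sP := subgrp_closure sH; have HP := @subset_closure _ H.
have [|n n0 oA] := @baire_multiples K (nat * int)%type (fun ns => f ns.1 *~ ns.2) A (closure H)
    cA sA sP (@closed_closure _ H).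
  move=> a Aa; have [h Hh [n [s Ras]]] := AH a Aa.
  exists 1%N, (n, s); split => //; apply: HP; rewrite mulr1n /=.
  rewrite (_ : _ - _ = h + (a - h - f n *~ s)); last by zmod.
  by apply: (subgrpD sH) => //; exact: RH.
have sPn : subgrp [set a : K | closure H (a *+ n)].
  split; first by rewrite /= mul0rn; exact: subgrp0.
  by move=> a b /= Pa Pb; rewrite mulrnBl; exact: (subgrpB sP).
have [t [_ tA]] := compact_finite_index cA sPn oA sA.
have [m m0 mA] := finite_index_exponent sPn sA tA.
move=> a Aa; have [h Hh Yah] := AH a Aa.
have mn0 : (0 < m * n)%N by rewrite muln_gt0 m0.
have [z Yz Rz] := divY _ _ Yah mn0.
have := mA z (YA _ Yz); rewrite /= -mulrnA => Pz.
rewrite (_ : a = h + z *+ (m * n) + (a - h - z *+ (m * n))); last by zmod.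
apply: (subgrpD sP); last by apply/HP/RH.
by apply: (subgrpD sP) => //; exact: HP.
Qed.

Lemma unbounded_torsion_free : compact [set: K] -> essential_dense K ->
    (forall n, (0 < n)%N -> exists a : K, a *+ n != 0) ->
  forall (x : K) n, (0 < n)%N -> x *+ n = 0 -> x = 0.
Proof.
move=> cK essK uK x n n0 xn; apply: contrapT => /eqP x0.
have [|H [sH _ HD Hx]] := @dense_subgroup_avoiding_cyc setT x cK (@subgrpT K) _ I.
- by move=> m m0; have [a] := uK m m0; exists a.
have [||y [Hy xy /eqP y0]] := essK H (cyc x) sH (fun y => HD y I) (subgrp_cyc x).
- by apply: compact_closed => //; exact: compact_cyc_torsion xn.
- by exists x => //; exact: cyc_id.
- by apply: y0; exact: Hx.
Qed.

End Unbounded.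

(** * Infinite compact groups of bounded exponent *)

Section PrimeOrder.
Variable G : zmodType.
Implicit Types (H : set G) (x l : G).

Lemma bezout_int (a b : int) : coprime `|a| `|b| -> exists u v : int, a * u + b * v = 1.
Proof.
move=> /coprimezP[[u v] /= uv]; exists u, v.
by rewrite mulrC [b * v]mulrC.
Qed.

Lemma prime_bezout p (j : int) : prime p -> ~~ (p %| `|j|)%N ->
  exists u v : int, j * u + p%:Z * v = 1.
Proof. by move=> pp pj; apply: bezout_int; rewrite coprime_sym prime_coprime. Qed.

(** Invert modulo [p] the coefficient of [l]; it is prime to [p], since otherwise
    [x] would be in [H]. *)
Lemma subgrp_modulo_prime p H l x : prime p -> subgrp H -> ~ H x -> H (l *+ p) ->
  (exists h, H h /\ exists j : int, h + l *~ j = x) -> exists s : int, H (l - x *~ s).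
Proof.
move=> pp sH nHx Hlp [h [Hh [j hE]]].
have [/dvdnP[k jk]|/(prime_bezout pp)[u [v uv]]] := boolP (p %| `|j|)%N.
  case: nHx; rewrite -hE; apply: (subgrpD sH Hh).
  have : H (l *+ p *+ k) by exact: subgrpMn.
  rewrite -mulrnA mulnC -jk; case: (intP j) => [|n|n] //.
  by rewrite abszN mulrNz => /(subgrpN sH).
exists u; have pv : p%:Z * v = 1 - j * u by rewrite -uv; ring.
rewrite (_ : _ - _ = (l *+ p) *~ v - h *~ u).
  by apply: (subgrpB sH); exact: subgrpMz.
rewrite -hE -[l *+ p]/(l *~ p%:Z) -[l *~ _ *~ v]mulrzA pv; zmod.
Qed.

Lemma prime_order_multiple p H x (j : int) : prime p -> subgrp H -> x *+ p = 0 ->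
  ~ H x -> H (x *~ j) -> x *~ j = 0.
Proof.
move=> pp sH xp nHx Hxj.
have [/dvdnP[k jk]|/(prime_bezout pp)[u [v uv]]] := boolP (p %| `|j|)%N.
  have : x *+ p *+ k = 0 by rewrite xp mul0rn.
  rewrite -mulrnA mulnC -jk; case: (intP j) => [|n|n] //.
  by rewrite abszN mulrNz => xn; rewrite (xn : x *~ n.+1%:Z = 0) oppr0.
case: nHx; have pv : p%:Z * v = 1 - j * u by rewrite -uv; ring.
rewrite (_ : x = x *~ j *~ u + x *+ p *~ v).
  by rewrite xp mul0rz addr0; exact: subgrpMz.
rewrite -[x *+ p]/(x *~ p%:Z) -[x *~ _ *~ v]mulrzA pv; zmod.
Qed.

End PrimeOrder.

Section Bounded.
Variable K : topologicalZmodType.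
Hypotheses (hK : hausdorff_space K) (cK : compact [set: K]).
Implicit Types (A B H L P S U V W : set K).

(** The closure of the infinite group [span_all f] is a compact infinite group, so
    it is uncountable by Baire's theorem. *)
Lemma closure_span_uncountable (f : nat -> K) (I : countType) (g : I -> K) : injective f ->
  exists2 z, closure (span_all f) z & forall i, z != g i.
Proof.
move=> injf; apply: contrapT => nz.
set S := span_all f in nz; have sS : subgrp S by exact: subgrp_span_all.
have sP := subgrp_closure sS.
have cP : compact (closure S) by apply: (subclosed_compact _ cK) => //; exact: closed_closure.
have [|||i [w [Pw [V V0 VF]]]] := @baire K I (fun i => [set g i]) (closure S) cP.
- by exists 0; exact: subgrp0.
- move=> i; exact: (accessible_closed_set1 (hausdorff_accessible hK)).
- move=> z Pz; apply: contrapT => nzi; apply: nz; exists z => // i.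
  by apply/eqP => zi; apply: nzi; exists i.
have oP : open_in (closure S) [set 0].
  exists V => // v [Pv Vv]; have /= wi : w = g i.
    by apply: VF; rewrite // subrr; exact: nbhs_singleton.
  have /= : w + v = g i by apply: VF; [exact: (subgrpD sP)|rewrite addrAC subrr add0r].
  by rewrite -wi => /(canRL (addKr w)); rewrite addNr.
have [s [_ sP0]] := compact_finite_index cP (@subgrp_set0 K) oP sP.
have : finite_set (range f).
  apply: (@sub_finite_set _ _ [set` s]); last exact: finite_seq.
  move=> _ [n _ <-] /=; have [|c cs /eqP] := sP0 (f n).
    by apply: subset_closure; exact: span_all_mem.
  by rewrite subr_eq0 => /eqP ->.
rewrite (eq_finite_set (inj_card_eq (in2W injf))); exact: infinite_nat.
Qed.

(** Modulo [M], [L] is a vector space over the field with [p] elements, and a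
    subgroup containing [M] that is maximal among those avoiding [x] is a
    hyperplane.  To make it dense, let it contain an infinite countable subgroup
    [S], itself taken in some hyperplane [H1] avoiding [x], and an element [z - x],
    where [z] is a limit of [S]: then its closure contains [z] and so [x].  For this
    not to force [x] into the hyperplane, [z] must avoid the countable group
    [S + M + <x>]. *)
Lemma dense_hyperplane L M p x : prime p -> subgrp L -> infinite_set L -> closed L ->
    subgrp M -> finite_set M -> M `<=` L -> (forall l, L l -> M (l *+ p)) ->
    L x -> x *+ p = 0 -> ~ M x ->
  exists H, [/\ subgrp H, M `<=` H, H `<=` L,
    ~ H x & L `<=` closure H /\ forall l, L l -> exists s : int, H (l - x *~ s)].
Proof.
move=> pp sL iL cL sM fM ML LM Lx xp nMx.
have hyper H : subgrp H -> M `<=` H -> (forall y, H y -> ~ [set x] y) ->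
    (forall a, L a -> ~ H a -> exists h, H h /\ exists j : int, [set x] (h + a *~ j)) ->
    forall l, L l -> exists s : int, H (l - x *~ s).
  move=> sH MH nHx Hmax l Ll; have [Hl|nHl] := pselect (H l).
    by exists 0; rewrite mulr0z subr0.
  apply: (subgrp_modulo_prime pp sH) (Hmax l Ll nHl); first by move=> /nHx; apply.
  by apply/MH/LM.
have [|H1 [sH1 MH1 H1L nH1x H1max]] := @maximal_avoiding _ M L [set x] sM sL ML.
  by move=> y My yx; apply: nMx; rewrite -yx.
have LH1 := hyper H1 sH1 MH1 nH1x H1max.
have fx := finite_cyc_torsion (prime_gt0 pp) xp.
have iH1 : infinite_set H1.
  move=> fH1; apply: iL.
  apply: (@sub_finite_set _ _ ((fun z => z.1 + z.2) @` (H1 `*` cyc x))).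
    move=> l Ll; have [s Hls] := LH1 l Ll; exists (l - x *~ s, x *~ s) => /=.
      by split => //=; exists s.
    by rewrite subrK.
  by apply: finite_image; exact: finite_setX.
have [f fH1 injf] : exists2 f : nat -> K, (forall n, H1 (f n)) & injective f.
  have /infiniteP/card_leP[g] := iH1.
  exists (fun n => val (g (SigSub (mem_set (I : [set: nat] n))))) => [n|n n'].
    exact: set_mem (valP _).
  by move=> /val_inj /(@inj _ _ _ g) /= h; case: (h (mem_set I) (mem_set I)).
have [t tM] : exists t : seq K, M = [set` t] by apply/finite_seqP.
pose S := span_all f; have sS : subgrp S by exact: subgrp_span_all.
have SH1 : S `<=` H1 by exact: span_all_sub.
have [z clz zg] := @closure_span_uncountable f (nat * seq int * nat * int)%type
  (fun i => let: (n, d, k, j) := i in lincomb f n d + nth 0 t k + x *~ j) injf.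
have nz s m (j : int) : S s -> M m -> z != s + m + x *~ j.
  move=> [n _ [d _ <-]] Mm; have mt : m \in t by move: Mm; rewrite tM.
  by have := zg (n, d, index m t, j); rewrite nth_index.
have Lz : L z by apply: closure_mono_sub clz => //; exact: (subset_trans SH1).
pose T := sumset (sumset S M) (cyc (z - x)).
have sSM : subgrp (sumset S M) by exact: subgrp_sumset.
have sT : subgrp T by apply: subgrp_sumset => //; exact: subgrp_cyc.
have nTx y : T y -> ~ [set x] y.
  move=> [w [s Ss Mws] [j _ yE]] /= yx; rewrite yx in yE.
  have [/dvdnP[k jk]|/(prime_bezout pp)[u [v uv]]] := boolP (p %| `|j|)%N.
    have Mj : M ((z - x) *~ j).
      have : M ((z - x) *+ p *+ k) by apply: (subgrpMn k sM); exact: (LM _ (subgrpB sL Lz Lx)).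
      rewrite -mulrnA mulnC -jk; case: (intP j) => [|n|n] //.
      by rewrite abszN mulrNz => /(subgrpN sM).
    apply: (nH1x x) => //; rewrite -(subrK w x) -yE; apply: (subgrpD sH1).
      exact: MH1.
    by rewrite -(subrK s w); apply: (subgrpD sH1); [exact: MH1|exact: SH1].
  have pv : p%:Z * v = 1 - j * u by rewrite -uv; ring.
  have Su : S (- (s *~ u)) by apply: (subgrpN sS); exact: subgrpMz.
  have Mv : M (z *+ p *~ v - (w - s) *~ u).
    by apply: (subgrpB sM); apply: subgrpMz => //; exact: LM.
  case/eqP: (nz _ _ (u + j * u) Su Mv).
  rewrite -[z *+ p]/(z *~ p%:Z) -[z *~ _ *~ v]mulrzA pv.
  have -> : w = x - (z - x) *~ j by rewrite yE subKr.
  zmod.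
have TL : T `<=` L.
  apply: sumset_sub => //; last by apply: cyc_sub => //; exact: (subgrpB sL).
  by apply: sumset_sub => //; exact: (subset_trans SH1).
have [H [sH TH HL nHx Hmax]] := @maximal_avoiding _ T L [set x] sT sL TL nTx.
have SMT : sumset S M `<=` T by apply: sumset_subl; exact: (subgrp0 (subgrp_cyc _)).
have MH : M `<=` H.
  by apply: (subset_trans _ TH); apply: (subset_trans _ SMT); apply: sumset_subr; exact: subgrp0.
have LH := hyper H sH MH nHx Hmax.
have sP := subgrp_closure sH; have HP := @subset_closure _ H.
have Px : closure H x.
  rewrite -(subKr z x); apply: (subgrpB sP).
    apply: closureS clz; apply: (subset_trans _ TH); apply: (subset_trans _ SMT).
    by apply: sumset_subl; exact: subgrp0.
  apply/HP/TH; apply: sumset_subr; first exact: subgrp0.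
  exact: cyc_id.
exists H; split => //; first by move=> /nHx; apply.
split => // l Ll; have [s Hls] := LH l Ll.
by rewrite -(subrK (x *~ s) l); apply: (subgrpD sP); [exact: HP|exact: (subgrpMz s sP Px)].
Qed.

(** Let [n K] be finite with [n] minimal, [p] a prime divisor of [n] and
    [q = n / p].  A dense hyperplane of [q K] avoiding some [x] of order [p]
    extends to a subgroup [H] of [K] maximal with [x] not in [H].  Then [K / H]
    is cyclic, generated by some [k0] with [q k0 = x], and [H] is dense: otherwise
    [q] would map the closure of [H] onto the hyperplane, which is not closed. *)
Lemma essential_compact_unbounded : essential_dense K -> infinite_set [set: K] ->
  forall n, (0 < n)%N -> exists a : K, a *+ n != 0.
Proof.
move=> essK iK m m0; apply: contrapT => nm.
have {nm} mK (a : K) : a *+ m = 0.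
  by apply/eqP/negPn/negP => am; apply: nm; exists a.
pose mul n := [set a *+ n | a in [set: K]].
have exn : exists n, (0 < n)%N && `[< finite_set (mul n) >].
  exists m; rewrite m0; apply/asboolP; apply: (@sub_finite_set _ _ [set 0]).
    by move=> _ [a _ <-]; exact: mK.
  exact: finite_set1.
case: (ex_minnP exn) => n /andP[n0 /asboolP fn] nmin.
have n1 : (1 < n)%N.
  rewrite ltn_neqAle n0 andbT; apply/eqP => n1; apply: iK; apply: sub_finite_set fn.
  by move=> a _; exists a => //; rewrite -n1.
pose p := pdiv n; have pp : prime p by exact: pdiv_prime.
have p1 := prime_gt1 pp; have p0 := prime_gt0 pp.
pose q := (n %/ p)%N; have nE : n = (q * p)%N by rewrite divnK // pdiv_dvd.
have q0 : (0 < q)%N by move: n0; rewrite nE muln_gt0 => /andP[].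
pose L := mul q; pose M := mul n.
have iL : infinite_set L.
  move=> fL; have : (q < n)%N by rewrite ltn_Pdiv.
  by rewrite ltnNge nmin // q0; exact/asboolP.
have sL : subgrp L by exact: (subgrp_mulrn _ (@subgrpT K)).
have sM : subgrp M by exact: (subgrp_mulrn _ (@subgrpT K)).
have cL : closed L by apply: compact_closed => //; exact: compact_mulrn.
have ML : M `<=` L by move=> _ [a _ <-]; exists (a *+ p) => //; rewrite -mulrnA mulnC -nE.
have LM l : L l -> M (l *+ p) by move=> [a _ <-]; exists a => //; rewrite -mulrnA -nE.
(* Otherwise the [p]-torsion of [L] and its image [p L = M] would both be
   finite. *)
have [x [Lx xp nMx]] : exists x, [/\ L x, x *+ p = 0 & ~ M x].
  apply: contrapT => nx.
  have [g gP] : {g : K -> K & forall y, M y -> L (g y) /\ g y *+ p = y}.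
    apply: (@choice _ _ (fun y l => M y -> L l /\ l *+ p = y)) => y.
    have [[a _ <-]|nMy] := pselect (M y); last by exists 0.
    by exists (a *+ q) => _; split; [exists a|rewrite -mulrnA -nE].
  apply: iL; apply: (@sub_finite_set _ _ ((fun z => g z.1 + z.2) @` (M `*` M))).
    move=> l Ll; have [Lg gp] := gP _ (LM l Ll).
    exists (l *+ p, l - g (l *+ p)); last by rewrite /= subrKC.
    split; first exact: LM.
    apply: contrapT => nMl; apply: nx; exists (l - g (l *+ p)); split => //.
      exact: subgrpB.
    by rewrite mulrnBl gp subrr.
  by apply: finite_image; exact: finite_setX.
have [H0 [sH0 MH0 H0L nH0x [LH0 H0gen]]] := dense_hyperplane pp sL iL cL sM fn ML LM Lx xp nMx.
have [a [q' [qE pq']]] : exists a q', q = (q' * p ^ a)%N /\ coprime p q'.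
  by exists (logn p q); have [q' pq' qE] := pfactor_coprime pp q0; exists q'.
(* The order of [k0] is made a power of [p], for [pj] below: if [k0] is not in
   the closure of [H], then all its multiples there are multiples of [p k0]. *)
have [k0 k0q k0p] : exists2 k0, k0 *+ q = x & k0 *+ (p ^ a.+1) = 0.
  case: (Lx) => k _ kq; have [|u [v uv]] := @bezout_int q' p; first by rewrite coprime_sym.
  exists (k *~ (q'%:Z * u)).
    have pv : q'%:Z * u = 1 - p%:Z * v by rewrite -uv; ring.
    rewrite pv (_ : _ *+ q = k *+ q - (k *+ q) *+ p *~ v); last by zmod.
    by rewrite kq xp mul0rz subr0.
  rewrite (_ : _ *+ _ = (k *+ q) *+ p *~ u); first by rewrite kq xp mul0rz.
  by rewrite qE expnS; zmod.
have [|H [sH H0H _ nHx Hmax]] := @maximal_avoiding _ H0 setT [set x] sH0 (@subgrpT K) (fun _ _ => I).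
  by move=> y Hy yx; apply: nH0x; rewrite -yx.
have {}nHx : ~ H x by move=> /nHx; apply.
have HL y : H y -> L y -> H0 y.
  move=> Hy Ly; have [s Hs] := H0gen y Ly.
  have Hxs : H (x *~ s) by rewrite -(subKr y (x *~ s)); apply: (subgrpB sH) => //; exact: H0H.
  by move: Hs; rewrite (prime_order_multiple pp sH xp nHx Hxs) subr0.
have gen_div d : (d %| q)%N -> forall k, H (k *+ d) -> exists s : int, H (k - k0 *~ s).
  elim/ltn_ind: d => d IHd dq k Hkd.
  have d0 : (0 < d)%N by exact: dvdn_gt0 dq.
  have [d1|d1] := eqVneq d 1%N.
    by exists 0; rewrite mulr0z subr0; rewrite d1 in Hkd.
  have d2 : (1 < d)%N by rewrite ltn_neqAle eq_sym d1.
  pose r := pdiv d; have pr : prime r by exact: pdiv_prime.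
  pose e := (d %/ r)%N; have dE : d = (e * r)%N by rewrite divnK // pdiv_dvd.
  have ed : (e < d)%N by rewrite ltn_Pdiv // prime_gt1.
  have eq_ : (e %| q)%N by apply: dvdn_trans dq; rewrite dE dvdn_mulr.
  have [Hke|nHke] := pselect (H (k *+ e)); first exact: IHd Hke.
  have [|s Hs] := subgrp_modulo_prime pr sH nHx _ (Hmax _ I nHke).
    by rewrite -mulrnA -dE.
  have [t qt] := dvdnP eq_.
  have [|s' Hs'] := IHd e ed eq_ (k - k0 *~ (t%:Z * s)).
    congr H: Hs; rewrite -k0q qt; zmod.
  exists (t%:Z * s + s'); congr H: Hs'; zmod.
have gen k : exists s : int, H (k - k0 *~ s).
  have [|s Hs] := H0gen (k *+ q); first by exists k.
  have [|s' Hs'] := gen_div q (dvdnn q) (k - k0 *~ s).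
    have := H0H _ Hs; congr H; rewrite -k0q; zmod.
  exists (s + s'); congr H: Hs'; zmod.
have sP := subgrp_closure sH; have HP := @subset_closure _ H.
have Pk0 : closure H k0.
  apply: contrapT => nPk0.
  have pj (j : int) : closure H (k0 *~ j) -> (p %| `|j|)%N.
    move=> Pj; apply: contrapT => /negP npj; apply: nPk0.
    have [|u [v uv]] := @bezout_int j (p ^ a.+1)%N.
      by rewrite coprime_sym coprimeXl // prime_coprime.
    rewrite (_ : k0 = k0 *~ j *~ u + k0 *+ (p ^ a.+1) *~ v).
      by rewrite k0p mul0rz addr0; exact: (subgrpMz u sP Pj).
    have jv : (p ^ a.+1)%N%:Z * v = 1 - j * u by rewrite -uv; ring.
    by rewrite -[k0 *+ _]/(k0 *~ (p ^ a.+1)%N%:Z) -[k0 *~ (p ^ _)%N%:Z *~ v]mulrzA jv; zmod.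
  have qP t : closure H t -> H0 (t *+ q).
    move=> Pt; apply: HL; last by exists t.
    have [s Hs] := gen t.
    have /pj/dvdnP[j sj] : closure H (k0 *~ s).
      by rewrite -(subKr t (k0 *~ s)); apply: (subgrpB sP) => //; exact: HP.
    rewrite (_ : t *+ q = (t - k0 *~ s) *+ q + (k0 *+ q) *~ s); last by zmod.
    rewrite k0q (_ : x *~ s = 0) ?addr0; first exact: subgrpMn.
    have : x *+ p *+ j = 0 by rewrite xp mul0rn.
    rewrite -mulrnA mulnC -sj; case: (intP s) => [|i|i] //.
    by rewrite abszN mulrNz => xi; rewrite (xi : x *~ i.+1%:Z = 0) oppr0.
  pose Q := [set t *+ q | t in closure H].
  have cQ : closed Q.
    apply: compact_closed => //; apply: compact_mulrn.
    by apply: (subclosed_compact _ cK) => //; exact: closed_closure.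
  have H0Q : H0 `<=` Q.
    move=> h H0h; have [k _ kq] := H0L _ H0h; have [s Hs] := gen k.
    have H0s : H0 ((k - k0 *~ s) *+ q) by apply: qP; exact: HP.
    have hE : (k - k0 *~ s) *+ q = h - x *~ s by rewrite -kq -k0q; zmod.
    have xs : x *~ s = 0.
      apply: (prime_order_multiple pp sH0 xp nH0x).
      by rewrite -(subKr h (x *~ s)); apply: (subgrpB sH0) => //; rewrite -hE.
    by exists (k - k0 *~ s); [exact: HP|rewrite hE xs subr0].
  apply: nH0x; have [t Pt <-] := closure_mono_sub cQ H0Q (LH0 x Lx); exact: qP.
have [|||y [Hy [j _ yE] /eqP y0]] := essK H (cyc x) sH _ (subgrp_cyc x).
- move=> k; have [s Hs] := gen k; rewrite -(subrK (k0 *~ s) k).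
  by apply: (subgrpD sP); [exact: HP|exact: (subgrpMz s sP)].
- by apply: compact_closed => //; exact: compact_cyc_torsion xp.
- exists x; first exact: cyc_id.
  by apply/eqP => x0; apply: nHx; rewrite x0; exact: subgrp0.
by apply: y0; rewrite -yE; apply: (prime_order_multiple pp sH xp nHx); rewrite yE.
Qed.

End Bounded.

(** * Torsion-free profinite essential groups are procyclic *)

Section Profinite.
Variable K : topologicalZmodType.
Hypotheses (hK : hausdorff_space K) (cK : compact [set: K]).
Hypothesis baseK : forall U : set K, nbhs (0 : K) U -> exists Q : set K, [/\ subgrp Q, open Q & Q `<=` U].
Hypothesis tfK : forall (x : K) n, (0 < n)%N -> x *+ n = 0 -> x = 0.
Implicit Types (A B H L M O P Q U V W : set K) (x y z : K).

Lemma open_subgrp_exponent Q : subgrp Q -> open Q ->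
  exists2 n, (0 < n)%N & forall a : K, Q (a *+ n).
Proof.
move=> sQ oQ; have oT : open_in [set: K] Q.
  exists Q; first by apply: open_nbhs_nbhs; split => //; exact: subgrp0.
  by move=> x [].
have [s [_ sP]] := compact_finite_index cK sQ oT (@subgrpT K).
have [n n0 nP] := finite_index_exponent sQ (@subgrpT K) sP.
by exists n => // a; exact: nP.
Qed.

(** Let [Q] be a proper open subgroup, [n] the exponent of the finite group
    [K / Q] and [q = n / p], for a prime divisor [p] of [n].  A subgroup maximal
    among those that contain the preimage of [Q] under [q] and avoid some [z] is a
    hyperplane, of index [p]. *)
Lemma prime_index_subgrp y : y != 0 -> exists p (O : set K) z, [/\ prime p, subgrp O, open O, ~ O z &
  forall k, O (k *+ p) /\ exists s : int, O (k - z *~ s)].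
Proof.
move=> y0; have [V [_ nV _ nVy]] := hausdorff_notin hK y0.
have [Q [sQ oQ QV]] := baseK nV.
have exn : exists n, (0 < n)%N && `[< forall a : K, Q (a *+ n) >].
  by have [n n0 Qn] := open_subgrp_exponent sQ oQ; exists n; rewrite n0; exact/asboolP.
case: (ex_minnP exn) => n /andP[n0 /asboolP nQ] nmin.
have n1 : (1 < n)%N.
  rewrite ltn_neqAle n0 andbT; apply/eqP => n1; apply/nVy/QV.
  by have := nQ y; rewrite -n1.
pose p := pdiv n; have pp : prime p by exact: pdiv_prime.
pose q := (n %/ p)%N; have nE : n = (q * p)%N by rewrite divnK // pdiv_dvd.
have q0 : (0 < q)%N by move: n0; rewrite nE muln_gt0 => /andP[].
have [z nQz] : exists z : K, ~ Q (z *+ q).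
  apply: contrapT => nz; have /nmin : (0 < q)%N && `[< forall a : K, Q (a *+ q) >].
    rewrite q0; apply/asboolP => a; apply: contrapT => nQa; apply: nz; by exists a.
  by rewrite leqNgt ltn_Pdiv // prime_gt1.
pose O' := [set a : K | Q (a *+ q)].
have sO' : subgrp O'.
  split; first by rewrite /O' /= mul0rn; exact: subgrp0.
  by move=> a b; rewrite /O' /= mulrnBl; exact: (subgrpB sQ).
have QO' : Q `<=` O' by move=> a; exact: subgrpMn.
have [|O [sO O'O _ nOz Omax]] := @maximal_avoiding _ O' setT [set z] sO' (@subgrpT K) (fun _ _ => I).
  by move=> a O'a az; apply: nQz; rewrite -az.
have {}nOz : ~ O z by move=> /nOz; apply.
have Op k : O (k *+ p) by apply: O'O; rewrite /O' /= -mulrnA mulnC -nE.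
exists p, O, z; split => //.
  apply: open_subgrp => //; apply: (@filterS _ _ _ Q); first exact: subset_trans O'O.
  by apply: open_nbhs_nbhs; split => //; exact: subgrp0.
move=> k; split => //; have [Ok|nOk] := pselect (O k).
  by exists 0; rewrite mulr0z subr0.
exact: (subgrp_modulo_prime pp sO nOz (Op k) (Omax k I nOk)).
Qed.

Variables (p : nat) (O M : set K) (z0 : K).
Hypotheses (pp : prime p) (sO : subgrp O) (oO : open O).
Hypothesis Ogen : forall k, O (k *+ p) /\ exists s : int, O (k - z0 *~ s).
Hypotheses (sM : subgrp M) (clM : closed M) (OM : [set: K] `<=` sumset M O).
Hypothesis Mmin : forall B, subgrp B -> closed B -> B `<=` M -> [set: K] `<=` sumset B O -> M `<=` B.

(** A closed subgroup of [M] not contained in [O] is a supplement of [O], as [O]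
    has prime index; so it is [M] by minimality. *)
Lemma local_generated z : M z -> ~ O z -> M `<=` closure (cyc z).
Proof.
move=> Mz nOz; apply: Mmin; first by apply: subgrp_closure; exact: subgrp_cyc.
- exact: closed_closure.
- by apply: closure_mono_sub => //; exact: cyc_sub.
move=> k _; have [_ [t Ot]] := Ogen z.
have [|s Os] := subgrp_modulo_prime pp sO nOz (Ogen z0).1.
  by exists (z - z0 *~ t); split => //; exists t; rewrite subrK.
have [_ [r Or]] := Ogen k.
exists (z *~ (s * r)); first by apply: subset_closure; exists (s * r).
rewrite (_ : _ - _ = (k - z0 *~ r) + (z0 - z *~ s) *~ r); last by zmod.
by apply: (subgrpD sO) => //; exact: subgrpMz.
Qed.

Variable x : K.
Hypotheses (Mx : M x) (nOx : ~ O x).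

(** Let [m'] be the part prime to [p] of the order of [x] modulo [Q].  As [m' x] is
    not in [O], it also generates a dense subgroup of [M]; so [x] is a multiple of
    [m' x] modulo [Q], which forces [m' = 1]. *)
Lemma local_power Q : subgrp Q -> open Q -> exists n, Q (x *+ p ^ n).
Proof.
move=> sQ oQ; have [m m0 Qm] := open_subgrp_exponent sQ oQ.
have [|n [n0 Qn nmin]] := subgrp_mult_min sQ (_ : exists2 n, (0 < n)%N & Q (x *+ n)).
  by exists m.
have [m' pm' nE] := pfactor_coprime pp n0.
have nOxm : ~ O (x *+ m').
  move=> Om; apply: nOx; have [|u [v uv]] := @bezout_int m' p; first by rewrite coprime_sym.
  rewrite (_ : x = x *+ m' *~ u + x *+ p *~ v).
    by apply: (subgrpD sO); apply: subgrpMz => //; exact: (Ogen x).1.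
  have pv : p%:Z * v = 1 - m'%:Z * u by rewrite -uv; ring.
  by rewrite -[x *+ p]/(x *~ p%:Z) -[x *~ p%:Z *~ v]mulrzA pv; zmod.
have nQ : nbhs (0 : K) Q by apply: open_nbhs_nbhs; split => //; exact: subgrp0.
have := local_generated (subgrpMn m' sM Mx) nOxm Mx.
move=> /closure_nbhs0 /(_ _ nQ)[_ [j _ <-] Qj].
have /nmin nj : Q (x *~ (m'%:Z * j - 1)) by congr Q: Qj; zmod.
have m'1 : m' = 1%N.
  have /dvdn_trans/(_ nj) mj : (m' %| n)%N by rewrite nE dvdn_mulr.
  have mj1 : (m'%:Z %| m'%:Z * j - 1)%Z by rewrite dvdzE.
  have : (m'%:Z %| 1)%Z by rewrite -[X in (_ %| X)%Z](subKr (m'%:Z * j)) rpredB // dvdz_mulr.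
  by rewrite dvdzE dvdn1 => /eqP.
by exists (logn p n); move: Qn; rewrite {1}nE m'1 mul1n.
Qed.

Lemma local_power_sub Q n y : subgrp Q -> open Q -> Q (x *+ p ^ n) -> M y -> Q (y *+ p ^ n).
Proof.
move=> sQ oQ Qx My; have nQ : nbhs (0 : K) Q by apply: open_nbhs_nbhs; split => //; exact: subgrp0.
have /closure_nbhs0 /(_ _ nQ)[_ [j _ <-] Qj] := local_generated Mx nOx My.
rewrite (_ : _ *+ _ = x *+ p ^ n *~ j - (x *~ j - y) *+ p ^ n); last by zmod.
by apply: (subgrpB sQ); [exact: subgrpMz|exact: subgrpMn].
Qed.

(** The multiples [j x] close to [z] are in [O], so [p] divides [j]; and [p M] is
    closed. *)
Lemma local_divides z : M z -> O z -> exists2 y, M y & y *+ p = z.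
Proof.
move=> Mz Oz; have cM : compact M := subclosed_compact clM cK (@subsetT _ M).
suff : [set y *+ p | y in M] z by move=> [y My <-]; exists y.
have : closed [set y *+ p | y in M] by apply: compact_closed => //; exact: compact_mulrn.
move=> /closure_idS; apply; apply: closureW => V nV.
have nO : nbhs (0 : K) O by apply: open_nbhs_nbhs; split => //; exact: subgrp0.
have /closure_nbhs0 /(_ _ (filterI nV nO))[_ [j _ <-] [Vj Oj]] := local_generated Mx nOx Mz.
exists (x *~ j) => //.
have Oxj : O (x *~ j) := subgrp_subK sO Oz Oj.
have [/dvdnP[k jk]|/(prime_bezout pp)[u [v uv]]] := boolP (p %| `|j|)%N.
  exists (x *~ (sgz j * k%:Z)); first exact: subgrpMz.
  by rewrite [in RHS](intEsg j) jk; zmod.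
case: nOx; have pv : p%:Z * v = 1 - j * u by rewrite -uv; ring.
rewrite (_ : x = x *~ j *~ u + x *+ p *~ v).
  by apply: (subgrpD sO); apply: subgrpMz => //; exact: (Ogen x).1.
by rewrite -[x *+ p]/(x *~ p%:Z) -[x *~ p%:Z *~ v]mulrzA pv; zmod.
Qed.

(** Dividing [z] by [p] for ever would put it in every open subgroup. *)
Lemma local_valuation z : M z -> z != 0 -> exists n y, [/\ M y, ~ O y & z = y *+ p ^ n].
Proof.
move=> Mz z0'; apply: contrapT => nz.
have div n : exists2 y, M y & z = y *+ p ^ n.
  elim: n => [|n [y My zE]]; first by exists z; rewrite ?expn0.
  have [Oy|nOy] := pselect (O y); last by case: nz; exists n, y.
  have [y' My' yE] := local_divides My Oy.
  by exists y' => //; rewrite zE -yE -mulrnA -expnS.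
have [V [_ nV _ nVz]] := hausdorff_notin hK z0'.
have [Q [sQ oQ QV]] := baseK nV; have [n Qn] := local_power sQ oQ.
have [y My zE] := div n; apply/nVz/QV; rewrite zE; exact: local_power_sub.
Qed.

(** Nonzero elements of [A `&` M] have the form [p ^ n y] with [y] in [M] but not
    in [O]; take [n] minimal.  If [n = 0], then [A] contains [M], and [O] is a
    smaller supplement.  Otherwise [w = p ^ n y] is in [p A], as every open
    subgroup [B] of index [p] of [A] contains [w]: if not, [B + <w> = A] and [B] is
    a smaller supplement of [M].  Being torsion-free, [K] then has [p ^ n.-1 y] in
    [A], against the choice of [n]. *)
Lemma local_complement A : subgrp A -> closed A -> [set: K] `<=` sumset A M ->
    (forall B, subgrp B -> closed B -> B `<=` A -> [set: K] `<=` sumset B M -> A `<=` B) ->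
  forall z, A z -> M z -> z = 0.
Proof.
move=> sA clA AM Amin z Az Mz; apply: contrapT => /eqP z0'.
have cA : compact A := subclosed_compact clA cK (@subsetT _ A).
have clO : closed O by exact: open_subgrp_closed.
have ex : exists n, `[< exists y, [/\ M y, ~ O y & A (y *+ p ^ n)] >].
  have [n [y [My nOy zE]]] := local_valuation Mz z0'; exists n; apply/asboolP; exists y.
  by rewrite -zE.
case: (ex_minnP ex) => -[|n] /asboolP[y [My nOy Ay]] nmin.
  have MA : M `<=` A.
    apply: (subset_trans (local_generated My nOy)); apply: closure_mono_sub => //.
    by apply: cyc_sub => //; rewrite expn0 in Ay.
  have AT k : A k by have [b Ab Mkb] := AM k I; apply: (subgrp_subK sA Ab); exact: MA.
  have AO : A `<=` O by apply: (Amin O sO clO (fun k _ => AT k)); rewrite sumsetC.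
  by apply: nOx; exact: AO.
set w := y *+ p ^ n.+1 in Ay.
have Mw : M w by exact: subgrpMn.
suff [a Aa aw] : exists2 a, A a & a *+ p = w.
  have /nmin : `[< exists y, [/\ M y, ~ O y & A (y *+ p ^ n)] >].
    apply/asboolP; exists y; split => //; suff -> : y *+ p ^ n = a by [].
    apply/eqP; rewrite -subr_eq0; apply/eqP; apply: (tfK (n := p)); first exact: prime_gt0.
    by rewrite mulrnBl aw /w -mulrnA -expnSr subrr.
  by rewrite ltnn.
pose pA := [set a *+ p | a in A].
have spA : subgrp pA by exact: subgrp_mulrn.
have clpA : closed pA by apply: compact_closed => //; exact: compact_mulrn.
apply: contrapT => nw; have {}nw : ~ pA w by move=> [a Aa aw]; apply: nw; exists a.
have [Q [sQ oQ QU]] := baseK (closed_notin clpA nw).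
pose W := A `&` sumset pA Q.
have sW : subgrp W by apply: subgrpI => //; exact: subgrp_sumset.
have [||B [sB WB BA nBw Bmax]] := @maximal_avoiding _ W A [set w] sW sA.
- by move=> a [].
- move=> b [_ [c pAc Qbc]] /= bw; rewrite bw in Qbc.
  have /QU : Q (- (w - c)) by exact: subgrpN.
  by apply; rewrite opprB subrKC.
have {}nBw : ~ B w by move=> /nBw; apply.
have QB : A `&` Q `<=` B.
  by move=> b [Ab Qb]; apply: WB; split => //; apply: sumset_subr => //; exact: subgrp0.
have oB : open_in A B.
  exists Q => //; apply: open_nbhs_nbhs; split => //; exact: subgrp0.
have clB : closed B by exact: open_in_closed clA sB BA sA oB.
apply: (nBw); apply: (Amin B sB clB BA) => // k _.
have [a Aa Mka] := AM k I.
have [s Bs] : exists s : int, B (a - w *~ s).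
  have [Ba|nBa] := pselect (B a); first by exists 0; rewrite mulr0z subr0.
  apply: (subgrp_modulo_prime pp sB nBw _ (Bmax a Aa nBa)).
  apply: WB; split; first exact: subgrpMn.
  by apply: sumset_subl; [exact: subgrp0|exists a].
exists (a - w *~ s) => //; rewrite (_ : _ - _ = (k - a) + w *~ s); last by zmod.
by apply: (subgrpD sM) => //; exact: subgrpMz.
Qed.

(** If the complement [A] of [M] had a nonzero element [a], there would be a dense
    subgroup [E] of [A] avoiding the nonzero multiples of [a], and [E + <a + x>]
    would be a dense subgroup of [K] with trivial intersection with [M]. *)
Lemma local_everything : essential_dense K -> forall k, closure (cyc x) k.
Proof.
move=> essK.
have [A [sA clA _ AM Amin]] := minimal_supplement cK (@closedT K) (@subgrpT K) sM clM.
have cA : compact A := subclosed_compact clA cK (@subsetT _ A).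
have AM0 := local_complement sA clA AM Amin.
have x0 : x != 0 by apply/eqP => x0; apply: nOx; rewrite x0; exact: subgrp0.
have [[a Aa a0]|nA] := pselect (exists2 a, A a & a != 0); last first.
  move=> k; have [a Aa Mka] := AM k I; apply: (local_generated Mx nOx).
  suff a0 : a = 0 by rewrite -[k]subr0 -a0.
  by apply/eqP/negPn/negP => a0; apply: nA; exists a.
have [n n0|E [sE EA AE Ea]] := dense_subgroup_avoiding_cyc hK cA sA _ Aa.
  by exists a => //; apply: contra a0 => /eqP/tfK ->.
pose H := sumset E (cyc (a + x)).
have sH : subgrp H by apply: subgrp_sumset => //; exact: subgrp_cyc.
have sP := subgrp_closure sH.
have EH : E `<=` H by apply: sumset_subl; exact: (subgrp0 (subgrp_cyc _)).
have AH : A `<=` closure H by apply: (subset_trans AE); exact: closureS.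
have Hx : closure H x.
  apply: (subgrp_addKl sP (AH _ Aa)); apply: subset_closure.
  by apply: sumset_subr; [exact: subgrp0|exact: cyc_id].
have MH : M `<=` closure H.
  apply: (subset_trans (local_generated Mx nOx)).
  by apply: closure_mono_sub; [exact: closed_closure|exact: cyc_sub].
have [||h [[e Ee [j _ hE]] Mh /eqP h0]] := essK H M sH _ sM clM.
- by move=> k; have [b /AH Hb /MH] := AM k I; exact: subgrp_subK.
- by exists x.
have ea0 : e + a *~ j = 0.
  apply: AM0; first by apply: (subgrpD sA (EA _ Ee)); exact: (subgrpMz j sA Aa).
  rewrite (_ : _ + _ = h - x *~ j); first by apply: (subgrpB sM Mh); exact: (subgrpMz j sM Mx).
  by rewrite -[h](subrK e) -hE; zmod.
have e0 : e = 0.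
  by apply: Ea => //; exists (- j) => //; rewrite mulrNz; apply/eqP; rewrite eq_sym -addr_eq0 ea0.
move: ea0 hE; rewrite e0 add0r subr0 => aj hE.
suff j0 : j = 0 by case: h0; rewrite -hE j0 mulr0z.
apply: contrapT => /eqP j0; case/eqP: a0; apply: (tfK (n := `|j|%N)); first by rewrite absz_gt0.
exact: (@subgrp_absz _ [set 0] a j (@subgrp_set0 _)).
Qed.

End Profinite.

Lemma essential_profinite_procyclic (K : topologicalZmodType) :
    hausdorff_space K -> compact [set: K] -> infinite_set [set: K] ->
    (forall U : set K, nbhs (0 : K) U -> exists Q : set K, [/\ subgrp Q, open Q & Q `<=` U]) ->
    essential_dense K ->
  exists p (x : K), [/\ prime p, (forall k : K, closure (cyc x) k),
    (forall Q : set K, subgrp Q -> open Q -> exists n, Q (x *+ p ^ n)),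
    (forall (y : K) n, (0 < n)%N -> y *+ n = 0 -> y = 0) &
    exists2 O : set K, ~ O x & forall k, O (k *+ p)].
Proof.
move=> hK cK iK baseK essK.
have uK := essential_compact_unbounded hK cK essK iK.
have tfK := unbounded_torsion_free hK cK essK uK.
have [y y0] := uK 1%N isT; rewrite mulr1n in y0.
have [p [O [z0 [pp sO oO nOz0 Ogen]]]] := prime_index_subgrp hK cK baseK y0.
have clO : closed O by exact: open_subgrp_closed.
have [M [sM clM _ OM Mmin]] := minimal_supplement cK (@closedT K) (@subgrpT K) sO clO.
have [x [Mx nOx]] : exists x, M x /\ ~ O x.
  apply: contrapT => nx; apply: nOz0; have [m Mm] := OM z0 I.
  apply: (subgrp_subK sO); apply: contrapT => nOm; apply: nx; by exists m.
exists p, x; split => //.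
- exact: (local_everything hK cK baseK tfK pp sO oO Ogen sM clM OM Mmin Mx nOx essK).
- exact: (local_power cK pp sO Ogen sM clM Mmin Mx nOx).
- by exists O => // k; exact: (Ogen k).1.
Qed.

(** * The p-adic integers *)

Section PadicInt.
Variable p : nat.

Definition pcoord n (z : padic_int p) : 'Z_(p ^ n.+1) := subgroup_val z n.

Lemma pcoordB n z z' : pcoord n (z - z') = pcoord n z - pcoord n z'.
Proof.
rewrite /pcoord.
have -> : subgroup_val (z - z') = subgroup_val z - subgroup_val z'.
  exact: (raddfB (val : padic_int p -> padic_product p)).
by [].
Qed.

Lemma pcoord_coherent n z : (pcoord n.+1 z : nat)%:R = pcoord n z.
Proof. by have /asboolP := valP z; apply. Qed.

Lemma pcoord_inj z z' : (forall n, pcoord n z = pcoord n z') -> z = z'.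
Proof. by move=> zz'; apply: val_inj; apply/functional_extensionality_dep => n; exact: zz'. Qed.

Lemma pcoord_lift (x : forall n, 'Z_(p ^ n.+1)) :
  (forall n, (x n.+1 : nat)%:R = x n) -> exists z, forall n, pcoord n z = x n.
Proof.
move=> cx; have px : (x : padic_product p) \in @padic_coherent p by apply/asboolP.
by exists (Sub (x : padic_product p) px : padic_int p) => n.
Qed.

Lemma pcoord_continuous n : continuous (pcoord n : padic_int p -> discrete_topology 'Z_(p ^ n.+1)).
Proof.
move=> z; apply: (@continuous_comp _ _ _ (@subgroup_val _ _)
  (fun x : padic_product p => x n)); first exact: subgroup_val_continuous.
exact: prod_proj_continuous.
Qed.

Lemma pcoord_continuous_to (T : topologicalType) (f : T -> padic_int p) :
  (forall n, continuous ((fun t => pcoord n (f t)) : T -> discrete_topology 'Z_(p ^ n.+1))) ->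
  continuous f.
Proof.
by move=> cf; apply: continuous_to_subgroup; apply: continuous_to_prod => n; exact: cf.
Qed.

Lemma intr_Zp_eq0 N (j : int) : (1 < N)%N -> (j%:~R == 0 :> 'Z_N) = (N %| `|j|)%N.
Proof.
move=> N1; have natr0 (m : nat) : (m%:R == 0 :> 'Z_N) = (N %| m)%N.
  by rewrite -val_eqE /= val_Zp_nat.
by case: (intP j) => [|m|m]; rewrite ?abszN ?rmorphN ?oppr_eq0 //= ?natr0.
Qed.

End PadicInt.

Section ProcyclicPadic.
Variables (K : topologicalZmodType) (p : nat) (x : K) (O : set K).
Hypotheses (hK : hausdorff_space K) (cK : compact [set: K]) (pp : prime p).
Hypothesis baseK : forall U : set K, nbhs (0 : K) U ->
  exists Q : set K, [/\ subgrp Q, open Q & Q `<=` U].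
Hypothesis tfK : forall (y : K) n, (0 < n)%N -> y *+ n = 0 -> y = 0.
Hypothesis genK : forall k : K, closure (cyc x) k.
Hypothesis powK : forall Q : set K, subgrp Q -> open Q -> exists n, Q (x *+ p ^ n).
Hypotheses (nOx : ~ O x) (pO : forall k : K, O (k *+ p)).

(** The [n]-th coordinate of [k] will be the residue of [i] modulo [p ^ n.+1], for
    any [i] with [k - i x] in [P n]. *)
Let P n := [set k *+ p ^ n.+1 | k in [set: K]].

Let q1 n : (1 < p ^ n.+1)%N.
Proof. by rewrite -(exp1n n.+1) ltn_exp2r // prime_gt1. Qed.

Let sP n : subgrp (P n).
Proof. exact: (subgrp_mulrn _ (@subgrpT K)). Qed.

Let cP n : closed (P n).
Proof. by apply: compact_closed => //; exact: compact_mulrn. Qed.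

Let PS n : P n.+1 `<=` P n.
Proof. by move=> _ [k _ <-]; exists (k *+ p) => //; rewrite -mulrnA -expnS. Qed.

Let Pgen n k : exists2 i, i \in iota 0 (p ^ n.+1) & P n (k - x *+ i).
Proof.
pose S := [set y | y \in [seq x *+ i | i <- iota 0 (p ^ n.+1)]].
have clB : closed (sumset S (P n)).
  by apply: closed_sumset => //; exact: compact_seq.
have xB : cyc x `<=` sumset S (P n).
  move=> _ [j _ <-].
  have N0 : (p ^ n.+1)%N%:Z != 0 by rewrite -absz_eq0 /= -lt0n ltnW.
  pose i := `|(j %% (p ^ n.+1)%N)%Z|%N.
  have iE : i%:Z = (j %% (p ^ n.+1)%N)%Z by rewrite gez0_abs // modz_ge0.
  exists (x *+ i).
    apply/mapP; exists i => //; rewrite mem_iota add0n -ltz_nat iE ltz_pmod //.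
    by rewrite ltz_nat ltnW.
  exists (x *~ (j %/ (p ^ n.+1)%N)%Z) => //.
  rewrite -[x *+ i]/(x *~ i%:Z) iE {2}(divz_eq j (p ^ n.+1)%N); zmod.
have [y /mapP[i im ->] Py] := closure_mono_sub clB xB (@genK k).
by exists i.
Qed.

Let Popen n : nbhs (0 : K) (P n).
Proof.
have [V nV VP] : open_in [set: K] (P n).
  apply: (@finite_index_open _ _ _ [seq x *+ i | i <- iota 0 (p ^ n.+1)]) => // k _.
  by have [i im Pk] := Pgen n k; exists (x *+ i) => //; exact: map_f.
by apply: filterS nV => v Vv; exact: VP.
Qed.

(** The coordinates are well defined because [x] is not divisible by [p]. *)
Let Puniq n (j : int) : P n (x *~ j) -> (p ^ n.+1 %| `|j|)%N.
Proof.
move=> Pxj; have sPn := sP n.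
have [|m [m0 Pm mdiv]] := @subgrp_mult_min _ (P n) x sPn.
  by exists (p ^ n.+1)%N; [rewrite ltnW|exists x].
have /mdiv : P n (x *~ (p ^ n.+1)%N%:Z) by exists x.
rewrite /= => /(dvdn_pfactor _ _ pp)[b bn mE].
have [bE|bn'] := eqVneq b n.+1; first by rewrite -bE -mE; exact: mdiv.
have {}bn : (b < n.+1)%N by rewrite ltn_neqAle bn'.
case: Pm => k _; rewrite mE => kx; case: nOx.
suff -> : x = k *+ p ^ (n - b) *+ p by exact: pO.
apply/eqP; rewrite eq_sym -subr_eq0; apply/eqP; apply: (tfK (n := p ^ b)).
  by rewrite expn_gt0 prime_gt0.
rewrite mulrnBl -kx -!mulrnA -expnS -expnD.
by rewrite (_ : n - b + b.+1 = n.+1)%N ?subrr //; lia.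
Qed.

Let Psmall U : nbhs (0 : K) U -> exists n, P n `<=` U.
Proof.
move=> /baseK[Q [sQ oQ QU]]; have [n Qn] := powK sQ oQ; exists n => _ [k _ <-]; apply: QU.
have nQ : nbhs (0 : K) Q by apply: open_nbhs_nbhs; split => //; exact: subgrp0.
have /closure_nbhs0 /(_ _ nQ)[_ [j _ <-] Qj] := @genK k.
rewrite (_ : _ *+ _ = (x *+ p ^ n *+ p) *~ j - (x *~ j - k) *+ p ^ n.+1).
  by apply: (subgrpB sQ); [apply: subgrpMz => //; exact: subgrpMn|exact: subgrpMn].
by rewrite expnSr; zmod.
Qed.

Let coord_ex (k : K) : exists z : padic_int p, forall n (i : int),
  (pcoord n z = i%:~R) <-> P n (k - x *~ i).
Proof.
have [i iP] : {i : nat -> nat & forall n, P n (k - x *+ i n)}.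
  by apply: (@choice _ _ (fun n i => P n (k - x *+ i))) => n; have [i _ Pi] := Pgen n k; exists i.
have char n (j : int) : (i n)%:R = j%:~R :> 'Z_(p ^ n.+1) <-> P n (k - x *~ j).
  have -> : ((i n)%:R = j%:~R :> 'Z_(p ^ n.+1)) <-> (p ^ n.+1 %| `|(i n)%:Z - j|)%N.
    rewrite -(intr_Zp_eq0 _ (q1 n)) intrB subr_eq0 -pmulrn.
    by split=> [->|/eqP].
  split=> [/dvdnP[m mE]|Pj].
    rewrite (_ : _ - _ = (k - x *+ i n) + x *~ ((i n)%:Z - j)); last by zmod.
    apply: (subgrpD (sP n)) => //.
    have : P n (x *+ (m * p ^ n.+1)) by exists (x *+ m) => //; rewrite -mulrnA.
    rewrite -mE; case: (intP ((i n)%:Z - j)) => [|l|l] //.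
    by rewrite abszN mulrNz => /(subgrpN (sP n)).
  apply: Puniq; rewrite (_ : x *~ _ = (k - x *~ j) - (k - x *+ i n)); last by zmod.
  exact: (subgrpB (sP n)).
have [|z zE] := @pcoord_lift p (fun n => (i n)%:R : 'Z_(p ^ n.+1)).
  move=> n; apply/esym; rewrite [RHS]pmulrn; apply/char/PS.
  by apply/(char n.+1); rewrite -pmulrn natr_Zp.
by exists z => n j; rewrite zE; exact: char.
Qed.

Lemma procyclic_padic : topologically_isomorphic K (padic_int p).
Proof.
have [f fP'] := choice coord_ex.
have fP k n (i : int) : pcoord n (f k) = i%:~R <-> P n (k - x *~ i) by exact: fP'.
have fI k n : exists i : nat, pcoord n (f k) = i%:R /\ P n (k - x *+ i).
  have [i _ Pi] := Pgen n k; exists i; split => //.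
  by rewrite [RHS]pmulrn; exact/(fP k).
have fB : {morph f : k k' / k - k'}.
  move=> k k'; apply: pcoord_inj => n; rewrite pcoordB.
  have [i [-> Pi]] := fI k n; have [i' [-> Pi']] := fI k' n.
  rewrite !pmulrn -intrB; apply/fP.
  rewrite (_ : _ - _ = (k - x *+ i) - (k' - x *+ i')); last by zmod.
  exact: (subgrpB (sP n)).
have f0 k n : pcoord n (f k) = 0 <-> P n k.
  by have := fP k n 0; rewrite mulr0z subr0.
have g_ex z : exists k, f k = z.
  have [|||k _ kz] := @compact_directed K setT nat
    (fun n => [set k | P n (k - x *+ pcoord n z)]) 0 cK.
  - by move=> n; exact: closed_translate.
  - have step n l : [set k | P (n + l)%N (k - x *+ pcoord (n + l) z)] `<=`
        [set k | P n (k - x *+ pcoord n z)].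
      elim: l => [|l IHl]; first by rewrite addn0.
      rewrite addnS => k /= Pk; apply: IHl => /=.
      have h := iffRL (fP k (n + l).+1 (pcoord (n + l).+1 z : nat)) Pk.
      apply: (iffLR (fP k (n + l)%N (pcoord (n + l) z : nat))); rewrite -pmulrn natr_Zp.
      rewrite -(pcoord_coherent (n + l) (f k)) (_ : pcoord _ (f k) = pcoord (n + l).+1 z).
        exact: pcoord_coherent.
      by rewrite h -pmulrn natr_Zp.
    move=> m n; exists (m + n)%N => k Pk; split; first exact: step Pk.
    by move: Pk; rewrite addnC; exact: step.
  - move=> n; exists (x *+ pcoord n z); split => //=.
    by rewrite subrr; exact: subgrp0.
  exists k; apply: pcoord_inj => n.
  rewrite (iffRL (fP k n (pcoord n z : nat)) (kz n)).
  by rewrite -pmulrn natr_Zp.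
have [g gK] := choice g_ex.
have fK : cancel f g.
  move=> k; apply/eqP; rewrite -subr_eq0; apply/negPn/negP => gk0.
  have [V [_ nV _ nVz]] := hausdorff_notin hK gk0.
  have [n PnV] := Psmall nV; apply/nVz/PnV/f0.
  by rewrite fB gK pcoordB subrr.
have fadd := GRing.isZmodMorphism.Build K (padic_int p) f fB.
pose F : {additive K -> padic_int p} := HB.pack f fadd.
exists F, g; split => //.
- apply: pcoord_continuous_to => n k; apply/discrete_cvg.
  apply/nbhs0P; apply: filterS (Popen n) => h Ph /=.
  apply/eqP; rewrite -subr_eq0 -pcoordB -fB; apply/eqP/f0.
  by rewrite addrAC subrr add0r.
- move=> z U /nbhs0P /Psmall[n PU].
  have : nbhs z [set z' | pcoord n z' = pcoord n z].
    by apply: (@pcoord_continuous p n z [set pcoord n z]); exact: discrete_set1.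
  apply: filterS => z' /= zz'; rewrite /= -(subrKC (g z) (g z')); apply: PU; apply/f0.
  by rewrite fB !gK pcoordB zz' subrr.
Qed.

End ProcyclicPadic.

(** * Subgroups of the p-adic integers are minimal *)

Section GroupTopology.
(** An alias of [G], on which the topology that is inferred is [tau]. *)
Definition topologized (G : zmodType) (tau : Topological G)
  (_ : is_group_topology tau) : Type := G.

Variables (G : zmodType) (tau : Topological G) (tauG : is_group_topology tau).
Local Notation T := (Topological.Pack tau).
Local Notation with_topology := (topologized tauG).

HB.instance Definition _ := GRing.Zmodule.copy with_topology G.

Let topT : (@open T : set (set G)) setT. Proof. exact: openT. Qed.
Let topI : setI_closed (@open T : set (set G)). Proof. by move=> A B; exact: (@openI T A B). Qed.
Let top_bigU (I : Type) (f : I -> set G) : (forall i, (@open T : set (set G)) (f i)) ->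
  (@open T : set (set G)) (\bigcup_i f i).
Proof. by move=> of_; apply: bigcup_open => i _; exact: of_. Qed.

HB.instance Definition _ := isOpenTopological.Build with_topology topT topI top_bigU.

Lemma with_topology_openE (A : set G) : @open with_topology A = @open T A.
Proof. by []. Qed.

Lemma with_topology_nbhsE (x : G) (A : set G) : @nbhs _ with_topology x A <-> @nbhs _ T x A.
Proof. by rewrite !nbhsE; split=> -[B [oB Bx] BA]; exists B. Qed.

Lemma with_topology_sub_continuous :
  continuous (fun z : with_topology * with_topology => z.1 - z.2).
Proof.
move=> [x y] A /with_topology_nbhsE Axy; have [addT oppT] := tauG.
have [[X Y] /= [nX nY] XYA] := addT (x, - y) A Axy.
have nY' := oppT y Y nY.
exists (X, [set z : G | Y (- z)]) => /=; first by split; apply/with_topology_nbhsE.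
by move=> [a b] [/= Xa Yb]; exact: (XYA (a, - b)).
Qed.

HB.instance Definition _ :=
  PreTopologicalNmodule_isTopologicalZmodule.Build with_topology with_topology_sub_continuous.

Lemma with_topology_hausdorff : hausdorff_space T -> hausdorff_space with_topology.
Proof.
move=> hT x y xy; apply: hT => A B nA nB; apply: xy; exact/with_topology_nbhsE.
Qed.

End GroupTopology.

Section ChainOfSubgroups.
Variables (K : topologicalZmodType) (D : nat -> set K).
Hypothesis hK : hausdorff_space K.
Hypothesis sD : forall n, subgrp (D n).
Hypothesis baseD : forall U : set K, nbhs (0 : K) U -> exists n, D n `<=` U.
Hypothesis finD : forall n, exists s : seq K, forall k, exists2 c, c \in s & D n (k - c).
Hypothesis genD : forall n m a b, ~ D n a -> D n b -> exists j : int, D m (b - a *~ j).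
Hypothesis divD : forall n a, a != 0 -> exists i, a *+ i != 0 /\ D n (a *+ i).

Let hausdorff_subgroup (L : zmodClosed K) : hausdorff_space (subgroup L).
Proof.
move=> s t st; apply: val_inj; apply: hK => A B nA nB.
have [||u [Au Bu]] := st (@subgroup_val K L @^-1` A) (@subgroup_val K L @^-1` B).
- exact: (@subgroup_val_continuous K L s A nA).
- exact: (@subgroup_val_continuous K L t B nB).
by exists (subgroup_val u).
Qed.

(** The closure [Q] of [D m] in a coarser Hausdorff topology on a subgroup is
    a subgroup of finite index, hence open.  If [s] is a nonzero element of
    [D n], then [s] is not in [Q] for [m] large, because a small closed
    neighbourhood avoiding [s] contains [D m]; and then [Q] is contained in
    [D n], since any element outside [D n] generates [s] modulo [D m]. *)
Lemma chain_hereditarily_minimal : hereditarily_minimal K.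
Proof.
move=> L; set S := subgroup L; split; first exact: hausdorff_subgroup.
move=> [tau [tauG htau [tauS]]]; apply.
pose T : topologicalZmodType := topologized tauG.
have hT : hausdorff_space T by exact: with_topology_hausdorff.
pose val' (s : T) : K := subgroup_val (s : S).
have valB (s t : T) : val' (s - t) = val' s - val' t.
  exact: (raddfB (val : S -> K)).
have valMz (s : T) j : val' (s *~ j) = val' s *~ j.
  exact: (raddfMz (val : S -> K) j s).
pose E n : set T := [set s : T | D n (val' s)].
have sE n : subgrp (E n).
  split; first by rewrite /E /=; exact: (subgrp0 (sD n)).
  by move=> s t Es Et; change (D n (val' (s - t))); rewrite valB; exact: (subgrpB (sD n)).
have finE m : exists s : seq T, forall t, exists2 c, c \in s & E m (t - c).
  have [s sP] := finD m.
  have [r rP] : {r : K -> S & forall c (a : S), D m (val' a - c) -> D m (val' (r c) - c)}.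
    apply: (@choice _ _ (fun c b => forall a : S, D m (val' a - c) -> D m (val' b - c))) => c.
    have [[a Da]|na] := pselect (exists a : S, D m (val' a - c)); first by exists a.
    by exists 0 => a Da; case: na; exists a.
  exists (map r s) => t; have [c cs Dc] := sP (val' t); exists (r c); first exact: map_f.
  change (D m (val' (t - r c))); rewrite valB (_ : _ - _ = (val' t - c) - (val' (r c) - c)); last by zmod.
  by apply: (subgrpB (sD m)) => //; exact: rP Dc.
have coarse (U : set T) : nbhs (0 : T) U -> exists m, E m `<=` U.
  rewrite nbhsE => -[V [oV V0] VU].
  have : nbhs (0 : S) (V : set S) by apply: open_nbhs_nbhs; split => //; exact: tauS.
  move=> /subgroup_nbhs0P[W /baseD[m DW] WV]; exists m => s Es; apply/VU/WV/DW; exact: Es.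
have nE n : nbhs (0 : T) (E n).
  have [[s0 s00]|nS] := pselect (exists s : S, s != 0); last first.
    apply: filterE => s; rewrite (_ : s = 0); first exact: (subgrp0 (sE n)).
    by apply/eqP/negPn/negP => s0; apply: nS; exists s.
  have [|i [si Di]] := @divD n (val' s0); first by rewrite -(inj_eq val_inj) in s00.
  have vi : val' (s0 *+ i) = val' s0 *+ i by exact: (raddfMn (val : S -> K) i s0).
  pose s : T := s0 *+ i.
  have Es : E n s by rewrite /E /= vi.
  have sn0 : s != 0 by apply: contra si => /eqP si0; rewrite -vi -/s si0.
  have [V [clV nV _ nVs]] := hausdorff_notin hT sn0.
  have [m EV] := coarse V nV.
  pose Q := closure (E m).
  have sQ : subgrp Q by exact: subgrp_closure.
  have EQ : E m `<=` Q by exact: subset_closure.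
  have nQs : ~ Q s by move=> /(closure_mono_sub clV EV).
  have QE : Q `<=` E n.
    move=> t Qt; apply: contrapT => nEt; apply: nQs.
    have [j Dj] := @genD n m (val' t) (val' s) nEt Es.
    rewrite -(subrK (t *~ j) s); apply: (subgrpD sQ); last exact: (subgrpMz j sQ Qt).
    by apply: EQ; change (D m (val' (s - t *~ j))); rewrite valB valMz.
  have [c cP] := finE m.
  have [U nU UQ] : open_in [set: T] Q.
    apply: (@finite_index_open _ _ _ c) => //; first exact: closed_closure.
    by move=> t _; have [d dc Ed] := cP t; exists d => //; exact: EQ.
  by apply: filterS nU => t Ut; apply/QE/UQ.
move=> U oU; rewrite -(with_topology_openE tauG) (@openE (topologized tauG)).
move=> s Us; apply/(@nbhs0P T).
have : nbhs (s : S) (U : set S) by apply: open_nbhs_nbhs; split.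
move=> /nbhs0P /subgroup_nbhs0P[W /baseD[m DW] WU].
by apply: filterS (nE m) => t Et; apply/WU/DW.
Qed.

End ChainOfSubgroups.

Section PadicChain.
Variables (p : nat) (K : topologicalZmodType).
Hypotheses (pp : prime p) (hK : hausdorff_space K).
Variables (f : {additive K -> padic_int p}) (g : padic_int p -> K).
Hypotheses (fK : cancel f g) (cg : continuous g).

Let q1 n : (1 < p ^ n.+1)%N.
Proof. by rewrite -(exp1n n.+1) ltn_exp2r // prime_gt1. Qed.

Let c n (k : K) : 'Z_(p ^ n.+1) := pcoord n (f k).

Let cB n k l : c n (k - l) = c n k - c n l.
Proof. by rewrite /c raddfB pcoordB. Qed.

Let c0 n : c n 0 = 0.
Proof. by rewrite -(subrr 0) cB subrr. Qed.

Let cD n k l : c n (k + l) = c n k + c n l.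
Proof. by rewrite -{1}[l]opprK cB -[- l]sub0r cB c0 sub0r opprK. Qed.

Let cMn n k i : c n (k *+ i) = c n k *+ i.
Proof. by elim: i => [|i IHi]; rewrite ?mulr0n ?c0 // !mulrS cD IHi. Qed.

Let cS n k : (c n.+1 k : nat)%:R = c n k.
Proof. exact: pcoord_coherent. Qed.

Let c_nat0 n (i : nat) : (i%:R == 0 :> 'Z_(p ^ n.+1)) = (p ^ n.+1 %| i)%N.
Proof. by rewrite pmulrn (intr_Zp_eq0 i (q1 n)). Qed.

Let c_down n l k : (c (n + l) k : nat)%:R = c n k.
Proof.
elim: l => [|l IHl]; first by rewrite addn0 natr_Zp.
rewrite -IHl addnS -[in RHS]cS.
rewrite (val_Zp_nat (q1 _)) -[LHS](Zp_nat_mod (q1 n)) -[RHS](Zp_nat_mod (q1 n)) modn_dvdm //.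
by rewrite dvdn_exp2l // ltnS leq_addr.
Qed.

Definition padic_chain n : set K := [set k | forall i, (i < n)%N -> c i k = 0].

Let chainS n k : padic_chain n.+1 k <-> c n k = 0.
Proof.
split=> [h|ck i]; first exact: h.
by rewrite ltnS => /subnKC ni; rewrite -(c_down i (n - i)) ni ck.
Qed.

Let chain_mono n m : (n <= m)%N -> padic_chain m `<=` padic_chain n.
Proof. by move=> nm k h i ni; apply: h; exact: leq_trans nm. Qed.

(** The chain is that of the subgroups [p ^ n Z_p]: an element [a] outside
    [p ^ n Z_p] has a smaller valuation than any [b] inside, so that it divides
    [b] modulo [p ^ m]. *)
Lemma padic_subgroups_minimal : hereditarily_minimal K.
Proof.
apply: (@chain_hereditarily_minimal K padic_chain hK).
- move=> n; split=> [i _|k l hk hl i ni]; first exact: c0.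
  by rewrite cB hk // hl // subrr.

- move=> U nU.
  have : nbhs (0 : padic_int p) (g @^-1` U).
    by apply: cg; rewrite (_ : g 0 = 0) // -(raddf0 f) fK.
  move=> /subgroup_nbhs0P[V nV VU].
  suff [n nP] : exists n, forall z : padic_product p, (forall i, (i < n)%N -> z i = 0) -> V z.
    by exists n => k hk; rewrite -(fK k); apply/VU/nP => i /hk.
  pose F (n : nat) : set (padic_product p) := [set z | forall i, (i < n)%N -> z i = 0].
  have FF : Filter (filter_from setT F).
    apply: filter_fromT_filter; first by exists 0%N.
    by move=> n m; exists (maxn n m) => z Fz; split=> i ni; apply: Fz;
      rewrite leq_max ni ?orbT.
  suff : filter_from setT F --> (0 : padic_product p) by move=> /(_ V nV)[n _ FV]; exists n.
  apply/cvg_sup => i A [_ [[B oB <-] B0 BA]]; exists i.+1 => // z Fz; apply: BA.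
  by rewrite /= Fz.
- move=> [|n]; first by exists [:: 0] => k; exists 0; rewrite ?mem_head.
  have [r rP] : {r : 'Z_(p ^ n.+1) -> K & forall u k, c n k = u -> c n (r u) = u}.
    apply: (@choice _ _ (fun u r => forall k, c n k = u -> c n r = u)) => u.
    have [[k ku]|nk] := pselect (exists k, c n k = u); first by exists k.
    by exists 0 => k ku; case: nk; exists k.
  exists (map r (enum 'Z_(p ^ n.+1))) => k; exists (r (c n k)).
    by apply: map_f; rewrite mem_enum.
  by apply/chainS; rewrite cB (rP _ k) // subrr.
- move=> [|n] m a b; first by move=> nDa; case: nDa.
  move=> na nb; have {}na : c n a != 0 by apply/eqP => /chainS.
  have {}nb : c n b = 0 by apply/chainS.
  have [mn|nm] := leqP m n.+1.
    by exists 0; rewrite mulr0z subr0; apply: (chain_mono mn); apply/chainS.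
  have mE : m = (n + (m - n.+1)).+1 by lia.
  set M := (n + (m - n.+1))%N in mE; set u : nat := c M a; set v : nat := c M b.
  have nu : ~~ (p ^ n.+1 %| u)%N by rewrite -c_nat0 c_down.
  have nv : (p ^ n.+1 %| v)%N by rewrite -c_nat0 c_down nb.
  have u0 : (0 < u)%N by rewrite lt0n; apply: contra nu => /eqP ->.
  (* The Bezout relation expresses [gcd (u, p ^ M.+1)], which divides [v], as a
     multiple of [u] modulo [p ^ M.+1]. *)
  have [w t wt _] := egcdnP (p ^ M.+1) u0.
  have [i iM gE] : exists2 i, (i <= M.+1)%N & gcdn u (p ^ M.+1) = (p ^ i)%N.
    by apply/(dvdn_pfactor _ _ pp); exact: dvdn_gcdr.
  have iv : (p ^ i %| v)%N.
    apply: dvdn_trans nv; rewrite dvdn_exp2l // leqNgt; apply: contra nu => /ltnW ni.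
    by apply: (@dvdn_trans (p ^ i)); [rewrite dvdn_exp2l|rewrite -gE dvdn_gcdl].
  move: iv => /dvdnP[y yE]; exists (w * y)%N; rewrite mE; apply/chainS.
  rewrite cB -[a *~ _]/(a *+ (w * y)) cMn -(natr_Zp (c M a)) -(natr_Zp (c M b)) -/u -/v.
  rewrite -mulrnA (_ : (u * (w * y) = t * p ^ M.+1 * y + v)%N); last first.
    by rewrite mulnA [(u * w)%N]mulnC wt gE mulnDl yE [(p ^ i * y)%N]mulnC.
  have tq : (t * p ^ M.+1 * y)%:R = 0 :> 'Z_(p ^ M.+1).
    by apply/eqP; rewrite c_nat0 mulnAC dvdn_mull.
  by rewrite natrD tq add0r subrr.
- move=> j k k0.
  have [n cn] : exists n, c n k != 0.
    apply: contrapT => nc; suff fk : f k = f 0.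
      by move/eqP: k0; apply; rewrite -(fK k) fk fK.
    apply: pcoord_inj => n; apply: etrans (esym (c0 n)).
    by apply/eqP/negPn/negP => cn; apply: nc; exists n.
  exists (p ^ j)%N; split.
    apply: contra_not_neq (negP cn) => kj0.
    have := cMn (n + j) k (p ^ j); rewrite kj0 c0 => /esym/eqP.
    rewrite -(natr_Zp (c (n + j) k)) -mulrnA c_nat0 -[c n k](c_down n j) c_nat0.
    move: (nat_of_ord _) => v; rewrite -addSn expnD dvdn_pmul2r //.
    by rewrite expn_gt0 prime_gt0.
  move=> i ij; rewrite cMn -(natr_Zp (c i k)) -mulrnA; apply/eqP; rewrite c_nat0.
  by rewrite dvdn_mull // dvdn_exp2l.
Qed.

End PadicChain.

(** * The equivalence *)

Theorem theoremC (K : topologicalZmodType) (K_hausdorff : hausdorff_space K)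
    (K_infinite : infinite_set [set: K])
    (K_locally_compact : locally_compact [set: K]) :
  [<-> hereditarily_minimal K;
       densely_minimal K;
       exists2 p : nat, prime p & topologically_isomorphic K (padic_int p)].
Proof.
tfae.
- by move=> hK L _; exact: hK.
- move=> dK.
  have essK : essential_dense K.
    by move=> H N sH dH sN cN N0; exact: (densely_minimal_essential K_hausdorff dK).
  have cycK (x : K) : compact (closure (cyc x)).
    apply: recurrent_cyc_compact => // W nW.
    exact: (densely_minimal_cyc_recurrent K_hausdorff dK).
  have C0 := component_trivial K_hausdorff K_locally_compact essK cycK.
  have baseK U : nbhs (0%R : K) U -> exists Q : set K, [/\ subgrp Q, open Q & Q `<=` U].
    by move=> /(open_compact_subgroup K_locally_compact C0)[Q [sQ oQ _ QU]]; exists Q.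
  have cK : compact [set: K].
    apply: densely_minimal_compact => // U; exact: open_compact_subgroup.
  have [p [x [pp genK powK tfK [O nOx pO]]]] :=
    essential_profinite_procyclic K_hausdorff cK K_infinite baseK essK.
  by exists p => //; exact: (procyclic_padic K_hausdorff cK pp baseK tfK genK powK nOx pO).
- move=> [p pp [f [g [fK _ _ cg]]]].
  exact: (padic_subgroups_minimal pp K_hausdorff fK cg).
Qed.
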